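(* Let $G$ be a torsionfree discrete countable group such that every non-zero element of $\mathbb Z G$ acts without kernel on $\ell^2 G$. If $\beta_1^{(2)}(G)\neq 0$, then the reduced group $C^*$-algebra $C^*_{red}(G)$ is simple and carries a unique trace.
   Context: $\mathbb Z G$ acts on the Hilbert space $\ell^2 G$ via the linear extension of the left regular representation $\lambda$; ''without kernel'' means injectively. $C^*_{red}(G)$ is the norm closure of the linear span of $\lambda(G)$ in $B(\ell^2 G)$; ''trace'' means tracial state. $\beta_1^{(2)}(G)=\dim_{LG}H_1(G;LG)$ is the first $\ell^2$-Betti number, where $LG$ is the group von Neumann algebra and $\dim_{LG}$ is Lück's dimension function. *)

(* Defs.v *)
From HB Require Import structures.
From mathcomp Require Import all_boot all_order all_algebra.
From mathcomp Require Import finmap complex ring lra.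
From mathcomp.multinomials Require Import freeg.
From mathcomp Require Import all_classical all_reals all_analysis.
From mathcomp.analysis.showcase Require Import summability.

Set Implicit Arguments.
Unset Strict Implicit.
Unset Printing Implicit Defensive.

Import Order.TTheory GRing.Theory Num.Theory.
Import numFieldNormedType.Exports.
Local Open Scope classical_set_scope.
Local Open Scope ring_scope.

Definition sqmod (R : realType) (z : R[i]) : R :=
  complex.Re z ^+ 2 + complex.Im z ^+ 2.

Lemma sqmod_ge0 (R : realType) (z : R[i]) : 0 <= sqmod z.
Proof. by rewrite addr_ge0 ?sqr_ge0. Qed.

Lemma sqmodM (R : realType) (z w : R[i]) : sqmod (z * w) = sqmod z * sqmod w.
Proof. by case: z => a b; case: w => c d; rewrite /sqmod /=; ring. Qed.

Lemma sqmodD_le (R : realType) (z w : R[i]) :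
  sqmod (z + w) <= 2 * sqmod z + 2 * sqmod w.
Proof.
case: z => a b; case: w => c d; rewrite /sqmod /= -subr_ge0.
have -> : 2 * (a ^+ 2 + b ^+ 2) + 2 * (c ^+ 2 + d ^+ 2)
  - ((a + c) ^+ 2 + (b + d) ^+ 2) = (a - c) ^+ 2 + (b - d) ^+ 2 by ring.
by rewrite addr_ge0 ?sqr_ge0.
Qed.

Section sqsum.
Variables (R : realType) (G : choiceType).
Implicit Types f g : G -> R[i].

Definition sqsum f : \bar R := \esum_(x in [set: G]) (sqmod (f x))%:E.

Lemma sqsum_ge0 f : (0 <= sqsum f)%E.
Proof. by apply: esum_ge0 => x _; rewrite lee_fin sqmod_ge0. Qed.

Lemma sqsum0 : sqsum (fun=> 0) = 0%E.
Proof. by apply: esum1 => x _; rewrite /sqmod /= expr0n /= addr0. Qed.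

Lemma sqsumD f g :
  (sqsum (fun x => (f x + g x)%R) <= 2%:E * sqsum f + 2%:E * sqsum g)%E.
Proof.
rewrite !(mule_natl _ 2) !mule2n /sqsum.
have ge0 h x : [set: G] x -> (0 <= (sqmod (h x : R[i]))%:E)%E.
  by rewrite lee_fin sqmod_ge0.
rewrite -!esumD; try by move=> x _; rewrite ?adde_ge0 ?lee_fin ?sqmod_ge0.
apply: le_esum => x _; rewrite -!EFinD lee_fin.
by apply: le_trans (sqmodD_le _ _) _; rewrite !mulr_natl !mulr2n.
Qed.

Lemma sqsumZ_le (c : R[i]) f :
  (sqsum (fun x => (c * f x)%R) <= (sqmod c)%:E * sqsum f)%E.
Proof.
apply: ub_ereal_sup => _ [A [finA _] <-].
under eq_fsbigr do rewrite sqmodM EFinM.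
rewrite -ge0_mule_fsumr; last by move=> x; rewrite lee_fin sqmod_ge0.
rewrite lee_wpmul2l ?lee_fin ?sqmod_ge0//.
by apply: ereal_sup_ubound; exists A.
Qed.

Definition square_summable : {pred G -> (R[i])^o} :=
  [pred f | (sqsum f < +oo)%E].

Fact square_summable_submod_closed : submod_closed square_summable.
Proof.
split=> [|c f g]; rewrite !inE.
  by rewrite (_ : sqsum _ = 0%E) ?ltry// -[RHS]sqsum0.
move=> foo goo; apply: le_lt_trans (sqsumD (fun x => c * f x) g) _.
rewrite lte_add_pinfty ?lte_mul_pinfty ?lee_fin//.
apply: le_lt_trans (sqsumZ_le c f) _.
by rewrite lte_mul_pinfty ?lee_fin ?sqmod_ge0.
Qed.

HB.instance Definition _ := GRing.isSubmodClosed.Build _ _ square_summable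
  square_summable_submod_closed.

Record ell2 := Ell2 { ell2_val :> G -> (R[i])^o ; _ : ell2_val \in square_summable }.
HB.instance Definition _ := [isSub for ell2_val].
HB.instance Definition _ := [Choice of ell2 by <:].
HB.instance Definition _ := [SubChoice_isSubLmodule of ell2 by <:].

End sqsum.
Arguments ell2 : clear implicits.

Section hilbert.
Variables (R : realType) (G : choiceType).
Implicit Types xi eta : ell2 R G.

Definition l2norm xi : R := Num.sqrt (fine (sqsum xi)).

(* The sum over G is the unconditional one: the limit of the finite partial
   sums along the finite subsets of G ordered by inclusion. *)
Definition inner xi eta : R[i] :=
  summability.sum (fun x : G => (xi x * (eta x)^* : (R[i])^o)).

Lemma l2norm_ge0 xi : 0 <= l2norm xi.
Proof. exact: sqrtr_ge0. Qed.

Lemma sqsum_fin_num xi : sqsum xi \is a fin_num.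
Proof. by rewrite ge0_fin_numE ?sqsum_ge0//; case: xi. Qed.

Lemma fine_sqsum_ge0 xi : 0 <= fine (sqsum xi).
Proof. by rewrite fine_ge0 ?sqsum_ge0. Qed.

Lemma sqr_l2norm xi : l2norm xi ^+ 2 = fine (sqsum xi).
Proof. by rewrite sqr_sqrtr ?fine_sqsum_ge0. Qed.

Lemma l2normD_le xi eta : l2norm (xi + eta) <= 2 * (l2norm xi + l2norm eta).
Proof.
have h : fine (sqsum (xi + eta)) <= 2 * fine (sqsum xi) + 2 * fine (sqsum eta).
  rewrite -lee_fin EFinD !EFinM !fineK ?sqsum_fin_num//; exact: sqsumD.
have h0 : 0 <= 2 * (l2norm xi + l2norm eta).
  by rewrite mulr_ge0// addr_ge0// l2norm_ge0.
rewrite -(@ler_pXn2r _ 2)// ?nnegrE ?l2norm_ge0//.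
rewrite sqr_l2norm; apply: le_trans h _; rewrite -!sqr_l2norm.
have := l2norm_ge0 xi; have := l2norm_ge0 eta; nra.
Qed.

Lemma l2normZ_le (c : R[i]) xi :
  l2norm (c *: xi) <= Num.sqrt (sqmod c) * l2norm xi.
Proof.
rewrite -sqrtrM ?sqmod_ge0// ler_wsqrtr// -lee_fin EFinM !fineK ?sqsum_fin_num//.
exact: sqsumZ_le.
Qed.

Definition bounded_linear : {pred ell2 R G -> ell2 R G} :=
  [pred T | `[< linear T /\
                exists M : R, forall xi, l2norm (T xi) <= M * l2norm xi >]].

Fact bounded_linear_submod_closed : submod_closed bounded_linear.
Proof.
split=> [|c S T]; rewrite !inE.
  split=> [a u v|]; first by rewrite /= scaler0 addr0.
  exists 0 => xi; rewrite mul0r; have := l2normZ_le 0 (0 : ell2 R G).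
  by rewrite scaler0 /sqmod /= expr0n /= addr0 sqrtr0 mul0r.
move=> [linS [M HM]] [linT [N HN]]; split.
  move=> a u v; rewrite !fctE /= linS linT !scalerDr !scalerA [c * a]mulrC.
  by rewrite -!addrA; congr (_ + _); rewrite addrCA.
exists (2 * (Num.sqrt (sqmod c) * M + N)) => xi; rewrite !fctE /=.
apply: le_trans (l2normD_le _ _) _; rewrite -mulrA ler_pM2l// mulrDl lerD//.
by apply: le_trans (l2normZ_le _ _) _; rewrite -mulrA ler_wpM2l ?sqrtr_ge0.
Qed.

HB.instance Definition _ := GRing.isSubmodClosed.Build _ _ bounded_linear
  bounded_linear_submod_closed.

(* B(l^2 G); its ring product, declared below, is composition. *)
Record bop := Bop {
  bop_fun :> ell2 R G -> ell2 R G ; _ : bop_fun \in bounded_linear }.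
HB.instance Definition _ := [isSub for bop_fun].
HB.instance Definition _ := [Choice of bop by <:].
HB.instance Definition _ := [SubChoice_isSubLmodule of bop by <:].

Lemma bop_ext (S T : bop) : S =1 T -> S = T.
Proof. by move=> ST; apply/val_inj/funext. Qed.

Lemma bop_linear (T : bop) : linear T.
Proof. by case: T => T /= /asboolP[]. Qed.

Lemma bop_bounded (T : bop) :
  exists M : R, forall xi, l2norm (T xi) <= M * l2norm xi.
Proof. by case: T => T /= /asboolP[]. Qed.

Fact bop_id_subproof : (id : ell2 R G -> ell2 R G) \in bounded_linear.
Proof.
by rewrite inE; split=> //; exists 1 => xi; rewrite mul1r.
Qed.
Definition bop_id := Bop bop_id_subproof.

Fact bop_comp_subproof (S T : bop) : S \o T \in bounded_linear.
Proof.
rewrite inE; split=> [a u v|]; first by rewrite /= !bop_linear.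
have [M HM] := bop_bounded S; have [N HN] := bop_bounded T.
exists (`|M| * N) => xi /=; apply: le_trans (HM _) _.
apply: le_trans (ler_wpM2r (l2norm_ge0 _) (ler_norm M)) _.
by rewrite -mulrA ler_wpM2l.
Qed.
Definition bop_comp (S T : bop) := Bop (bop_comp_subproof S T).

Fact bop_compA : associative bop_comp.
Proof. by move=> S T U; apply: bop_ext. Qed.
Fact bop_comp1l : left_id bop_id bop_comp.
Proof. by move=> S; apply: bop_ext. Qed.
Fact bop_comp1r : right_id bop_id bop_comp.
Proof. by move=> S; apply: bop_ext. Qed.
Fact bop_compDl : left_distributive bop_comp +%R.
Proof. by move=> S T U; apply: bop_ext. Qed.
Fact bop_compDr : right_distributive bop_comp +%R.
Proof.
move=> S T U; apply: bop_ext => xi /=.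
by have := bop_linear S 1 (T xi) (U xi); rewrite !scale1r.
Qed.

HB.instance Definition _ := GRing.Zmodule_isPzRing.Build bop
  bop_compA bop_comp1l bop_comp1r bop_compDl bop_compDr.

Definition opnorm (T : bop) : R :=
  sup [set l2norm (T xi) | xi in [set xi | l2norm xi <= 1]].

Definition norm_closure (S : set bop) : set bop :=
  [set T | forall e : R, 0 < e -> exists2 U, S U & opnorm (T - U) < e].

Definition linear_span (S : set bop) : set bop :=
  [set T | exists (n : nat) (c : 'I_n -> R[i]) (U : 'I_n -> bop),
     (forall i, S (U i)) /\ T = \sum_(i < n) c i *: U i].

Definition is_adjoint (T S : bop) :=
  forall xi eta, inner (T xi) eta = inner xi (S eta).

Definition commutant (S : set bop) : set bop :=
  [set T | forall U, S U -> T * U = U * T].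

End hilbert.

Section regular_representation.
Variables (R : realType) (G : groupType).
Implicit Types (g h x : G) (xi : ell2 R G).

Lemma sqsum_translate (f : G -> R[i]) g :
  sqsum (fun x => f (g^-1 * x)%g) = sqsum f.
Proof.
rewrite /sqsum; symmetry.
apply: (reindex_esum setT setT (fun x => (g^-1 * x)%g)); split=> //.
- by move=> x y _ _ /mulgI.
- by move=> x _; exists (g * x)%g => //; rewrite mulKg.
Qed.

Fact translate_subproof g xi :
  (fun x => xi (g^-1 * x)%g) \in @square_summable R G.
Proof. by rewrite inE sqsum_translate; case: xi. Qed.
Definition translate g xi : ell2 R G := Ell2 (translate_subproof g xi).

Lemma ell2_ext (xi eta : ell2 R G) : xi =1 eta -> xi = eta.
Proof. by move=> xe; apply/val_inj/funext. Qed.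

Fact lambda_subproof g : translate g \in @bounded_linear R G.
Proof.
rewrite inE; split=> [c u v|]; first exact: ell2_ext.
by exists 1 => xi; rewrite mul1r /l2norm sqsum_translate.
Qed.
Definition lambda g : bop R G := Bop (lambda_subproof g).

Lemma lambdaM g h : lambda (g * h)%g = lambda g * lambda h.
Proof.
apply: bop_ext => xi; apply: ell2_ext => x /=.
by rewrite invgM mulgA.
Qed.

Fact delta1_subproof :
  (fun x : G => (x == 1%g)%:R) \in @square_summable R G.
Proof.
rewrite inE /sqsum (esumID [set 1%g]); last first.
  by move=> x _; rewrite lee_fin sqmod_ge0.
rewrite setTI esum_set1 ?lee_fin ?sqmod_ge0// setTI.
rewrite esum1 ?adde0 ?ltry// => x /eqP/negPf ->.
by rewrite /sqmod /= expr0n /= addr0.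
Qed.
Definition delta1 : ell2 R G := Ell2 delta1_subproof.

Fact bop_oner_neq0 : 1 != 0 :> bop R G.
Proof.
apply/eqP => /(congr1 (fun T : bop R G => T delta1 1%g)) /= /eqP.
by rewrite eqxx oner_eq0.
Qed.
HB.instance Definition _ := GRing.PzSemiRing_isNonZero.Build (bop R G)
  bop_oner_neq0.

(* Z[G] is {freeg G / int}, the finitely supported functions from G to int. *)
Definition zgroup_ring_act (a : {freeg G / int}) : bop R G :=
  \sum_(g <- dom a) lambda g *~ coeff g a.

Definition Cred : set (bop R G) := norm_closure (linear_span (range lambda)).

(* The group von Neumann algebra is the bicommutant of lambda(G) in B(l^2 G). *)
Definition in_LG : {pred bop R G} :=
  [pred T | `[< commutant (commutant (range lambda)) T >]].

Fact in_LG_subring_closed : subring_closed in_LG.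
Proof.
split=> [|S T|S T]; rewrite !inE.
- by move=> U _; rewrite mul1r mulr1.
- by move=> hS hT U hU; rewrite mulrBl mulrBr hS ?hT.
- by move=> hS hT U hU; rewrite -mulrA hT// mulrA hS// mulrA.
Qed.
HB.instance Definition _ := GRing.isSubringClosed.Build _ in_LG
  in_LG_subring_closed.

Record LG := MkLG { LG_val :> bop R G ; _ : LG_val \in in_LG }.
HB.instance Definition _ := [isSub for LG_val].
HB.instance Definition _ := [Choice of LG by <:].
HB.instance Definition _ := [SubChoice_isSubNzRing of LG by <:].

Fact lambda_in_LG g : lambda g \in in_LG.
Proof.
by rewrite inE => U hU; apply/esym/hU; exists g.
Qed.
Definition LG_lambda g : LG := MkLG (lambda_in_LG g).

Lemma LG_lambdaM g h : LG_lambda (g * h)%g = LG_lambda g * LG_lambda h.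
Proof. by apply: val_inj; exact: lambdaM. Qed.

Definition LG_trace (T : LG) : R[i] := inner (T delta1) delta1.

End regular_representation.
Arguments Cred : clear implicits.

Section cstar.
Variables (R : realType) (G : choiceType) (A : set (bop R G)).

Definition closed_ideal (I : set (bop R G)) :=
  [/\ I `<=` A, I 0,
      forall (c : R[i]) S T, I S -> I T -> I (c *: S + T),
      forall S T, A S -> I T -> I (S * T) /\ I (T * S)
    & norm_closure I `<=` I].

Definition simple_cstar :=
  forall I, closed_ideal I -> I = [set 0] \/ I = A.

(* A functional on A is represented by a function on all of B(l^2 G), of which
   only the values on A matter. Positivity is tau (T^* T) >= 0. *)
Definition tracial_state (tau : bop R G -> R[i]) :=
  [/\ forall (c : R[i]) S T, A S -> A T -> tau (c *: S + T) = c * tau S + tau T,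
      forall S T, A S -> A T -> is_adjoint T S -> 0 <= tau (S * T),
      tau 1 = 1
    & forall S T, A S -> A T -> tau (S * T) = tau (T * S)].

Definition has_unique_trace :=
  exists2 tau, tracial_state tau
    & forall tau', tracial_state tau' -> forall T, A T -> tau' T = tau T.

End cstar.

Section quotient_module.
Local Open Scope quotient_scope.
Variables (A : pzRingType) (M : lmodType A) (N : zmodClosed M).
Hypothesis scaleN : GRing.scaler_closed N.

Definition quotmod of GRing.scaler_closed N := Quotient.quot N.
Local Notation Q := (quotmod scaleN).
HB.instance Definition _ := GRing.Zmodule.on Q.
HB.instance Definition _ := EqQuotient.on Q.

Definition quotmod_scale (a : A) (u : Q) : Q :=
  \pi_Q (a *: repr u).

Lemma pi_quotmodZ a (x : M) :
  quotmod_scale a (\pi_Q x) = \pi_Q (a *: x).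
Proof.
apply/eqP; rewrite -Quotient.idealrBE -scalerBr scaleN//.
by rewrite Quotient.idealrBE reprK.
Qed.

Lemma pi_quotmodD (x y : M) :
  \pi_Q x + \pi_Q y = \pi_Q (x + y).
Proof. by apply: esym; exact: (Quotient.pi_add N x y). Qed.

Fact quotmod_scaleA a b u :
  quotmod_scale a (quotmod_scale b u) = quotmod_scale (a * b) u.
Proof. by rewrite -[u]reprK (pi_quotmodZ b) !pi_quotmodZ scalerA. Qed.
Fact quotmod_scale1 : left_id 1 quotmod_scale.
Proof. by move=> u; rewrite -[u]reprK !pi_quotmodZ scale1r. Qed.
Fact quotmod_scaleDr : right_distributive quotmod_scale +%R.
Proof.
move=> a u v; rewrite -[u]reprK -[v]reprK.
by rewrite pi_quotmodD !pi_quotmodZ pi_quotmodD scalerDr.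
Qed.
Fact quotmod_scaleDl u : {morph quotmod_scale^~ u : a b / a + b}.
Proof.
by move=> a b; rewrite -[u]reprK !pi_quotmodZ pi_quotmodD scalerDl.
Qed.
HB.instance Definition _ := GRing.Zmodule_isLmodule.Build A Q
  quotmod_scaleA quotmod_scale1 quotmod_scaleDr quotmod_scaleDl.

End quotient_module.

Section fglift_linear.
Variables (A : nzRingType) (M : lmodType A) (K : choiceType) (f : K -> M).

Fact fglift_is_linear : linear (fglift f : {freeg K / A} -> M).
Proof.
have addf := lift_is_additive f.
have f0 : fglift f 0 = 0 by rewrite -(subrr 0) addf subrr.
have fN D : fglift f (- D) = - fglift f D by rewrite -sub0r addf f0 sub0r.
have fD D E : fglift f (D + E) = fglift f D + fglift f E.
  by rewrite -[E in LHS]opprK addf fN opprK.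
have fsum (s : seq K) (F : K -> {freeg K / A}) :
    fglift f (\sum_(x <- s) F x) = \sum_(x <- s) fglift f (F x).
  by elim: s => [|x s IHs]; rewrite ?big_nil// !big_cons fD IHs.
move=> a D E; rewrite fD; congr (_ + _).
rewrite -[D in RHS]freeg_sumE {1}/GRing.scale /= /fgscale !fsum scaler_sumr.
by apply: eq_bigr => x _; rewrite !liftU scalerA.
Qed.
HB.instance Definition _ :=
  GRing.isLinear.Build A {freeg K / A} M _ (fglift f) fglift_is_linear.
End fglift_linear.

Section betti.
Variables (R : realType) (G : groupType).
Local Notation LG := (LG R G).

(* The inhomogeneous bar complex with coefficients in LG, regarded as a right
   ZG-module through lambda. In degree n it is the free left LG-module on G^n,
   and its differentials
     d_1 (m [g])   = m lambda(g) - m,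
     d_2 (m [g|h]) = m lambda(g) [h] - m [gh] + m [g]
   are left LG-linear, hence given by their values on the basis. *)
Definition bar_d1 : {freeg G / LG} -> LG^o :=
  fglift (fun g => LG_lambda R g - 1 : LG^o).

Definition bar_d2 : {freeg (G * G) / LG} -> {freeg G / LG} :=
  fglift (fun p : G * G => LG_lambda R p.1 *: << p.2 >>
                           - << (p.1 * p.2)%g >> + << p.1 >>).

HB.instance Definition _ := GRing.Linear.on bar_d1.
HB.instance Definition _ := GRing.Linear.on bar_d2.

Definition is_cycle : {pred {freeg G / LG}} := [pred c | bar_d1 c == 0].
Fact is_cycle_submod_closed : submod_closed is_cycle.
Proof.
have E c : (c \in is_cycle) = (bar_d1 c == 0) by [].
split=> [|a c d]; rewrite !E ?linear0//.
by move=> /eqP hc /eqP hd; rewrite linearP /= hc hd scaler0 addr0.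
Qed.
HB.instance Definition _ := GRing.isSubmodClosed.Build _ _ is_cycle
  is_cycle_submod_closed.

Record cycles := MkCycle { cycle_val :> {freeg G / LG} ; _ : cycle_val \in is_cycle }.
HB.instance Definition _ := [isSub for cycle_val].
HB.instance Definition _ := [Choice of cycles by <:].
HB.instance Definition _ := [SubChoice_isSubLmodule of cycles by <:].

Lemma bar_d1U (m : LG) g : bar_d1 << m *g g >> = m * LG_lambda R g - m.
Proof. by rewrite /bar_d1 liftU /GRing.scale /= mulrBr mulr1. Qed.

Lemma bar_d2U (m : LG) g h : bar_d2 << m *g (g, h) >> =
  << (m * LG_lambda R g) *g h >> - << m *g (g * h)%g >> + << m *g g >>.
Proof.
have scaleU (a b : LG) x : a *: (<< b *g x >> : {freeg G / LG}) = << (a * b) *g x >>.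
  by apply/eqP/freeg_eqP => y; rewrite coeffZ !coeffU mulrA.
by rewrite /bar_d2 liftU /= scalerDr scalerBr !scaleU !mulr1.
Qed.

Lemma bar_d1d2 c : bar_d1 (bar_d2 c) = 0.
Proof.
rewrite -[c]freeg_sumE !linear_sum big1// => -[g h] _ /=.
rewrite bar_d2U linearD linearB /= !bar_d1U LG_lambdaM.
rewrite mulrA opprB.
by rewrite [X in X + _](addrC, subrKA) !subrKA subrr.
Qed.

Definition is_boundary : {pred cycles} :=
  [pred z | `[< exists c, bar_d2 c = cycle_val z >]].
Fact is_boundary_submod_closed : submod_closed is_boundary.
Proof.
split=> [|a y z]; rewrite !inE; first by exists 0; rewrite linear0.
by move=> [c hc] [d hd]; exists (a *: c + d); rewrite linearP /= hc hd.
Qed.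
HB.instance Definition _ := GRing.isSubmodClosed.Build _ _ is_boundary
  is_boundary_submod_closed.
Fact is_boundary_scaler_closed : GRing.scaler_closed is_boundary.
Proof. by move=> a z; exact: rpredZ. Qed.

Definition H1 : lmodType LG := quotmod is_boundary_scaler_closed.

(* Lueck's dimension of a module is the supremum of the dimensions of its
   finitely generated projective submodules. For an idempotent A in M_n(LG),
   im A is the finitely generated projective left module
   { v *m A | v in LG^n }, whose dimension is the trace of A. The relation says
   that P is a submodule of M isomorphic to such an im A, of dimension d; a
   linear map on im A is the restriction of a linear map f on LG^n. The trace of
   an idempotent is real. *)
Definition fg_projective_dim (M : lmodType LG) (P : set M) (d : R) :=
  exists (n : nat) (A : 'M[LG]_n) (f : {linear 'rV[LG]_n -> M}),
    [/\ A *m A = A,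
        forall v, f (v *m A) = 0 -> v *m A = 0,
        P = range (fun v => f (v *m A))
      & d = complex.Re (\sum_(i < n) LG_trace (A i i))].

Definition luck_dim (M : lmodType LG) : \bar R :=
  ereal_sup [set d%:E | d in [set d | exists P, @fg_projective_dim M P d]].

Definition l2betti1 : \bar R := luck_dim H1.

End betti.

Definition torsionfree (G : groupType) :=
  forall (g : G) (n : nat), (0 < n)%N -> (g ^+ n = 1)%g -> g = 1%g.

(* Main.v *)
(* Let D be the left LG-module generated by symbols [g], g in G, with the relations
   [gh] = [g] + g [h], so that H_1(G; LG) is the kernel of D -> LG, [g] |-> g - 1.
   Say that c in D depends on [x] if t c = q [x] for some t, q in LG with t injective
   on l^2 G. The trace on LG yields the Ore condition with respect to the injective
   elements, so the elements depending on [x] form a submodule. If this submodule is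
   D for some x <> 1, then H_1(G; LG) is annihilated elementwise by injective
   elements, contains no non-zero projective submodule and beta_1 = 0. Hence
   C(x) = {y | [y] depends on [x]} is a proper subgroup for x <> 1; since two such
   subgroups are equal or meet trivially, finitely many of them do not cover G.

   If y is not in C(x), then x and y generate a free product: Fox calculus turns a
   shortest alternating relation into A [x] + B [y] = 0 in D where B (y - 1) is a
   non-zero element of Z[G], hence injective, and [y] would depend on [x]. Thus for
   every finite set of elements x <> 1 there is one y free from all of them, and
   a ping-pong argument gives || sum_(j < n) lambda (y^j x y^-j) || <= 2 sqrt n.
   Simplicity and uniqueness of the trace follow by averaging, as for Powers groups. *)
Require Import Defs.
From HB Require Import structures.
From mathcomp Require Import all_boot all_order all_algebra.
From mathcomp Require Import finmap complex ring lra.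
From mathcomp.multinomials Require Import freeg.
From mathcomp Require Import all_classical all_reals all_analysis.
From mathcomp.analysis.showcase Require Import summability.

Set Implicit Arguments.
Unset Strict Implicit.
Unset Printing Implicit Defensive.

Import Order.TTheory GRing.Theory Num.Theory.
Import numFieldNormedType.Exports.
Local Open Scope classical_set_scope.
Local Open Scope ring_scope.

(** * The Hilbert space *)

(* Spectral projections and unbounded operators enter only through powers. For a positive
   contraction [C] the powers [C ^+ n] converge strongly to the projection onto the fixed vectors,
   so by faithfulness of the trace an element [C] of LG has no non-zero fixed vector exactly when
   the trace of [C ^+ n] tends to 0. Such traces can be compared through intertwining relations like
   [(1 - adj T * T) ^+ n * adj T = adj T * (1 - T * adj T) ^+ n]; this transfers injectivity from
   [adj T] to [T] and yields the Ore condition. The module of the symbols [g] is never formed: its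
   elements are chains, equal up to [boundary], and fractions are replaced by denominators on the
   left. Torsionfreeness enters through powers: those of a fixed element in the covering argument,
   and those of [y] that serve as conjugators. A tracial state is given by algebra and positivity
   alone, so its continuity has to be derived; square roots of [1 - T] inside the algebra, for small
   self-adjoint [T], provide it. *)
#[local] Existing Instance summability.totally_filter.

Section complex_parts.
Variable R : realType.
Implicit Types z w : R[i].

Lemma Re_sum (I : Type) (F : I -> R[i]) s :
  complex.Re (\sum_(x <- s) F x) = \sum_(x <- s) complex.Re (F x).
Proof. by elim/big_rec2: _ => // i u v _ <-; case: (F i) v => ? ? []. Qed.

Lemma Im_sum (I : Type) (F : I -> R[i]) s :
  complex.Im (\sum_(x <- s) F x) = \sum_(x <- s) complex.Im (F x).
Proof. by elim/big_rec2: _ => // i u v _ <-; case: (F i) v => ? ? []. Qed.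

Lemma complexBE z w :
  z - w = Complex (complex.Re z - complex.Re w) (complex.Im z - complex.Im w).
Proof. by case: z w => ? ? []. Qed.

Lemma norm_le_ReIm z : `|z| <= (`|complex.Re z| + `|complex.Im z|)%:C%C.
Proof.
case: z => b a; rewrite normc_def lecR /=.
have -> : `|b| + `|a| = Num.sqrt ((`|b| + `|a|) ^+ 2).
  by rewrite sqrtr_sqr (ger0_norm (addr_ge0 (normr_ge0 b) (normr_ge0 a))).
rewrite ler_wsqrtr// sqrrD !real_normK ?num_real//.
by rewrite lerD2r lerDl mulrn_wge0// mulr_ge0.
Qed.

End complex_parts.

(* Locked, since unification would otherwise unfold norms down to extended real
   sums; [rip] is the real part of the inner product, obtained by polarization. *)
HB.lock Definition nsq (R : realType) (G : choiceType) (xi : ell2 R G) : R :=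
  fine (sqsum xi).

HB.lock Definition hnorm (R : realType) (G : choiceType) (xi : ell2 R G) : R :=
  Num.sqrt (nsq xi).

HB.lock Definition rip (R : realType) (G : choiceType) (xi eta : ell2 R G) : R :=
  (nsq (xi + eta) - nsq (xi - eta)) / 4.

(** * The real inner product as a limit of finite sums *)

Section real_inner_product.
Variables (R : realType) (G : choiceType).
Implicit Types (xi eta zeta : ell2 R G) (A : {fset G}).

Lemma partial_sumE (V : zmodType) (f : G -> V) A :
  summability.partial_sum f A = \sum_(x <- A) f x.
Proof. by rewrite /summability.partial_sum big_seq_fsetE. Qed.

Lemma nsqE_fine xi : nsq xi = fine (sqsum xi). Proof. by rewrite nsq.unlock. Qed.

Lemma nsq_ge0 xi : 0 <= nsq xi. Proof. by rewrite nsqE_fine fine_sqsum_ge0. Qed.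

Lemma hnormE xi : hnorm xi = Num.sqrt (nsq xi). Proof. by rewrite hnorm.unlock. Qed.

Lemma l2normE xi : l2norm xi = hnorm xi. Proof. by rewrite hnormE nsqE_fine. Qed.

Lemma fset_le_sqsum (f : G -> R[i]) A :
  ((\sum_(x <- A) sqmod (f x))%:E <= sqsum f)%E.
Proof.
apply: ereal_sup_ubound; exists [set` A]; first by split.
by rewrite fsbig_finite//= set_fsetK sumEFin.
Qed.

Lemma sqsum_le (f : G -> R[i]) (c : R) :
  (forall A, \sum_(x <- A) sqmod (f x) <= c) -> (sqsum f <= c%:E)%E.
Proof.
move=> h; apply: ge_ereal_sup => _ [B [finB _] <-].
by rewrite fsbig_finite// sumEFin lee_fin.
Qed.

Lemma fset_le_nsq xi A : \sum_(x <- A) sqmod (xi x) <= nsq xi.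
Proof. by rewrite nsqE_fine -lee_fin fineK ?sqsum_fin_num// fset_le_sqsum. Qed.

Lemma nsq_le xi (c : R) :
  (forall A, \sum_(x <- A) sqmod (xi x) <= c) -> nsq xi <= c.
Proof. by move=> h; rewrite nsqE_fine -lee_fin fineK ?sqsum_fin_num// sqsum_le. Qed.

Lemma nsq_approx xi (e : R) : 0 < e ->
  exists A, nsq xi - e < \sum_(x <- A) sqmod (xi x).
Proof.
move=> e0; apply/not_existsP => h.
suff: nsq xi <= nsq xi - e by lra.
by apply: nsq_le => A; rewrite leNgt; apply/negP/h.
Qed.

Lemma sqmod_le_nsq xi x : sqmod (xi x) <= nsq xi.
Proof. by have := fset_le_nsq xi [fset x]%fset; rewrite big_seq_fset1. Qed.

Lemma nsq_cvg xi :
  summability.partial_sum (fun x => sqmod (xi x)) A @[A --> summability.totally]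
    --> nsq xi.
Proof.
apply/cvgrPdist_lt => e e0; have [A0 hA0] := nsq_approx xi e0.
exists A0 => //= A /= A0A; rewrite partial_sumE ger0_norm; last first.
  by rewrite subr_ge0 fset_le_nsq.
rewrite ltrBlDl -ltrBlDr; apply: lt_le_trans hA0 _.
rewrite [leRHS](big_fsetID _ [in A0])/=.
rewrite (_ : [fset x in A | x \in A0]%fset = A0); last first.
  by apply/fsetP => x; rewrite !inE/= andb_idl// => /(fsubsetP A0A).
by rewrite lerDl sumr_ge0// => x _; exact: sqmod_ge0.
Qed.

(** Polarization holds in each coordinate, so the convergence is inherited from two square sums. *)
Lemma rip_cvg xi eta :
  summability.partial_sum (fun x => complex.Re (xi x * conjc (eta x))) A
    @[A --> summability.totally] --> rip xi eta.
Proof.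
rewrite (_ : (fun A => _) = (fun A : {fset G} =>
   (summability.partial_sum (fun x => sqmod ((xi + eta) x)) A -
   summability.partial_sum (fun x => sqmod ((xi - eta) x)) A) * 4^-1)); last first.
  apply/funext => A; rewrite !partial_sumE -sumrB mulr_suml.
  apply: eq_bigr => x _.
  rewrite [(xi + eta) x]/(xi x + eta x) [(xi - eta) x]/(xi x - eta x) /sqmod.
  by case: (xi x) => a b; case: (eta x) => c d /=; field.
have h := cvgM (cvgB (@nsq_cvg (xi + eta)) (@nsq_cvg (xi - eta)))
  (cvg_cst (4^-1 : R)).
by rewrite rip.unlock; exact: h.
Qed.

(** Uniqueness of limits reduces algebraic identities for [rip] to finite sums, which are then
    compared coordinate by coordinate. *)
Lemma rip_unique xi eta (F : {fset G} -> R) l :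
  (forall A, \sum_(x <- A) complex.Re (xi x * conjc (eta x)) = F A) ->
  F A @[A --> summability.totally] --> l -> rip xi eta = l.
Proof.
move=> hF Fl; have h := @rip_cvg xi eta.
have E : summability.partial_sum (fun x => complex.Re (xi x * conjc (eta x))) = F.
  by apply/funext => A; rewrite partial_sumE hF.
rewrite E in h; exact: (cvg_unique _ h Fl).
Qed.

Lemma ripC xi eta : rip xi eta = rip eta xi.
Proof.
apply: rip_unique (@rip_cvg eta xi) => A; rewrite partial_sumE.
by apply: eq_bigr => x _; case: (xi x) => a b; case: (eta x) => c d /=; ring.
Qed.

Lemma ell2DE xi eta x : (xi + eta) x = xi x + eta x :> R[i]. Proof. by []. Qed.
Lemma ell2BE xi eta x : (xi - eta) x = xi x - eta x :> R[i]. Proof. by []. Qed.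
Lemma ell2ZE (c : R[i]) xi x : (c *: xi) x = c * xi x :> R[i]. Proof. by []. Qed.

Lemma ripDl xi eta zeta : rip (xi + eta) zeta = rip xi zeta + rip eta zeta.
Proof.
have h := cvgD (@rip_cvg xi zeta) (@rip_cvg eta zeta).
apply: (@rip_unique _ _ (fun A => summability.partial_sum _ A
  + summability.partial_sum _ A) _ _ (h _)) => A.
rewrite !partial_sumE -big_split; apply: eq_bigr => x _; rewrite ell2DE.
by case: (xi x) => a b; case: (eta x) => c d; case: (zeta x) => u v /=; ring.
Qed.

Lemma ripZl (c : R) xi eta : rip (c%:C%C *: xi) eta = c * rip xi eta.
Proof.
have h := cvgM (cvg_cst (c : R)) (@rip_cvg xi eta).
apply: (@rip_unique _ _ (fun A => c * summability.partial_sum _ A) _ _ (h _ _)) => A.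
rewrite !partial_sumE big_distrr; apply: eq_bigr => x _; rewrite ell2ZE.
by case: (xi x) => a b; case: (eta x) => c' d /=; ring.
Qed.

Lemma rip_i xi eta : rip ('i%C *: xi) ('i%C *: eta) = rip xi eta.
Proof.
apply: rip_unique (@rip_cvg xi eta) => A; rewrite partial_sumE.
apply: eq_bigr => x _; rewrite !ell2ZE.
by case: (xi x) => a b; case: (eta x) => c' d /=; ring.
Qed.

Lemma rip_nsq xi : rip xi xi = nsq xi.
Proof.
apply: rip_unique (@nsq_cvg xi) => A; rewrite partial_sumE.
by apply: eq_bigr => x _; rewrite /sqmod; case: (xi x) => a b /=; ring.
Qed.

(** The real part of [z * conjc ('i * w)] is the imaginary part of [z * conjc w]. This equation
    trades the complex [inner] of the definitions for [rip]. *)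
Lemma inner_rip xi eta :
  inner xi eta = Complex (rip xi eta) (rip xi ('i%C *: eta)).
Proof.
rewrite /inner /summability.sum; apply: (@cvg_lim (R[i])^o (@norm_hausdorff _ _)).
apply/(@cvgrPdist_lt _ (R[i])^o) => e e0.
have e20 : 0 < complex.Re e / 2 by case: e e0 => a b; rewrite ltcE/= => /andP[_]; lra.
have ere : e = (complex.Re e)%:C%C.
  by case: e e0 {e20} => a b; rewrite ltcE/= => /andP[/eqP->].
have /cvgrPdist_lt/(_ _ e20) h1 := @rip_cvg xi eta.
have /cvgrPdist_lt/(_ _ e20) h2 := @rip_cvg xi ('i%C *: eta).
near=> A; have : `|rip xi eta - summability.partial_sum
    (fun x => complex.Re (xi x * conjc (eta x))) A| < complex.Re e / 2 by near: A.
have : `|rip xi ('i%C *: eta) - summability.partial_sum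
    (fun x => complex.Re (xi x * conjc (('i%C *: eta) x))) A| < complex.Re e / 2 by near: A.
set a := _ - summability.partial_sum _ _; set b := _ - summability.partial_sum _ _.
move=> ha hb.
have -> : Complex (rip xi eta) (rip xi ('i%C *: eta)) -
   summability.partial_sum (fun x => xi x * (eta x)^* : (R[i])^o) A = Complex b a.
  rewrite complexBE /a /b !partial_sumE Re_sum Im_sum.
  congr (Complex (_ - _) (_ - _)); apply: eq_bigr => x _; rewrite ell2ZE.
  by case: (xi x) => u v; case: (eta x) => c' d /=; ring.
rewrite ere; apply: le_lt_trans (norm_le_ReIm _) _; rewrite ltcR /=.
by clearbody a b; lra.
Unshelve. all: by end_near. Qed.

End real_inner_product.

(** * Cauchy-Schwarz, convergence and completeness *)

Section hilbert_space.
Variables (R : realType) (G : choiceType).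
Implicit Types (xi eta zeta : ell2 R G) (A : {fset G}).
Local Open Scope complex_scope.

Lemma ripDr xi eta zeta : rip xi (eta + zeta) = rip xi eta + rip xi zeta.
Proof. by rewrite ripC ripDl ![rip _ xi]ripC. Qed.

Lemma ripZr (c : R) xi eta : rip xi (c%:C *: eta) = c * rip xi eta.
Proof. by rewrite ripC ripZl ripC. Qed.

Lemma rip0l xi : rip 0 xi = 0.
Proof. by rewrite -[0 in LHS](scale0r (0 : ell2 R G)) ripZl mul0r. Qed.

Lemma rip0r xi : rip xi 0 = 0. Proof. by rewrite ripC rip0l. Qed.

Lemma ripNl xi eta : rip (- xi) eta = - rip xi eta.
Proof. by apply/eqP; rewrite -addr_eq0 -ripDl addNr rip0l. Qed.

Lemma ripNr xi eta : rip xi (- eta) = - rip xi eta.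
Proof. by rewrite ripC ripNl ripC. Qed.

Lemma ripBl xi eta zeta : rip (xi - eta) zeta = rip xi zeta - rip eta zeta.
Proof. by rewrite ripDl ripNl. Qed.

Lemma ripBr xi eta zeta : rip xi (eta - zeta) = rip xi eta - rip xi zeta.
Proof. by rewrite ripDr ripNr. Qed.

Lemma rip_suml (I : Type) (s : seq I) (P : pred I) (F : I -> ell2 R G) eta :
  rip (\sum_(i <- s | P i) F i) eta = \sum_(i <- s | P i) rip (F i) eta.
Proof. by elim/big_rec2: _ => [|i u v _ <-]; rewrite ?rip0l// ripDl. Qed.

Lemma rip_sumr (I : Type) (s : seq I) (P : pred I) (F : I -> ell2 R G) eta :
  rip eta (\sum_(i <- s | P i) F i) = \sum_(i <- s | P i) rip eta (F i).
Proof. by elim/big_rec2: _ => [|i u v _ <-]; rewrite ?rip0r// ripDr. Qed.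

Lemma rip_ir xi eta : rip xi ('i *: eta) = - rip ('i *: xi) eta.
Proof.
rewrite -[in RHS](rip_i _ eta) scalerA (_ : 'i * 'i = -1 :> R[i]) ?scaleN1r.
  by rewrite ripNl opprK.
by rewrite -expr2 sqr_i.
Qed.

Lemma scale_ReIm (c : R[i]) xi :
  c *: xi = (complex.Re c)%:C *: xi + (complex.Im c)%:C *: ('i *: xi).
Proof. by rewrite scalerA -scalerDl [in LHS](complexE c) ['i * _]mulrC. Qed.

Lemma ripZr_conj (c : R[i]) xi eta : rip xi (c *: eta) = rip (conjc c *: xi) eta.
Proof.
rewrite scale_ReIm [in RHS]scale_ReIm ripDr ripDl !ripZr !ripZl rip_ir.
by case: c => a b /=; ring.
Qed.

Lemma rip_ge0 xi : 0 <= rip xi xi.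
Proof. by rewrite rip_nsq nsq_ge0. Qed.

Lemma nsqE xi : nsq xi = hnorm xi ^+ 2. Proof. by rewrite hnormE sqr_sqrtr ?nsq_ge0. Qed.

Lemma hnorm_ge0 xi : 0 <= hnorm xi. Proof. by rewrite hnormE sqrtr_ge0. Qed.

Lemma nsqD xi eta : nsq (xi + eta) = nsq xi + 2 * rip xi eta + nsq eta.
Proof. by rewrite -!rip_nsq ripDl !ripDr (ripC eta xi); ring. Qed.

Lemma nsqB xi eta : nsq (xi - eta) = nsq xi - 2 * rip xi eta + nsq eta.
Proof. by rewrite nsqD ripNr -[nsq (- _)]rip_nsq ripNl ripNr rip_nsq; ring. Qed.

Lemma nsq0 : nsq (0 : ell2 R G) = 0. Proof. by rewrite -rip_nsq rip0l. Qed.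

Lemma nsq_eq0 xi : nsq xi = 0 -> xi = 0.
Proof.
move=> h; apply/val_inj/funext => x /=.
have : sqmod (xi x) <= 0 by rewrite -h sqmod_le_nsq.
rewrite /sqmod; case: (xi x) => a b /= ab.
have a0 : a = 0 by nra.
have b0 : b = 0 by nra.
by rewrite a0 b0.
Qed.

Lemma nsq_scale (c : R[i]) xi : nsq (c *: xi) = sqmod c * nsq xi.
Proof.
rewrite -!rip_nsq ripZr_conj scalerA scale_ReIm ripDl !ripZl /sqmod.
by case: c => a b /=; ring.
Qed.

Lemma nsq_scaleR (c : R) xi : nsq (c%:C *: xi) = c ^+ 2 * nsq xi.
Proof. by rewrite nsq_scale /sqmod /= expr0n /= addr0. Qed.

Lemma rip_sq_le xi eta : rip xi eta ^+ 2 <= nsq xi * nsq eta.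
Proof.
have [/nsq_eq0 ->|n0] := eqVneq (nsq xi) 0.
  by rewrite rip0l nsq0 expr0n mul0r.
have p0 : 0 < nsq xi by rewrite lt_def n0 nsq_ge0.
have := nsq_ge0 (eta - (rip xi eta / nsq xi)%:C *: xi).
rewrite nsqB ripZr nsq_scaleR (ripC eta) => h.
have E : nsq eta - 2 * (rip xi eta / nsq xi * rip xi eta) +
   (rip xi eta / nsq xi) ^+ 2 * nsq xi = nsq eta - rip xi eta ^+ 2 / nsq xi.
  by field.
by move: h; rewrite E subr_ge0 ler_pdivrMr// mulrC.
Qed.

Lemma rip_le xi eta : `|rip xi eta| <= hnorm xi * hnorm eta.
Proof.
rewrite -(@ler_pXn2r _ 2)// ?nnegrE ?mulr_ge0 ?hnorm_ge0//.
by rewrite real_normK ?num_real// exprMn -2!nsqE rip_sq_le.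
Qed.

Lemma hnormD xi eta : hnorm (xi + eta) <= hnorm xi + hnorm eta.
Proof.
rewrite -(@ler_pXn2r _ 2)// ?nnegrE ?addr_ge0 ?hnorm_ge0//.
rewrite -nsqE nsqD !nsqE; have := rip_le xi eta.
by rewrite ler_norml => /andP[_]; move: (rip xi eta) (hnorm xi) (hnorm eta) => r a b; nra.
Qed.

Lemma hnorm0 : hnorm (0 : ell2 R G) = 0. Proof. by rewrite hnormE nsq0 sqrtr0. Qed.

Lemma hnorm_eq0 xi : hnorm xi = 0 -> xi = 0.
Proof. by move=> h; apply: nsq_eq0; rewrite nsqE h expr0n. Qed.

Lemma hnormZ (c : R[i]) xi : hnorm (c *: xi) = Num.sqrt (sqmod c) * hnorm xi.
Proof. by rewrite !hnormE nsq_scale sqrtrM ?sqmod_ge0. Qed.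

Lemma hnormN xi : hnorm (- xi) = hnorm xi.
Proof. by rewrite !hnormE -[nsq (- _)]rip_nsq ripNl ripNr opprK rip_nsq. Qed.

Lemma hnormB xi eta : hnorm (xi - eta) = hnorm (eta - xi).
Proof. by rewrite -hnormN opprB. Qed.

Lemma hnorm_dist xi eta : `|hnorm xi - hnorm eta| <= hnorm (xi - eta).
Proof.
rewrite ler_norml; apply/andP; split.
  by have := hnormD (eta - xi) xi; rewrite subrK hnormB; lra.
by have := hnormD (xi - eta) eta; rewrite subrK; lra.
Qed.

Lemma hnorm_le_nsq xi (c : R) : 0 <= c -> (hnorm xi <= c) = (nsq xi <= c ^+ 2).
Proof. by move=> c0; rewrite nsqE ler_pXn2r// nnegrE hnorm_ge0. Qed.

Definition l2cvg (u : nat -> ell2 R G) xi := hnorm (u n - xi) @[n --> \oo] --> (0 : R).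

Lemma l2cvgP (u : nat -> ell2 R G) xi :
  l2cvg u xi <-> forall e : R, 0 < e -> \forall n \near \oo, hnorm (u n - xi) <= e.
Proof.
split=> [/cvgrPdist_le h e /h|h].
  by apply: filterS => n; rewrite sub0r normrN ger0_norm ?hnorm_ge0.
apply/cvgrPdist_le => e /h; apply: filterS => n.
by rewrite sub0r normrN ger0_norm ?hnorm_ge0.
Qed.

Lemma l2cvg_le (u : nat -> ell2 R G) xi (v : nat -> R) :
  (forall n, hnorm (u n - xi) <= v n) -> v @ \oo --> (0 : R) -> l2cvg u xi.
Proof.
move=> h hv; apply: (@squeeze_cvgr _ _ _ _ (fun=> 0) v) => //; last exact: cvg_cst.
by near=> n; rewrite hnorm_ge0 h.
Unshelve. all: by end_near. Qed.

Lemma l2cvg_rip (u : nat -> ell2 R G) xi eta :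
  l2cvg u xi -> rip (u n) eta @[n --> \oo] --> rip xi eta.
Proof.
move=> h; apply/cvgrPdist_le => e e0.
have [z|n0] := eqVneq (hnorm eta) 0.
  have -> : eta = 0 by exact: hnorm_eq0.
  by near=> n; rewrite !rip0r subr0 normr0 ltW.
have p : 0 < hnorm eta by rewrite lt_def n0 hnorm_ge0.
have /l2cvgP/(_ (e / hnorm eta)) := h; rewrite divr_gt0// => /(_ isT).
apply: filterS => n; rewrite ler_pdivlMr// => hn.
by rewrite -ripBl; apply: le_trans (rip_le _ _) _; rewrite hnormB.
Unshelve. all: by end_near. Qed.

Lemma l2cvg_norm (u : nat -> ell2 R G) xi :
  l2cvg u xi -> hnorm (u n) @[n --> \oo] --> hnorm xi.
Proof.
move=> /l2cvgP h; apply/cvgrPdist_le => e /h; apply: filterS => n.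
by apply: le_trans; rewrite distrC hnorm_dist.
Qed.

Lemma l2cvgD (u v : nat -> ell2 R G) xi eta :
  l2cvg u xi -> l2cvg v eta -> l2cvg (fun n => u n + v n) (xi + eta).
Proof.
move=> hu hv; apply: l2cvg_le
  (_ : (fun n => hnorm (u n - xi) + hnorm (v n - eta)) @ \oo --> 0) => [n|].
  by rewrite opprD addrACA hnormD.
by rewrite -[0 in X in _ --> X]addr0; exact: cvgD.
Qed.

Lemma l2cvgZ (c : R[i]) (u : nat -> ell2 R G) xi :
  l2cvg u xi -> l2cvg (fun n => c *: u n) (c *: xi).
Proof.
move=> hu; apply: l2cvg_le
  (_ : (fun n => Num.sqrt (sqmod c) * hnorm (u n - xi)) @ \oo --> 0) => [n|].
  by rewrite -scalerBr hnormZ.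
by rewrite -[0 in X in _ --> X](mulr0 (Num.sqrt (sqmod c))); apply: cvgM => //; exact: cvg_cst.
Qed.

Lemma rcvg_unique (v : nat -> R) (a b : R) :
  v @ \oo --> a -> v @ \oo --> b -> a = b.
Proof. by move=> ha hb; exact: (cvg_unique _ ha hb). Qed.

Lemma l2cvg_unique (u : nat -> ell2 R G) xi eta :
  l2cvg u xi -> l2cvg u eta -> xi = eta.
Proof.
move=> h1 h2; apply/eqP; rewrite -subr_eq0; apply/eqP/nsq_eq0; rewrite -rip_nsq ripBl.
by rewrite (rcvg_unique (@l2cvg_rip _ _ (xi - eta) h1) (@l2cvg_rip _ _ (xi - eta) h2)) subrr.
Qed.

Lemma l2cvg_shift (u : nat -> ell2 R G) xi : l2cvg u xi -> l2cvg (fun n => u n.+1) xi.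
Proof.
move=> /l2cvgP h; apply/l2cvgP => e /h[N _ hN].
by exists N => // n Nn; exact: (hN _ (leqW Nn)).
Qed.

Lemma l2cvg_cst xi : l2cvg (fun=> xi) xi.
Proof. by apply/l2cvgP => e e0; near=> n; rewrite subrr hnorm0 ltW.
Unshelve. all: by end_near. Qed.

Lemma rcvg_sum (I : Type) (s : seq I) (F : I -> nat -> R) (l : I -> R) :
  (forall i, F i @ \oo --> l i) ->
  \sum_(i <- s) F i n @[n --> \oo] --> \sum_(i <- s) l i.
Proof.
move=> h; elim: s => [|i s IHs].
  by rewrite big_nil; under eq_fun do rewrite big_nil; exact: cvg_cst.
by rewrite big_cons; under eq_fun do rewrite big_cons; exact: cvgD.
Qed.

Lemma cauchy_real_cvg (v : nat -> R) :
  (forall e : R, 0 < e -> exists N, forall n, (N <= n)%N -> `|v N - v n| < e) ->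
  exists l : R, v @ \oo --> l.
Proof.
move=> h; suff : cvg (v @ \oo) by move=> ?; exists (lim (v @ \oo)).
apply/cauchy_cvgP/cauchy_exP => e e0; have [N hN] := h _ e0.
by exists (v N), N => // n /= Nn; rewrite /ball/=; exact: hN.
Qed.

Definition l2cauchy (u : nat -> ell2 R G) := forall e : R, 0 < e ->
  exists N, forall m n, (N <= m)%N -> (N <= n)%N -> hnorm (u m - u n) <= e.

Lemma Re_le_sqmod (z : R[i]) (e : R) : 0 <= e -> sqmod z <= e ^+ 2 -> `|complex.Re z| <= e.
Proof.
case: z => a b e0; rewrite /sqmod /= => h.
rewrite -(@ler_pXn2r _ 2)// ?nnegrE// real_normK ?num_real//.
by move: (sqr_ge0 b); lra.
Qed.

Lemma Im_le_sqmod (z : R[i]) (e : R) : 0 <= e -> sqmod z <= e ^+ 2 -> `|complex.Im z| <= e.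
Proof.
case: z => a b e0; rewrite /sqmod /= => h.
rewrite -(@ler_pXn2r _ 2)// ?nnegrE// real_normK ?num_real//.
by move: (sqr_ge0 a); lra.
Qed.

Lemma l2complete (u : nat -> ell2 R G) : l2cauchy u -> exists xi, l2cvg u xi.
Proof.
move=> hu.
have sq x (e : R) : 0 < e -> exists N, forall m n, (N <= m)%N -> (N <= n)%N ->
    sqmod (u m x - u n x) <= e ^+ 2.
  move=> e0; have [N hN] := hu e e0; exists N => m n Nm Nn.
  rewrite -ell2BE; apply: le_trans (sqmod_le_nsq _ _) _.
  by rewrite -(hnorm_le_nsq _ (ltW e0)) hN.
have re x : exists l : R, complex.Re (u n x) @[n --> \oo] --> l.
  apply: cauchy_real_cvg => e e0; have e20 : 0 < e / 2 by rewrite divr_gt0.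
  have [N hN] := sq x _ e20; exists N => n Nn; apply: le_lt_trans (_ : e / 2 < e); last by lra.
  have := Re_le_sqmod (ltW e20) (hN N n (leqnn _) Nn); rewrite complexBE/=.
  by [].
have im x : exists l : R, complex.Im (u n x) @[n --> \oo] --> l.
  apply: cauchy_real_cvg => e e0; have e20 : 0 < e / 2 by rewrite divr_gt0.
  have [N hN] := sq x _ e20; exists N => n Nn; apply: le_lt_trans (_ : e / 2 < e); last by lra.
  have := Im_le_sqmod (ltW e20) (hN N n (leqnn _) Nn); rewrite complexBE/=.
  by [].
have [f hf] := choice re; have [g hg] := choice im.
(* For a fixed finite set [A] the Cauchy bound between [u n] and [u m] survives the limit in [m].
   The threshold [N] does not depend on [A], so the bound extends to the whole square sum. *)
have key (e : R) : 0 < e -> exists N, forall n, (N <= n)%N -> forall A,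
    \sum_(x <- A) sqmod (u n x - Complex (f x) (g x)) <= e ^+ 2.
  move=> e0; have [N hN] := hu e e0; exists N => n Nn A.
  have h : \sum_(x <- A) sqmod (u n x - u m x) @[m --> \oo] -->
           \sum_(x <- A) sqmod (u n x - Complex (f x) (g x)).
    apply: rcvg_sum => x.
    have -> : sqmod (u n x - Complex (f x) (g x)) =
        (complex.Re (u n x) - f x) * (complex.Re (u n x) - f x)
        + (complex.Im (u n x) - g x) * (complex.Im (u n x) - g x).
      by rewrite complexBE /sqmod/= !expr2.
    have -> : (fun m => sqmod (u n x - u m x)) = (fun m =>
        (complex.Re (u n x) - complex.Re (u m x)) * (complex.Re (u n x) - complex.Re (u m x))
      + (complex.Im (u n x) - complex.Im (u m x)) * (complex.Im (u n x) - complex.Im (u m x))).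
      by apply/funext => m; rewrite complexBE /sqmod/= !expr2.
    have h1 := cvgB (cvg_cst (complex.Re (u n x) : R)) (hf x).
    have h2 := cvgB (cvg_cst (complex.Im (u n x) : R)) (hg x).
    exact: cvgD (cvgM (h1 _ _) (h1 _ _)) (cvgM (h2 _ _) (h2 _ _)).
  apply: (closed_cvg _ (@closed_le R (e ^+ 2)) _ _ h) => //.
  exists N => // m /= Nm; apply: le_trans (_ : nsq (u n - u m) <= _).
    by have := fset_le_nsq (u n - u m) A.
  by rewrite -(hnorm_le_nsq _ (ltW e0)); exact: hN.
have [N hN] := key 1 ltr01.
(* Square summability is known for the difference from [u N], not yet for the pointwise limit; the
   limit is therefore built as [u N] minus this difference. *)
have ss : (fun x => u N x - Complex (f x) (g x)) \in @square_summable R G.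
  by rewrite inE; apply: le_lt_trans (sqsum_le (hN N (leqnn _))) _; rewrite ltry.
exists (u N - Ell2 ss); apply/l2cvgP => e /[dup] e0 /key[M hM].
exists M => // n /= Mn; rewrite (hnorm_le_nsq _ (ltW e0)); apply: nsq_le => A.
apply: le_trans (hM n Mn A).
rewrite le_eqVlt; apply/orP; left; apply/eqP; apply: eq_bigr => x _; congr sqmod.
by rewrite !ell2BE (_ : Ell2 ss x = u N x - Complex (f x) (g x) :> R[i])//; ring.
Qed.

End hilbert_space.

(** * Bounded operators and adjoints *)

HB.lock Definition onorm (R : realType) (G : choiceType) (T : bop R G) : R :=
  sup [set hnorm (T xi) | xi in [set xi | hnorm xi <= 1]].

Section bounded_operators.
Variables (R : realType) (G : choiceType).
Implicit Types (xi eta zeta : ell2 R G) (A : {fset G}) (S T : bop R G).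
Local Open Scope complex_scope.

Lemma sqmod0 : sqmod (0 : R[i]) = 0.
Proof. by rewrite /sqmod /= expr0n addr0. Qed.

Fact cut_subproof (P : pred G) xi :
  (fun x => if P x then xi x else 0) \in @square_summable R G.
Proof.
rewrite inE; apply: (@le_lt_trans _ _ (nsq xi)%:E); last by rewrite ltry.
apply: sqsum_le => A; apply: le_trans (fset_le_nsq xi A).
apply: ler_sum => x _; case: ifP => _; rewrite ?sqmod0 ?lexx//.
exact: sqmod_ge0.
Qed.
Definition cut (P : pred G) xi : ell2 R G := Ell2 (cut_subproof P xi).

Lemma cutE (P : pred G) xi x : cut P xi x = if P x then xi x else 0 :> R[i].
Proof. by []. Qed.

Lemma rip_disjoint xi eta : (forall x, xi x = 0 \/ eta x = 0) -> rip xi eta = 0.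
Proof.
move=> h; apply: (@rip_unique _ _ _ _ (fun=> 0)); last exact: cvg_cst.
move=> A; rewrite big1// => x _; case: (h x) => ->.
  by rewrite mul0r.
by rewrite conjc0 mulr0.
Qed.

Fact single_subproof (x : G) (c : R[i]) :
  (fun y => if y == x then c else 0) \in @square_summable R G.
Proof.
rewrite inE; apply: (@le_lt_trans _ _ (sqmod c)%:E); last by rewrite ltry.
apply: sqsum_le => A.
rewrite (eq_bigr (fun y => if y == x then sqmod c else 0)); last first.
  by move=> y _; case: ifP; rewrite ?sqmod0.
rewrite -big_mkcond/= big_const_seq iter_addr addr0.
rewrite (count_uniq_mem x (fset_uniq A)).
by case: (x \in A); rewrite ?mulr1n ?mulr0n ?sqmod_ge0.
Qed.
Definition single (x : G) (c : R[i]) : ell2 R G := Ell2 (single_subproof x c).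

Lemma singleE x c y : single x c y = if y == x then c else 0 :> R[i].
Proof. by []. Qed.

Lemma ell2_eqP xi eta : (forall x, xi x = eta x :> R[i]) -> xi = eta.
Proof. by move=> h; apply/val_inj/funext => x; exact: h. Qed.

Lemma single_scale x (c d : R[i]) : single x (c * d) = c *: single x d.
Proof. by apply: ell2_eqP => y; rewrite ell2ZE !singleE; case: ifP => // _; rewrite mulr0. Qed.

Lemma singleD x (c d : R[i]) : single x (c + d) = single x c + single x d.
Proof. by apply: ell2_eqP => y; rewrite ell2DE !singleE; case: ifP => // _; rewrite addr0. Qed.

Lemma ell2_sumE (I : Type) (s : seq I) (P : pred I) (F : I -> ell2 R G) x :
  (\sum_(i <- s | P i) F i) x = \sum_(i <- s | P i) (F i x : R[i]) :> R[i].
Proof. by elim/big_rec2: _ => [|i u v _ <-]//; rewrite ell2DE. Qed.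

Lemma cut_sum A xi : cut (mem A) xi = \sum_(x <- A) single x (xi x).
Proof.
apply: ell2_eqP => y; rewrite ell2_sumE cutE.
rewrite (eq_bigr (fun x => if x == y then xi y else 0 : R[i])); last first.
  by move=> x _; rewrite singleE eq_sym; case: eqP => // ->.
case: ifPn => [yA|yA].
  by rewrite (big_fsetD1 y)//= eqxx big1_fset ?addr0// => x; rewrite !inE => /andP[/negPf->].
by rewrite big1_fset// => x xA _; case: eqP => // xy; move: yA; rewrite -xy /= xA.
Qed.

Lemma finite_approx xi (e : R) : 0 < e -> exists A, hnorm (xi - cut (mem A) xi) < e.
Proof.
move=> e0; have [A hA] := @nsq_approx R G xi (e ^+ 2) (exprn_gt0 _ e0).
exists A; rewrite -(@ltr_pXn2r _ 2)// ?nnegrE ?hnorm_ge0 ?ltW// -nsqE.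
have h0 : rip (xi - cut (mem A) xi) (cut (mem A) xi) = 0.
  apply: rip_disjoint => x; rewrite ell2BE cutE.
  by case: ifP => _; [left; rewrite subrr|right].
have h1 : \sum_(x <- A) sqmod (xi x) <= nsq (cut (mem A) xi).
  apply: le_trans (fset_le_nsq (cut (mem A) xi) A); rewrite big_seq [leRHS]big_seq.
  by apply: ler_sum => x xA; rewrite cutE /= xA.
have := nsqD (xi - cut (mem A) xi) (cut (mem A) xi); rewrite subrK h0 mulr0 addr0.
move: hA h1; move: (nsq xi) (nsq (xi - _)) (nsq (cut _ _)) => a b c.
by move: (\sum_(_ <- _) _) (e ^+ 2) => d f; lra.
Qed.

(** Finitely supported vectors are dense. Scalars are carried by [single x c], so additivity
    suffices. *)
Lemma functional_eq0 (phi : ell2 R G -> R) (K : R) :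
  (forall xi eta, phi (xi + eta) = phi xi + phi eta) ->
  (forall xi, `|phi xi| <= K * hnorm xi) ->
  (forall x c, phi (single x c) = 0) -> forall xi, phi xi = 0.
Proof.
move=> phiD phiK phi0 xi.
have phi00 : phi 0 = 0 by have := phiD 0 0; rewrite addr0; lra.
have h (e : R) : 0 < e -> `|phi xi| <= `|K| * e.
  move=> /(finite_approx xi)[A /ltW hA].
  rewrite -(subrK (cut (mem A) xi) xi) phiD cut_sum.
  have -> : phi (\sum_(x <- A) single x (xi x)) = 0.
    by elim/big_rec: _ => // x u _ hu; rewrite phiD phi0 hu addr0.
  rewrite addr0 -cut_sum; apply: le_trans (phiK _) _.
  apply: le_trans (ler_wpM2r (hnorm_ge0 _) (ler_norm K)) _.
  by rewrite ler_wpM2l.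
apply/eqP; rewrite -normr_eq0 eq_le normr_ge0 andbT.
apply/ler_addgt0Pl => e e0; rewrite addr0.
apply: le_trans (h (e / (`|K| + 1)) _) _; first by rewrite divr_gt0// ltr_wpDl.
rewrite mulrCA ger_pMr// ler_pdivrMr ?ltr_wpDl// mul1r.
by rewrite lerDl.
Qed.

Lemma bopD T xi eta : T (xi + eta) = T xi + T eta.
Proof. by have := bop_linear T 1 xi eta; rewrite !scale1r. Qed.

Lemma bop0 T : T 0 = 0.
Proof. by apply: (addrI (T 0)); rewrite -bopD !addr0. Qed.

Lemma bopZ T (c : R[i]) xi : T (c *: xi) = c *: T xi.
Proof. by have := bop_linear T c xi 0; rewrite bop0 !addr0. Qed.

Lemma bopN T xi : T (- xi) = - T xi.
Proof. by rewrite -scaleN1r bopZ scaleN1r. Qed.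

Lemma bopB T xi eta : T (xi - eta) = T xi - T eta.
Proof. by rewrite bopD bopN. Qed.

Lemma bop_sum T (I : Type) (s : seq I) (P : pred I) (F : I -> ell2 R G) :
  T (\sum_(i <- s | P i) F i) = \sum_(i <- s | P i) T (F i).
Proof. by elim/big_rec2: _ => [|i u v _ <-]; rewrite ?bop0 ?bopD. Qed.

Lemma bop_addE S T xi : (S + T) xi = S xi + T xi. Proof. by []. Qed.
Lemma bop_oppE T xi : (- T) xi = - T xi. Proof. by []. Qed.
Lemma bop_subE S T xi : (S - T) xi = S xi - T xi. Proof. by []. Qed.
Lemma bop_zeroE xi : (0 : bop R G) xi = 0. Proof. by []. Qed.
Lemma bop_oneE xi : (1 : bop R G) xi = xi. Proof. by []. Qed.
Lemma bop_mulE S T xi : (S * T) xi = S (T xi). Proof. by []. Qed.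
Lemma bop_scaleE (c : R[i]) T xi : (c *: T) xi = c *: T xi. Proof. by []. Qed.

Lemma bop_sumE (I : Type) (s : seq I) (P : pred I) (F : I -> bop R G) xi :
  (\sum_(i <- s | P i) F i) xi = \sum_(i <- s | P i) F i xi.
Proof. by elim/big_rec2: _ => [|i u v _ <-]. Qed.

Lemma bop_bound T : exists2 M : R, 0 <= M & forall xi, hnorm (T xi) <= M * hnorm xi.
Proof.
have [M hM] := bop_bounded T; exists `|M| => // xi; rewrite -!l2normE.
exact: le_trans (hM _) (ler_wpM2r (l2norm_ge0 _) (ler_norm _)).
Qed.

Lemma bop_single_eq S T : (forall x c, S (single x c) = T (single x c)) -> S = T.
Proof.
move=> h; apply: bop_ext => xi; apply/eqP; rewrite -subr_eq0; apply/eqP/nsq_eq0.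
have [M M0 hM] := bop_bound (S - T).
rewrite -rip_nsq; set eta := S xi - T xi.
apply: (@functional_eq0 (fun zeta => rip (S zeta - T zeta) eta) (M * hnorm eta)).
- by move=> u v; rewrite !bopD -ripDl opprD addrACA.
- move=> u; apply: le_trans (rip_le _ _) _; rewrite mulrAC ler_wpM2r ?hnorm_ge0//.
  exact: hM.
- by move=> x c; rewrite h subrr rip0l.
Qed.

Lemma rip_single x (c : R[i]) xi :
  rip (single x c) xi = complex.Re c * complex.Re (xi x) + complex.Im c * complex.Im (xi x).
Proof.
have h : rip (single x c) (xi - single x (xi x)) = 0.
  apply: rip_disjoint => y; rewrite ell2BE !singleE.
  by case: eqP => [->|_]; [right; rewrite subrr|left].
have -> : rip (single x c) xi = rip (single x c) (single x (xi x)).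
  by apply/eqP; rewrite -subr_eq0 -ripBr h.
apply: (@rip_unique _ _ _ _ (fun A => if x \in A then
  complex.Re c * complex.Re (xi x) + complex.Im c * complex.Im (xi x) else 0)).
  move=> A; case: ifPn => xA.
    rewrite (big_fsetD1 x xA) big1_fset ?addr0 => [|y].
      by rewrite !singleE eqxx; clear h; case: (xi x) c => a b [u v] /=; ring.
    by rewrite !inE => /andP[/negPf yx _] _; rewrite singleE yx mul0r.
  rewrite big1_fset// => y yA _; rewrite singleE; case: eqP => [yx|_]; last by rewrite mul0r.
  by move: xA; rewrite -yx yA.
apply/cvgrPdist_le => e e0; exists [fset x]%fset => //= A /fsubsetP/(_ x).
by rewrite inE eqxx => -> //; rewrite subrr normr0 ltW.
Qed.

Lemma nsq_single x (c : R[i]) : nsq (single x c) = sqmod c.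
Proof. by rewrite -rip_nsq rip_single singleE eqxx /sqmod !expr2. Qed.

Lemma rip_fix xi eta : (forall zeta, rip zeta xi = rip zeta eta) -> xi = eta.
Proof.
move=> h; apply/eqP; rewrite -subr_eq0; apply/eqP/nsq_eq0.
by rewrite -rip_nsq ripBr h subrr.
Qed.

(** * Existence of the adjoint *)

Section adjoint.
Variable T : bop R G.

(** Riesz representation in coordinates: the real functional [rip (T _) eta] is tested on the values
    1 and ['i] at the point [x]. *)
Let adj_fun eta (x : G) : R[i] :=
  Complex (rip (T (single x 1)) eta) (rip (T (single x 'i)) eta).

Let rip_adj_single eta x (c : R[i]) : rip (T (single x c)) eta =
  complex.Re c * complex.Re (adj_fun eta x) + complex.Im c * complex.Im (adj_fun eta x).
Proof.
rewrite [c in LHS]complexE singleD ['i * _]mulrC -[(complex.Re c)%:C]mulr1 !single_scale.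
by rewrite bopD !bopZ ripDl !ripZl.
Qed.

Let adj_fun_bound eta : exists2 K : R, 0 <= K & forall A,
  \sum_(x <- A) sqmod (adj_fun eta x) <= (K * hnorm eta) ^+ 2.
Proof.
have [M M0 hM] := bop_bound T; exists M => // A; set s := leLHS.
(* [zeta] is the candidate vector restricted to [A]. Testing [T] on it gives
   [s = |zeta|^2 <= M |zeta| |eta|], where one factor [|zeta|] cancels. *)
pose zeta := \sum_(x <- A) single x (adj_fun eta x).
have zE x : zeta x = if x \in A then adj_fun eta x else 0.
  rewrite ell2_sumE.
  rewrite (eq_bigr (fun y => if y == x then adj_fun eta x else 0 : R[i])); last first.
    by move=> y _; rewrite singleE eq_sym; case: eqP => // ->.
  case: ifPn => xA.
    by rewrite (big_fsetD1 x)//= eqxx big1_fset ?addr0// => y; rewrite !inE => /andP[/negPf->].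
  by rewrite big1_fset// => y yA _; case: eqP => // yx; move: xA; rewrite -yx yA.
have nz : nsq zeta = s.
  rewrite -rip_nsq {1}/zeta rip_suml /s big_seq [RHS]big_seq; apply: eq_bigr => x xA.
  by rewrite rip_single zE xA /sqmod !expr2.
have e1 : rip (T zeta) eta = s.
  rewrite /zeta bop_sum rip_suml; apply: eq_bigr => x _.
  by rewrite rip_adj_single /sqmod !expr2.
have s0 : 0 <= s by rewrite -nz nsq_ge0.
have h : s <= M * hnorm zeta * hnorm eta.
  rewrite -e1; apply: le_trans (ler_norm _) _; apply: le_trans (rip_le _ _) _.
  by rewrite ler_wpM2r ?hnorm_ge0.
have nzs : s = hnorm zeta ^+ 2 by rewrite -nz nsqE.
have [z0|zn0] := eqVneq (hnorm zeta) 0.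
  by rewrite nzs z0 expr0n /= sqr_ge0.
have zp : 0 < hnorm zeta by rewrite lt_def zn0 hnorm_ge0.
rewrite nzs ler_pXn2r// ?nnegrE ?mulr_ge0 ?hnorm_ge0//.
by move: h; rewrite nzs expr2 mulrAC mulrC ler_pM2r.
Qed.

Let adj_ss eta : adj_fun eta \in @square_summable R G.
Proof.
have [K _ h] := adj_fun_bound eta.
by rewrite inE; apply: le_lt_trans (sqsum_le h) _; rewrite ltry.
Qed.

Let adj_vec eta : ell2 R G := Ell2 (adj_ss eta).

Let adj_vecP xi eta : rip (T xi) eta = rip xi (adj_vec eta).
Proof.
have [M M0 hM] := bop_bound T; apply/eqP; rewrite -subr_eq0; apply/eqP.
apply: (@functional_eq0 (fun zeta => rip (T zeta) eta - rip zeta (adj_vec eta))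
  (M * hnorm eta + hnorm (adj_vec eta))).
- by move=> u v; rewrite bopD !ripDl opprD addrACA.
- move=> u; apply: le_trans (ler_normB _ _) _; rewrite mulrDl lerD//.
    apply: le_trans (rip_le _ _) _; rewrite mulrAC ler_wpM2r ?hnorm_ge0//.
  by apply: le_trans (rip_le _ _) _; rewrite mulrC.
- by move=> x c; rewrite rip_adj_single rip_single subrr.
Qed.

Lemma adjoint_exists : exists S, forall xi eta, rip (T xi) eta = rip xi (S eta).
Proof.
have bl : adj_vec \in @bounded_linear R G.
  rewrite inE; split.
    move=> c u v; apply: rip_fix => zeta.
    by rewrite -adj_vecP !ripDr ripZr_conj -bopZ ripZr_conj !adj_vecP.
  have [M M0 hM] := bop_bound T; exists M => eta; rewrite !l2normE.
  have [z0|zn0] := eqVneq (hnorm (adj_vec eta)) 0.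
    by rewrite z0 mulr_ge0 ?hnorm_ge0.
  have zp : 0 < hnorm (adj_vec eta) by rewrite lt_def zn0 hnorm_ge0.
  rewrite -(ler_pM2r zp) -expr2 -nsqE -rip_nsq -adj_vecP.
  apply: le_trans (ler_norm _) _; apply: le_trans (rip_le _ _) _.
  by rewrite mulrAC ler_wpM2r ?hnorm_ge0.
by exists (Bop bl).
Qed.

End adjoint.

(** The default 0 of [xget] is never taken, by [adjoint_exists]. *)
Definition adj T : bop R G :=
  xget (0 : bop R G) [set S : bop R G | forall xi eta, rip (T xi) eta = rip xi (S eta)].

Lemma adjP T xi eta : rip (T xi) eta = rip xi (adj T eta).
Proof.
rewrite /adj; case: xgetP => [S _ hS|h]; first exact: hS.
by have [S hS] := adjoint_exists T; case: (h S).
Qed.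

Lemma adjPl T xi eta : rip (adj T xi) eta = rip xi (T eta).
Proof. by rewrite ripC -adjP ripC. Qed.

Lemma adj_uniq T S : (forall xi eta, rip (T xi) eta = rip xi (S eta)) -> S = adj T.
Proof.
by move=> h; apply: bop_ext => eta; apply: rip_fix => xi; rewrite -h adjP.
Qed.

Lemma adjK T : adj (adj T) = T.
Proof. by apply/esym/adj_uniq => xi eta; rewrite adjPl. Qed.

Lemma adjM S T : adj (S * T) = adj T * adj S.
Proof. by apply/esym/adj_uniq => xi eta; rewrite !bop_mulE !adjP. Qed.

Lemma adjD S T : adj (S + T) = adj S + adj T.
Proof. by apply/esym/adj_uniq => xi eta; rewrite !bop_addE ripDl ripDr !adjP. Qed.

Lemma adjB S T : adj (S - T) = adj S - adj T.
Proof. by apply/esym/adj_uniq => xi eta; rewrite !bop_subE ripBl ripBr !adjP. Qed.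

Lemma adj1 : adj 1 = 1.
Proof. by apply/esym/adj_uniq => xi eta; rewrite !bop_oneE. Qed.

Lemma adj0 : adj (0 : bop R G) = 0.
Proof. by apply/esym/adj_uniq => xi eta; rewrite !bop_zeroE rip0l rip0r. Qed.

Lemma adjZ (c : R[i]) T : adj (c *: T) = conjc c *: adj T.
Proof.
apply/esym/adj_uniq => xi eta; rewrite !bop_scaleE ripZr_conj conjcK.
by rewrite -bopZ adjP.
Qed.

Lemma is_adjointP T S : is_adjoint T S <-> S = adj T.
Proof.
split=> [h|-> xi eta].
  apply: adj_uniq => xi eta; have := h xi eta; rewrite !inner_rip => -[]//.
by rewrite !inner_rip adjP -bopZ adjP.
Qed.

Lemma l2cvg_bop T (u : nat -> ell2 R G) xi : l2cvg u xi -> l2cvg (fun n => T (u n)) (T xi).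
Proof.
move=> h; have [M M0 hM] := bop_bound T.
apply: l2cvg_le (_ : (fun n => M * hnorm (u n - xi)) @ \oo --> 0) => [n|].
  by rewrite -bopB.
by rewrite -[0 in X in _ --> X](mulr0 M); apply: cvgM => //; exact: cvg_cst.
Qed.

Lemma strong_limit (T : nat -> bop R G) (M : R) :
  (forall n xi, hnorm (T n xi) <= M * hnorm xi) ->
  (forall xi, l2cauchy (fun n => T n xi)) ->
  exists2 S : bop R G, (forall xi, hnorm (S xi) <= M * hnorm xi) &
    forall xi, l2cvg (fun n => T n xi) (S xi).
Proof.
move=> hM hc; have /choice[f hf] : forall xi, exists eta, l2cvg (fun n => T n xi) eta.
  by move=> xi; exact: l2complete.
have fM xi : hnorm (f xi) <= M * hnorm xi.
  have := l2cvg_norm (hf xi) => h.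
  apply: (closed_cvg _ (@closed_le R (M * hnorm xi)) _ _ h) => //.
  by exists 0%N => // n _; exact: hM.
have bl : f \in @bounded_linear R G.
  rewrite inE; split; last by exists M => xi; rewrite !l2normE.
  move=> c u v; apply: l2cvg_unique (hf _) _.
  rewrite (_ : (fun n => _) = (fun n => c *: T n u + T n v)); last first.
    by apply/funext => n; rewrite bopD bopZ.
  exact: l2cvgD (l2cvgZ _ (hf _)) (hf _).
by exists (Bop bl).
Qed.

Lemma opnormE T : opnorm T = onorm T.
Proof.
have E : @l2norm R G = @hnorm R G by apply/funext => xi; rewrite l2normE.
by rewrite onorm.unlock /opnorm E.
Qed.

Lemma onorm_has_sup T :
  has_sup [set hnorm (T xi) | xi in [set xi | hnorm xi <= 1]].
Proof.
split; first by exists (hnorm (T 0)), 0 => //=; rewrite hnorm0.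
have [M M0 hM] := bop_bound T; exists M => _ [xi /= h <-].
by apply: le_trans (hM _) _; rewrite -[leRHS]mulr1 ler_wpM2l.
Qed.

Lemma onorm_ge0 T : 0 <= onorm T.
Proof.
rewrite onorm.unlock; apply: le_trans (hnorm_ge0 (T 0)) _; apply: sup_upper_bound.
  exact: onorm_has_sup.
by exists 0 => //=; rewrite hnorm0.
Qed.

Lemma onormP T xi : hnorm (T xi) <= onorm T * hnorm xi.
Proof.
have [z0|zn0] := eqVneq (hnorm xi) 0.
  by rewrite (hnorm_eq0 z0) bop0 hnorm0 mulr0.
have zp : 0 < hnorm xi by rewrite lt_def zn0 hnorm_ge0.
have s (c : R) eta : 0 <= c -> hnorm (c%:C *: eta) = c * hnorm eta.
  by move=> c0; rewrite hnormZ /sqmod /= expr0n /= addr0 sqrtr_sqr ger0_norm.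
rewrite -ler_pdivrMr// mulrC -s ?invr_ge0 ?hnorm_ge0// -bopZ onorm.unlock.
apply: sup_upper_bound; first exact: onorm_has_sup.
by exists ((hnorm xi)^-1%:C *: xi) => //=; rewrite s ?invr_ge0 ?hnorm_ge0// mulVf.
Qed.

Lemma onorm_le T (M : R) : 0 <= M -> (forall xi, hnorm (T xi) <= M * hnorm xi) ->
  onorm T <= M.
Proof.
move=> M0 hM; rewrite onorm.unlock; apply: ge_sup.
  by exists (hnorm (T 0)), 0 => //=; rewrite hnorm0.
move=> _ [xi /= h <-]; apply: le_trans (hM _) _.
by rewrite -[leRHS]mulr1 ler_wpM2l.
Qed.

Lemma onormD S T : onorm (S + T) <= onorm S + onorm T.
Proof.
apply: onorm_le => [|xi]; first by rewrite addr_ge0 ?onorm_ge0.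
rewrite bop_addE; apply: le_trans (hnormD _ _) _.
by rewrite mulrDl lerD ?onormP.
Qed.

Lemma onormM S T : onorm (S * T) <= onorm S * onorm T.
Proof.
apply: onorm_le => [|xi]; first by rewrite mulr_ge0 ?onorm_ge0.
rewrite bop_mulE; apply: le_trans (onormP _ _) _.
by rewrite -mulrA ler_wpM2l ?onorm_ge0 ?onormP.
Qed.

Lemma onormZ (c : R[i]) T : onorm (c *: T) <= Num.sqrt (sqmod c) * onorm T.
Proof.
apply: onorm_le => [|xi]; first by rewrite mulr_ge0 ?onorm_ge0 ?sqrtr_ge0.
rewrite bop_scaleE hnormZ -mulrA ler_wpM2l ?sqrtr_ge0 ?onormP//.
Qed.

Lemma onormN T : onorm (- T) = onorm T.
Proof.
have h S : onorm (- S) <= onorm S.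
  apply: onorm_le; first exact: onorm_ge0.
  by move=> xi; rewrite bop_oppE hnormN onormP.
by apply/eqP; rewrite eq_le h -{1}[T]opprK h.
Qed.

Lemma onormB S T : onorm (S - T) = onorm (T - S).
Proof. by rewrite -onormN opprB. Qed.

Lemma onorm0 : onorm (0 : bop R G) = 0.
Proof.
apply/eqP; rewrite eq_le onorm_ge0 andbT; apply: onorm_le => // xi.
by rewrite bop_zeroE hnorm0 mul0r.
Qed.

Lemma onorm1 : onorm (1 : bop R G) <= 1.
Proof. by apply: onorm_le => // xi; rewrite bop_oneE mul1r. Qed.

Lemma onorm_sum (I : Type) (s : seq I) (P : pred I) (F : I -> bop R G) :
  onorm (\sum_(i <- s | P i) F i) <= \sum_(i <- s | P i) onorm (F i).
Proof.
elim/big_rec2: _ => [|i u v _ h]; first by rewrite onorm0.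
by apply: le_trans (onormD _ _) _; rewrite lerD2l.
Qed.

Lemma onorm_adj T : onorm (adj T) = onorm T.
Proof.
have h S : onorm (adj S) <= onorm S.
  apply: onorm_le; first exact: onorm_ge0.
  move=> xi; have [z0|zn0] := eqVneq (hnorm (adj S xi)) 0.
    by rewrite z0 mulr_ge0 ?hnorm_ge0 ?onorm_ge0.
  have zp : 0 < hnorm (adj S xi) by rewrite lt_def zn0 hnorm_ge0.
  rewrite -(ler_pM2r zp) -expr2 -nsqE -rip_nsq adjPl.
  apply: le_trans (ler_norm _) _; apply: le_trans (rip_le _ _) _.
  by rewrite mulrC [leRHS]mulrAC ler_wpM2r ?hnorm_ge0 ?onormP.
by apply/eqP; rewrite eq_le h -{1}[T]adjK h.
Qed.

End bounded_operators.

(** * The trace on LG *)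

Section positive_contraction_powers.
Variables (R : realType) (G : choiceType).
Implicit Types (xi eta zeta : ell2 R G) (S T C : bop R G).

Lemma adjX C n : adj C = C -> adj (C ^+ n) = C ^+ n.
Proof.
by move=> hC; elim: n => [|n IHn]; rewrite ?expr0 ?adj1// {1}exprS adjM hC IHn -exprSr.
Qed.

Lemma exprD_vec C i j xi : (C ^+ (i + j)) xi = (C ^+ i) ((C ^+ j) xi).
Proof. by rewrite exprD. Qed.

Lemma exprS_vec C n xi : (C ^+ n.+1) xi = C ((C ^+ n) xi).
Proof. by rewrite exprS. Qed.

Lemma expr_fix C n xi : C xi = xi -> (C ^+ n) xi = xi.
Proof. by move=> h; elim: n => // n IHn; rewrite exprS_vec IHn. Qed.

Definition positive_contraction C :=
  adj C = C /\ forall xi, 0 <= rip (C xi) xi <= rip xi xi.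

Variable C : bop R G.
Hypothesis posC : positive_contraction C.

Let adjC : adj C = C. Proof. by case: posC. Qed.

Lemma rip_powD i j xi eta : rip ((C ^+ (i + j)) xi) eta = rip ((C ^+ i) xi) ((C ^+ j) eta).
Proof. by rewrite addnC exprD_vec -{1}(adjX j adjC) adjPl. Qed.

(** An even power is the square of a self-adjoint operator; an odd one is [C] between two equal
    self-adjoint powers. *)
Lemma pow_rip_ge0 n xi : 0 <= rip ((C ^+ n) xi) xi.
Proof.
rewrite -[n]odd_double_half; set j := n./2.
case: (odd n); last by rewrite add0n -addnn rip_powD rip_ge0.
rewrite add1n -addnn -addSn rip_powD exprS_vec.
by case: posC => _ /(_ ((C ^+ j) xi))/andP[].
Qed.

Lemma pow_rip_decrS n xi : rip ((C ^+ n.+1) xi) xi <= rip ((C ^+ n) xi) xi.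
Proof.
rewrite -[n]odd_double_half; set j := n./2.
case: (odd n); last first.
  rewrite add0n -addnn -addSn !rip_powD exprS_vec.
  by case: posC => _ /(_ ((C ^+ j) xi))/andP[].
rewrite add1n -addnn (_ : (j + j).+2 = j.+1 + j.+1)%N; last by rewrite addSn addnS.
rewrite -addSn !rip_powD exprS_vec.
(* For odd exponents: [C - C^2 = C (1 - C) C + (1 - C) C (1 - C)] is a sum of positive operators. *)
set eta := (C ^+ j) xi; set b := C eta.
have [_ h] := posC; have /andP[_ h1] := h b; have /andP[h2 _] := h (eta - b).
have e : rip (C b) eta = rip b b by rewrite -{1}adjC adjPl.
move: h1 h2; rewrite bopB -/b ripBl !ripBr e.
move: (rip b eta) (rip b b) (rip (C b) b) => u v w; lra.
Qed.

Lemma pow_rip_decr m n xi : (m <= n)%N -> rip ((C ^+ n) xi) xi <= rip ((C ^+ m) xi) xi.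
Proof.
move=> /subnK <-; elim: (n - m)%N => // k IHk.
by rewrite addSn; apply: le_trans (pow_rip_decrS _ _) IHk.
Qed.

Lemma pow_rip_cvg xi : exists l : R, [/\ rip ((C ^+ n) xi) xi @[n --> \oo] --> l,
  0 <= l & forall n, l <= rip ((C ^+ n) xi) xi].
Proof.
pose h n := rip ((C ^+ n) xi) xi.
have hd : {homo h : m n / (m <= n)%N >-> n <= m} by move=> m n mn; exact: pow_rip_decr.
have hb : has_lbound (range h) by exists 0 => _ [n _ <-]; exact: pow_rip_ge0.
have := nonincreasing_cvgn hd hb; set l := inf _ => hl; exists l; split=> //.
  by apply: lb_le_inf; [exists (h 0%N), 0%N|move=> _ [n _ <-]; exact: pow_rip_ge0].
by move=> n; apply: ge_inf => //; exists n.
Qed.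

(** With [h n = rip ((C ^+ n) xi) xi], which decreases to [l], the squared distance of two powers is
    [h (2m) - 2 h (m + n) + h (2n)], at most [2 (h N - l)]. *)
Lemma pow_cauchy xi : l2cauchy (fun n => (C ^+ n) xi).
Proof.
move=> e e0; have [l [hl l0 lh]] := pow_rip_cvg xi.
have e20 : 0 < e ^+ 2 / 2 by rewrite divr_gt0// exprn_gt0.
have /cvgrPdist_le/(_ _ e20)[N _ hN] := hl; exists N => m n Nm Nn.
rewrite (hnorm_le_nsq _ (ltW e0)) nsqB -!rip_nsq -!rip_powD.
have := hN N (leqnn _); rewrite /= distrC ler_norml => /andP[_ h].
have h1 : rip ((C ^+ (m + m)) xi) xi <= rip ((C ^+ N) xi) xi.
  by apply: pow_rip_decr; rewrite (leq_trans Nm)// leq_addr.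
have h2 : rip ((C ^+ (n + n)) xi) xi <= rip ((C ^+ N) xi) xi.
  by apply: pow_rip_decr; rewrite (leq_trans Nn)// leq_addr.
have h3 := lh (m + n)%N.
move: h h1 h2 h3; move: (rip _ _) (rip _ _) (rip _ _) (rip _ _) (e ^+ 2) => a b c d f.
by lra.
Qed.

Lemma contraction_norm xi : hnorm (C xi) <= hnorm xi.
Proof.
rewrite (hnorm_le_nsq _ (hnorm_ge0 _)) -!nsqE -!rip_nsq.
have := pow_rip_decr xi (isT : (0 <= 2)%N).
by rewrite -[2%N]/(1 + 1)%N rip_powD expr1 expr0.
Qed.

Lemma pow_norm n xi : hnorm ((C ^+ n) xi) <= 1 * hnorm xi.
Proof.
rewrite mul1r; elim: n => [|n IHn]; first by rewrite expr0.
by rewrite exprS_vec (le_trans (contraction_norm _)).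
Qed.

(** [E] is the orthogonal projection onto the fixed vectors of [C], that is, the spectral projection
    of [C] at 1. *)
Lemma pow_limit : exists E : bop R G, [/\ forall xi, l2cvg (fun n => (C ^+ n) xi) (E xi),
  forall xi, C (E xi) = E xi & forall xi, rip (E xi) xi = nsq (E xi)].
Proof.
have [E _ hE] := strong_limit pow_norm pow_cauchy; exists E.
have CE xi : C (E xi) = E xi.
  have h1 := l2cvg_bop C (hE xi).
  have : (fun n => C ((C ^+ n) xi)) = (fun n => (C ^+ n.+1) xi).
    by apply/funext => n; rewrite exprS_vec.
  by move=> e; rewrite e in h1; exact: (l2cvg_unique h1 (l2cvg_shift (hE xi))).
split=> // xi; rewrite -rip_nsq.
have h1 : rip ((C ^+ n) xi) (E xi) @[n --> \oo] --> rip xi (E xi).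
  rewrite (_ : (fun n => _) = fun=> rip xi (E xi)); first exact: cvg_cst.
  by apply/funext => n; rewrite -{1}(adjX n adjC) adjPl expr_fix.
by rewrite -(rcvg_unique h1 (@l2cvg_rip _ _ _ _ (E xi) (hE xi))) ripC.
Qed.

Lemma pow_cvg0 : (forall xi, C xi = xi -> xi = 0) ->
  forall xi, rip ((C ^+ n) xi) xi @[n --> \oo] --> 0.
Proof.
move=> h xi; have [E [hE CE _]] := pow_limit.
by rewrite -(rip0l xi) -(h _ (CE xi)); exact: l2cvg_rip.
Qed.

End positive_contraction_powers.

(** * Left and right translations, and the trace *)

Section group_operators.
Variables (R : realType) (G : groupType).
Implicit Types (xi eta zeta : ell2 R G) (S T C : bop R G) (g h x y : G).
Local Open Scope complex_scope.

Lemma lambdaE g xi x : lambda R g xi x = xi (g^-1 * x)%g :> R[i]. Proof. by []. Qed.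

Lemma lambda1 : lambda R (1%g : G) = 1.
Proof. by apply: bop_ext => xi; apply: ell2_eqP => x; rewrite lambdaE invg1 mul1g. Qed.

Lemma nsq_lambda g xi : nsq (lambda R g xi) = nsq xi.
Proof. by rewrite !nsqE_fine (sqsum_translate (ell2_val xi) g). Qed.

Lemma rip_isometry (f : ell2 R G -> ell2 R G) xi eta :
  {morph f : u v / u + v} -> {morph f : u v / u - v} ->
  (forall u, nsq (f u) = nsq u) -> rip (f xi) (f eta) = rip xi eta.
Proof. by move=> fD fB fn; rewrite rip.unlock -fD -fB !fn. Qed.

Lemma adj_lambda g : adj (lambda R g) = lambda R (g^-1)%g.
Proof.
apply/esym/adj_uniq => xi eta.
rewrite -(@rip_isometry (lambda R (g^-1)%g))//; last 1 first.
- exact: nsq_lambda.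
- by rewrite -bop_mulE -lambdaM mulVg lambda1.
- by move=> u v; rewrite bopD.
- by move=> u v; rewrite bopB.
Qed.

Lemma onorm_lambda g : onorm (lambda R g) <= 1.
Proof. by apply: onorm_le => // xi; rewrite mul1r !hnormE nsq_lambda. Qed.

Lemma sqsum_right (f : G -> R[i]) g : sqsum (fun x => f (x * g)%g) = sqsum f.
Proof.
rewrite /sqsum; symmetry.
apply: (reindex_esum setT setT (fun x => (x * g)%g)); split=> //.
- by move=> x y _ _ /mulIg.
- by move=> x _; exists (x * g^-1)%g => //; rewrite mulgVK.
Qed.

Fact rho_vec_subproof g xi : (fun x => xi (x * g)%g) \in @square_summable R G.
Proof. by rewrite inE sqsum_right; case: xi. Qed.
Definition rho_vec g xi : ell2 R G := Ell2 (rho_vec_subproof g xi).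

Fact rho_subproof g : rho_vec g \in @bounded_linear R G.
Proof.
rewrite inE; split=> [c u v|]; first exact: ell2_ext.
by exists 1 => xi; rewrite mul1r /l2norm (sqsum_right (ell2_val xi) g).
Qed.
(** The right regular representation. It commutes with LG and carries [delta1] to every point of
    [G], so an element of LG is determined by its value at [delta1]. *)
Definition rho g : bop R G := Bop (rho_subproof g).

Lemma rhoE g xi x : rho g xi x = xi (x * g)%g :> R[i]. Proof. by []. Qed.

Lemma rhoM g h : rho (g * h)%g = rho g * rho h.
Proof. by apply: bop_ext => xi; apply: ell2_eqP => x; rewrite !rhoE mulgA. Qed.

Lemma rho1 : rho 1%g = 1.
Proof. by apply: bop_ext => xi; apply: ell2_eqP => x; rewrite rhoE mulg1. Qed.

Lemma nsq_rho g xi : nsq (rho g xi) = nsq xi.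
Proof. by rewrite !nsqE_fine (sqsum_right (ell2_val xi) g). Qed.

Lemma rip_rho g xi eta : rip (rho g xi) (rho g eta) = rip xi eta.
Proof.
apply: (@rip_isometry (rho g)); last exact: nsq_rho.
  by move=> u v; rewrite bopD.
by move=> u v; rewrite bopB.
Qed.

Lemma rho_commutant g : commutant (range (@lambda R G)) (rho g).
Proof.
move=> _ [h _ <-]; apply: bop_ext => xi; apply: ell2_eqP => x.
by rewrite !bop_mulE rhoE !lambdaE rhoE mulgA.
Qed.

Lemma in_LGE T : (T \in @in_LG R G) <-> commutant (commutant (range (@lambda R G))) T.
Proof. by rewrite inE. Qed.

Lemma in_LGP T : T \in @in_LG R G -> forall g xi, T (rho g xi) = rho g (T xi).
Proof.
move=> /in_LGE hT g xi.
by rewrite -!bop_mulE hT//; exact: rho_commutant.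
Qed.

Lemma adj_in_LG T : T \in @in_LG R G -> adj T \in @in_LG R G.
Proof.
move=> /in_LGE hT; apply/in_LGE => U hU.
have hU' : commutant (range (@lambda R G)) (adj U).
  move=> _ [g _ <-]; rewrite -[g]invgK -adj_lambda -!adjM.
  by congr adj; rewrite hU//; exists (g^-1)%g.
by rewrite -[U]adjK -!adjM hT.
Qed.

Lemma limit_in_LG (T : nat -> bop R G) S : (forall n, T n \in @in_LG R G) ->
  (forall xi, l2cvg (fun n => T n xi) (S xi)) -> S \in @in_LG R G.
Proof.
move=> hT hS; apply/in_LGE => U hU; apply: bop_ext => xi.
apply: l2cvg_unique (hS _) _; have h := l2cvg_bop U (hS xi).
rewrite (_ : (fun n => _) = fun n => U (T n xi))//.
apply/funext => n; have := hT n; move=> /in_LGE/(_ U hU).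
by move=> /(congr1 (fun V : bop R G => V xi)).
Qed.

Lemma scale_in_LG (c : R[i]) T : T \in @in_LG R G -> c *: T \in @in_LG R G.
Proof.
move=> /in_LGE hT; apply/in_LGE => U hU; apply: bop_ext => xi.
rewrite !bop_mulE !bop_scaleE bopZ; congr (_ *: _).
by rewrite -!bop_mulE hT.
Qed.

Lemma delta1E : delta1 R G = single 1%g 1.
Proof. by apply: ell2_eqP => x; rewrite singleE /=; case: eqP. Qed.

Lemma single_rho x (c : R[i]) : single x c = rho (x^-1)%g (c *: delta1 R G).
Proof.
apply: ell2_eqP => y; rewrite rhoE ell2ZE delta1E !singleE.
rewrite (_ : (y == x) = (y * x^-1 == 1)%g); last first.
  by rewrite -(inj_eq (@mulIg _ x) (y * x^-1)%g) mulgVK mul1g.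
by case: eqP; rewrite ?mulr1 ?mulr0.
Qed.

(** The real part of the trace; the imaginary part is later recovered by scaling with [- 'i]. *)
Definition rtr T : R := rip (T (delta1 R G)) (delta1 R G).

Lemma rtrD S T : rtr (S + T) = rtr S + rtr T. Proof. by rewrite /rtr ripDl. Qed.
Lemma rtrB S T : rtr (S - T) = rtr S - rtr T. Proof. by rewrite /rtr ripBl. Qed.

Lemma rtr1 : rtr 1 = 1.
Proof. by rewrite /rtr rip_nsq delta1E nsq_single /sqmod /= expr0n expr1n addr0. Qed.

Lemma rtr_single T x (c : R[i]) : T \in @in_LG R G ->
  rip (T (single x c)) (single x c) = sqmod c * rtr T.
Proof.
move=> hT; rewrite !single_rho (in_LGP hT) rip_rho bopZ ripZr_conj scalerA.
rewrite scale_ReIm ripDl !ripZl /sqmod /rtr; case: c => a b /=.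
by ring.
Qed.

Lemma sqsum_flip (f : G -> R[i]) : sqsum (fun x => conjc (f (x^-1)%g)) = sqsum f.
Proof.
transitivity (sqsum (fun x => f (x^-1)%g)).
  by apply: eq_esum => x _; congr (_%:E); case: (f _) => a b; rewrite /sqmod /= sqrrN.
rewrite /sqsum; symmetry.
apply: (reindex_esum setT setT (fun x : G => (x^-1)%g)); split=> //.
- by move=> x y _ _ /invg_inj.
- by move=> x _; exists (x^-1)%g => //; rewrite invgK.
Qed.

Fact flip_subproof xi : (fun x => conjc (xi (x^-1)%g)) \in @square_summable R G.
Proof. by rewrite inE sqsum_flip; case: xi. Qed.
(** The modular conjugation: for [T] in LG it exchanges [T delta1] and [adj T delta1]. Being
    isometric for [rip], it makes [rtr] tracial. *)
Definition flip xi : ell2 R G := Ell2 (flip_subproof xi).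

Lemma flipE xi x : flip xi x = conjc (xi (x^-1)%g) :> R[i]. Proof. by []. Qed.

Lemma flipK xi : flip (flip xi) = xi.
Proof. by apply: ell2_eqP => x; rewrite !flipE invgK conjcK. Qed.

Lemma nsq_flip xi : nsq (flip xi) = nsq xi.
Proof. by rewrite !nsqE_fine (sqsum_flip (ell2_val xi)). Qed.

Lemma rip_flip xi eta : rip (flip xi) (flip eta) = rip xi eta.
Proof.
apply: (@rip_isometry flip); last exact: nsq_flip.
  by move=> u v; apply: ell2_eqP => x; rewrite ell2DE !flipE ell2DE rmorphD.
by move=> u v; apply: ell2_eqP => x; rewrite ell2BE !flipE ell2BE rmorphB.
Qed.

Lemma adj_delta1 T : T \in @in_LG R G -> adj T (delta1 R G) = flip (T (delta1 R G)).
Proof.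
move=> hT; apply: ell2_eqP => x; set z := T _.
have key (c : R[i]) : rip (single x c) (adj T (delta1 R G)) = complex.Re (c * z (x^-1)%g).
  rewrite -adjP single_rho (in_LGP hT) bopZ -/z.
  rewrite -(rip_rho x) -bop_mulE -rhoM mulgV rho1 bop_oneE.
  have -> : rho x (delta1 R G) = single (x^-1)%g 1.
    by rewrite single_rho invgK scale1r.
  rewrite ripC rip_single ell2ZE; case: c (z _) => a b [u v] /=; ring.
have := key 1; have := key 'i; rewrite !rip_single flipE.
case: (adj T (delta1 R G) x) (z _) => a b [u v] /= h1 h2.
by congr Complex; move: h1 h2; rewrite !(mul0r, mul1r, add0r, addr0, subr0, sub0r).
Qed.

Lemma rtrC S T : S \in @in_LG R G -> T \in @in_LG R G -> rtr (S * T) = rtr (T * S).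
Proof.
move=> hS hT; rewrite /rtr !bop_mulE [LHS]adjP [RHS]adjP (adj_delta1 hS) (adj_delta1 hT).
by rewrite -[LHS]rip_flip flipK ripC.
Qed.

(** The limit [E] of the powers is a projection in LG with trace 0. All its diagonal entries equal
    its trace, since it commutes with right translations, so [E = 0]. *)
Lemma trace_pow_fix C : C \in @in_LG R G -> positive_contraction C ->
  rtr (C ^+ n) @[n --> \oo] --> 0 -> forall xi, C xi = xi -> xi = 0.
Proof.
move=> hC pC h0 xi Cxi; have [E [hE CE nE]] := pow_limit pC.
have hX n : C ^+ n \in @in_LG R G by rewrite rpredX.
have hEL := limit_in_LG hX hE.
have tE : rtr E = 0 by exact: rcvg_unique (l2cvg_rip (hE _)) h0.
have E0 : E = 0.
  apply: bop_single_eq => x c; apply: nsq_eq0.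
  by rewrite -nE (rtr_single _ _ hEL) tE mulr0.
have : E xi = xi.
  apply: l2cvg_unique (hE xi) _; rewrite (_ : (fun n => _) = fun=> xi).
    exact: l2cvg_cst.
  by apply/funext => n; rewrite expr_fix.
by rewrite E0 bop_zeroE.
Qed.

Lemma trace_pow_cvg0 C : positive_contraction C -> (forall xi, C xi = xi -> xi = 0) ->
  rtr (C ^+ n) @[n --> \oo] --> 0.
Proof. by move=> pC h; exact: pow_cvg0. Qed.

End group_operators.

(** * Injective elements of LG *)

Section ore.
Variables (R : realType) (G : groupType).
Implicit Types (xi eta zeta u v : ell2 R G) (S T C : bop R G).
Local Open Scope complex_scope.

Definition injective_op T := forall xi, T xi = 0 -> xi = 0.

(** Used to rescale operators to contractions; a positive factor does not affect injectivity. *)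
Lemma small_scale (K : R) : exists2 c : R, 0 < c & c ^+ 2 * K <= 1.
Proof.
have K0 : 0 < `|K| + 1 by rewrite ltr_wpDl.
exists (`|K| + 1)^-1; first by rewrite invr_gt0.
rewrite expr2 -mulrA mulrC ler_pdivrMr// mul1r mulrC ler_pdivrMr//.
have := ler_norm K; move: K0; move: (`|K|) => a; nra.
Qed.

Lemma injective_scale (c : R) T : 0 < c -> injective_op T -> injective_op (c%:C *: T).
Proof.
move=> c0 h xi /eqP; rewrite bop_scaleE scaler_eq0 => /orP[|/eqP/h//].
by move/eqP => [] c00; move: c0; rewrite c00 ltxx.
Qed.

Lemma pos_contr_1sub T : (forall xi, nsq (adj T xi) <= nsq xi) ->
  positive_contraction (1 - T * adj T).
Proof.
move=> h; split=> [|xi]; first by rewrite adjB adj1 adjM adjK.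
have e : rip (T (adj T xi)) xi = nsq (adj T xi) by rewrite adjP rip_nsq.
rewrite bop_subE bop_oneE bop_mulE ripBl e rip_nsq.
have := h xi; have := nsq_ge0 (adj T xi).
by move: (nsq xi) (nsq (adj T xi)) => a b; lra.
Qed.

(** [adj T] intertwines the two powers, so cyclicity of the trace turns [C ^+ n * (T * adj T)] into
    [D ^+ n * (adj T * T)]. *)
Lemma rtr_pow_swap T n : T \in @in_LG R G ->
  rtr ((1 - T * adj T) ^+ n) = rtr ((1 - adj T * T) ^+ n).
Proof.
move=> hT; have hA := adj_in_LG hT.
set C := 1 - T * adj T; set D := 1 - adj T * T.
have DT k : D ^+ k * adj T = adj T * C ^+ k.
  elim: k => [|k IHk]; first by rewrite !expr0 mul1r mulr1.
  rewrite exprS -mulrA IHk mulrA exprS [RHS]mulrA; congr (_ * _).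
  by rewrite /C /D mulrBl mulrBr mul1r mulr1 mulrA.
have hC k : C ^+ k \in @in_LG R G by rewrite rpredX ?rpredB ?rpred1 ?rpredM.
elim: n => [|n IHn]; first by rewrite !expr0.
rewrite !exprSr {2}/C {2}/D !mulrBr !mulr1 !rtrB IHn; congr (_ - _).
by rewrite [in LHS]mulrA rtrC ?rpredM// [in LHS]mulrA -DT -mulrA.
Qed.


(** Finiteness of LG. After scaling [T] to a contraction [S], the kernels of [adj S] and [S] are the
    fixed spaces of [1 - S * adj S] and [1 - adj S * S], whose powers have the same traces by
    [rtr_pow_swap]. *)
Lemma injective_adj T : T \in @in_LG R G -> injective_op (adj T) -> injective_op T.
Proof.
move=> hT iT xi Txi.
have [c c0 hc] := small_scale (onorm T ^+ 2).
pose S := c%:C *: T; have hS : S \in @in_LG R G by exact: scale_in_LG.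
have hA := adj_in_LG hS.
have bS (U : bop R G) eta : onorm U = onorm T -> nsq ((c%:C *: U) eta) <= nsq eta.
  move=> hU; rewrite bop_scaleE nsq_scaleR nsqE.
  apply: le_trans (_ : c ^+ 2 * (onorm T ^+ 2 * nsq eta) <= _).
    rewrite ler_pM2l ?exprn_gt0// nsqE -exprMn ler_pXn2r ?nnegrE ?mulr_ge0 ?hnorm_ge0 ?onorm_ge0//.
    by rewrite -hU onormP.
  by rewrite mulrA ler_piMl ?nsq_ge0.
have aS : adj S = c%:C *: adj T by rewrite adjZ conjc_real.
have p1 : positive_contraction (1 - S * adj S).
  by apply: pos_contr_1sub => eta; rewrite aS bS// onorm_adj.
have p2 : positive_contraction (1 - adj S * S).
  by rewrite -{2}[S]adjK; apply: pos_contr_1sub => eta; rewrite adjK bS.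
have t0 : rtr ((1 - S * adj S) ^+ n) @[n --> \oo] --> 0.
  apply: trace_pow_cvg0 => // eta; rewrite bop_subE bop_oneE => /eqP.
  rewrite -subr_eq0 addrAC subrr add0r oppr_eq0 => /eqP h.
  have : nsq (adj S eta) = 0 by rewrite -rip_nsq adjPl -bop_mulE h rip0r.
  by move/nsq_eq0; rewrite aS; exact: injective_scale.
apply: (@trace_pow_fix _ _ (1 - adj S * S)) => //.
- by rewrite rpredB ?rpred1 ?rpredM.
- by under eq_fun do rewrite -rtr_pow_swap//.
by rewrite bop_subE bop_oneE bop_mulE bop_scaleE Txi scaler0 bop0 subr0.
Qed.

Lemma injective_mul S T : injective_op S -> injective_op T -> injective_op (S * T).
Proof. by move=> hS hT xi; rewrite bop_mulE => /hS/hT. Qed.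

Lemma injective_mull S T : injective_op (S * T) -> injective_op T.
Proof. by move=> h xi Txi; apply: h; rewrite bop_mulE Txi bop0. Qed.

(* Only the right factor of an injective product is injective a priori; the
   trace gives the left one. *)
Lemma injective_mulr S T : S \in @in_LG R G -> T \in @in_LG R G ->
  injective_op (S * T) -> injective_op S.
Proof.
move=> hS hT h; apply: injective_adj => //.
apply: (@injective_mull (adj T)); rewrite -adjM.
by apply: injective_adj; rewrite ?adj_in_LG ?rpredM ?adjK.
Qed.

Lemma injective_adjoint T : T \in @in_LG R G -> injective_op T -> injective_op (adj T).
Proof. by move=> hT h; apply: injective_adj; rewrite ?adj_in_LG ?adjK. Qed.

End ore.

(** * The Ore condition *)

Section ore_construction.
Variables (R : realType) (G : groupType).
Implicit Types (xi eta zeta u v : ell2 R G) (S T C : bop R G).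
Local Open Scope complex_scope.
Variables m b : bop R G.
Hypotheses (mLG : m \in @in_LG R G) (bLG : b \in @in_LG R G).
Hypothesis small : forall u, nsq (m u) + nsq (b u) <= nsq u.

Let N := adj m * m + adj b * b.
Let C := 1 - N.
(** Partial sums of the Neumann series for the inverse of [N]. This inverse may be unbounded, but
    the products of [g n] with [m] or [b] on the left and an adjoint of [m] or [b] on the right stay
    bounded. *)
Let g n := \sum_(j < n) C ^+ j.

Let ripN u v : rip (N u) v = rip (m u) (m v) + rip (b u) (b v).
Proof. by rewrite bop_addE ripDl !bop_mulE !adjPl. Qed.

Let CE u : C u = u - N u. Proof. by []. Qed.
Let NE u : N u = u - C u. Proof. by rewrite CE opprB addrC subrK. Qed.

Let posC : positive_contraction C.
Proof.
split=> [|u]; first by rewrite /C /N adjB adj1 adjD !adjM !adjK.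
rewrite CE ripBl ripN !rip_nsq; have := small u.
by have := nsq_ge0 (m u); have := nsq_ge0 (b u); move: (nsq _) (nsq _) (nsq _) => x y z; lra.
Qed.

Let CLG n : C ^+ n \in @in_LG R G.
Proof. by rewrite rpredX ?rpredB ?rpred1 ?rpredD ?rpredM ?adj_in_LG. Qed.

Let gLG n : g n \in @in_LG R G.
Proof. by apply: rpred_sum => j _; exact: CLG. Qed.

Let gE n u : g n u = \sum_(j < n) (C ^+ j) u.
Proof. by rewrite bop_sumE. Qed.

Let gS n u : g n.+1 u = g n u + (C ^+ n) u.
Proof. by rewrite !gE big_ord_recr. Qed.

Let adj_g n : adj (g n) = g n.
Proof.
apply/esym/adj_uniq => u v; rewrite !gE rip_suml rip_sumr; apply: eq_bigr => j _.
by rewrite adjP adjX; last by case: posC.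
Qed.

Let Ng n u : N (g n u) = u - (C ^+ n) u.
Proof.
elim: n => [|n IHn]; first by rewrite gE big_ord0 bop0 expr0 bop_oneE subrr.
rewrite gS bopD IHn exprS_vec NE.
by rewrite addrA subrK.
Qed.

Let gN n u : g n (N u) = u - (C ^+ n) u.
Proof.
elim: n => [|n IHn]; first by rewrite gE big_ord0 expr0 bop_oneE subrr.
rewrite gS IHn NE bopB -(bop_mulE (C ^+ n)) -exprSr.
by rewrite addrA subrK.
Qed.

Let H zeta j := rip ((C ^+ j) zeta) zeta.
Let h zeta n := rip (g n zeta) zeta.

Let hE zeta n : h zeta n = \sum_(j < n) H zeta j.
Proof. by rewrite /h gE rip_suml. Qed.

Let nsqN u : nsq (m u) + nsq (b u) = rip (N u) u.
Proof. by rewrite ripN !rip_nsq. Qed.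

(** Expand [0 <= |u - m a|^2 + |v - b a|^2] for [a = g n zeta]: the cross terms contribute [-2 h],
    and [rip (N a) a <= h] because the powers of [C] are positive. *)
Let h_bound u v n : h (adj m u + adj b v) n <= nsq u + nsq v.
Proof.
set zeta := _ + _; set a := g n zeta.
have p1 := nsq_ge0 (u - m a); have p2 := nsq_ge0 (v - b a); rewrite !nsqB in p1 p2.
have e1 : rip u (m a) + rip v (b a) = h zeta n.
  by rewrite /h -/a /zeta ripDr -!adjP ripC [rip v _]ripC.
have e2 := nsqN a; have e3 : rip (N a) a = h zeta n - rip ((C ^+ n) zeta) a.
  by rewrite /a Ng ripBl ripC.
have e4 : 0 <= rip ((C ^+ n) zeta) a.
  rewrite /a gE rip_sumr sumr_ge0// => j _.
  by rewrite -rip_powD// pow_rip_ge0.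
move: e1 e2 e3 e4 p1 p2; move: (rip u (m a)) (rip v (b a)) (rip (N a) a) => x y z.
move: (nsq (m a)) (nsq (b a)) (nsq u) (nsq v) => x1 x2 x3 x4.
by move: (h zeta n) (rip ((C ^+ n) zeta) a) => x5 x6; lra.
Qed.

(** [N] telescopes on the difference [d] of the partial sums, so [rip (N d) d] is the sum of
    [H (k + j) - H (n + j)] over [k <= j < n], and each term is at most [H j]. *)
Let h_diff zeta k n : (k <= n)%N ->
  nsq (m (g n zeta - g k zeta)) + nsq (b (g n zeta - g k zeta)) <= h zeta n - h zeta k.
Proof.
move=> kn; rewrite nsqN bopB !Ng opprB addrC addrA subrK.
have -> : h zeta n - h zeta k = \sum_(k <= j < n) H zeta j.
  by rewrite !hE -!(big_mkord xpredT) (big_cat_nat (n := k))//= addrAC subrr add0r.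
have -> : g n zeta - g k zeta = \sum_(k <= j < n) (C ^+ j) zeta.
  rewrite !gE -!(big_mkord xpredT (fun j => (C ^+ j) zeta)) (big_cat_nat (n := k))//=.
  by rewrite addrAC subrr add0r.
rewrite rip_sumr; apply: ler_sum => j _; rewrite ripBl -!rip_powD//.
have := pow_rip_decr posC zeta (leq_addl k j).
by have := pow_rip_ge0 posC (n + j) zeta; rewrite /H; lra.
Qed.


Let H_cvg zeta : exists l : R, H zeta n @[n --> \oo] --> l.
Proof. by have [l [hl _ _]] := pow_rip_cvg posC zeta; exists l. Qed.

(** As [N = 1 - C], this is [H (2n) - H (2n + 1)] for a convergent sequence [H]. *)
Let NC_cvg zeta : rip (N ((C ^+ n) zeta)) ((C ^+ n) zeta) @[n --> \oo] --> 0.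
Proof.
have [l hl] := H_cvg zeta.
rewrite (_ : (fun n => _) = fun n => H zeta (n + n) - H zeta ((n + n).+1)); last first.
  apply/funext => n; rewrite /H -addSn !rip_powD// -ripBl exprS_vec.
  by rewrite NE.
have h2 : H zeta (n + n) @[n --> \oo] --> l.
  apply: cvg_comp hl => A [M _ hA]; exists M => // n /= Mn; apply: hA => /=.
  by rewrite (leq_trans Mn) ?leq_addr.
have h3 : H zeta (n + n).+1 @[n --> \oo] --> l.
  apply: (@cvg_comp _ _ _ (fun n => (n + n).+1) (H zeta) _ _ _ _ hl) => A [M _ hA].
  exists M => // n /= Mn; apply: hA => /=.
  by rewrite (leq_trans Mn) ?leqW ?leq_addr.
by rewrite -(subrr l); exact: cvgB.
Qed.

Let mC_cvg (T : bop R G) zeta : (forall u, nsq (T u) <= rip (N u) u) ->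
  l2cvg (fun n => T ((C ^+ n) zeta)) 0.
Proof.
move=> hT; apply/l2cvgP => e e0.
have /cvgrPdist_le/(_ _ (exprn_gt0 2 e0)) := NC_cvg zeta.
apply: filterS => n; rewrite sub0r normrN subr0 (hnorm_le_nsq _ (ltW e0)).
by apply: le_trans; apply: le_trans (hT _) (ler_norm _).
Qed.

Let hm u : nsq (m u) <= rip (N u) u.
Proof. by rewrite -nsqN lerDl nsq_ge0. Qed.

Let hb u : nsq (b u) <= rip (N u) u.
Proof. by rewrite -nsqN lerDr nsq_ge0. Qed.

Let h_cauchy u v (e : R) : 0 < e -> exists M, forall k n, (M <= k)%N -> (k <= n)%N ->
  h (adj m u + adj b v) n - h (adj m u + adj b v) k <= e.
Proof.
move=> e0; set zeta := _ + _.
have hn : {homo h zeta : k n / (k <= n)%N >-> k <= n}.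
  move=> k n kn; rewrite -subr_ge0; apply: le_trans (h_diff zeta kn).
  by rewrite addr_ge0 ?nsq_ge0.
have hub : has_ubound (range (h zeta)).
  by exists (nsq u + nsq v) => _ [n _ <-]; exact: h_bound.
have hc := nondecreasing_cvgn hn hub.
have /cvgrPdist_le/(_ _ e0)[M _ hM] := hc; exists M => k n Mk kn.
have := hM k Mk; rewrite ler_norml => /andP[_ h1].
have : h zeta n <= sup (range (h zeta)).
  by apply: sup_upper_bound; [split; [exists (h zeta 0%N), 0%N|]|exists n].
by move: h1; move: (h zeta n) (h zeta k) (sup _) => x y z; lra.
Qed.

(** The sequence [h] is increasing and bounded, and its increments dominate those of [T * g n * S].
    The map [f] is [(w, 0)] or [(0, w)] and treats [S = adj m] and [S = adj b] at once. *)
Let limit_exists (T S : bop R G) : (forall u, nsq (T u) <= rip (N u) u) ->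
  (exists f : ell2 R G -> ell2 R G * ell2 R G, (forall w, S w = adj m (f w).1 + adj b (f w).2)
     /\ forall w, nsq (f w).1 + nsq (f w).2 = nsq w) ->
  exists2 L : bop R G, (forall w, hnorm (L w) <= 1 * hnorm w) &
    forall w, l2cvg (fun n => (T * g n * S) w) (L w).
Proof.
move=> hT [f [hS hf]]; apply: strong_limit => [n w|w e e0].
  rewrite mul1r (hnorm_le_nsq _ (hnorm_ge0 _)) -nsqE -(hf w).
  have hbd := h_bound (f w).1 (f w).2 n; apply: le_trans hbd; rewrite -hS.
  apply: le_trans (hT _) _; rewrite -nsqN.
  have := @h_diff (S w) 0 n (leq0n _).
  have g0 : g 0 (S w) = 0 by rewrite gE big_ord0.
  have h0 : h (S w) 0 = 0 by rewrite hE big_ord0.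
  by rewrite g0 h0 !subr0.
have [M hM] := h_cauchy (f w).1 (f w).2 (exprn_gt0 2 e0); rewrite -hS in hM.
have wl k n : (M <= k)%N -> (k <= n)%N -> hnorm ((T * g n * S) w - (T * g k * S) w) <= e.
  move=> Mk kn; rewrite (hnorm_le_nsq _ (ltW e0)) !bop_mulE -bopB.
  apply: le_trans (hM k n Mk kn); apply: le_trans (h_diff (S w) kn).
  by rewrite nsqN; exact: hT.
exists M => k n Mk Mn; have [kn|/ltnW nk] := leqP k n; last exact: wl.
by rewrite hnormB; exact: wl.
Qed.


Let limit_m (T : bop R G) : (forall u, nsq (T u) <= rip (N u) u) ->
  exists2 L : bop R G, (forall w, hnorm (L w) <= 1 * hnorm w) &
    forall w, l2cvg (fun n => (T * g n * adj m) w) (L w).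
Proof.
move=> hT; apply: limit_exists => //; exists (fun w => (w, 0)); split=> w /=.
  by rewrite bop0 addr0.
by rewrite nsq0 addr0.
Qed.

Let limit_b (T : bop R G) : (forall u, nsq (T u) <= rip (N u) u) ->
  exists2 L : bop R G, (forall w, hnorm (L w) <= 1 * hnorm w) &
    forall w, l2cvg (fun n => (T * g n * adj b) w) (L w).
Proof.
move=> hT; apply: limit_exists => //; exists (fun w => (0, w)); split=> w /=.
  by rewrite bop0 add0r.
by rewrite nsq0 add0r.
Qed.

(* With [N = m^* m + b^* b] and [C = 1 - N], the matrix with entries [al = lim m g_n m^*],
   [be = lim m g_n b^*], [be'] and [ga] is the projection onto the closure of the range
   of [(m, b)], so that [1 - al] and [be] solve the equation. Its trace is at most 1 and
   [tr (al^k) - tr ((1 - ga)^k)] does not depend on [k]; as [ga] is injective, [tr (al^k)]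
   tends to 0 and [1 - al] is injective. *)
Lemma ore_small : injective_op b -> exists t s : bop R G,
  [/\ t \in @in_LG R G, s \in @in_LG R G, t * m = s * b & injective_op t].
Proof.
move=> ib.
have [al al1 hal] := limit_m hm; have [be _ hbe] := limit_b hm.
have [be' _ hbe'] := limit_m hb; have [ga ga1 hga] := limit_b hb.
have LGt (T S : bop R G) n : T \in @in_LG R G -> S \in @in_LG R G ->
    T * g n * adj S \in @in_LG R G.
  by move=> ? ?; rewrite !rpredM ?adj_in_LG.
have alLG : al \in @in_LG R G by apply: (limit_in_LG _ hal) => n; exact: LGt.
have beLG : be \in @in_LG R G by apply: (limit_in_LG _ hbe) => n; exact: LGt.
have be'LG : be' \in @in_LG R G by apply: (limit_in_LG _ hbe') => n; exact: LGt.
have gaLG : ga \in @in_LG R G by apply: (limit_in_LG _ hga) => n; exact: LGt.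
(* Before the limit the left side is [T * g n * N = T - T * C ^+ n], and [T * C ^+ n] tends strongly
   to 0 by [mC_cvg]. *)
have pX (T A B : bop R G) : (forall u, nsq (T u) <= rip (N u) u) ->
    (forall w, l2cvg (fun n => (T * g n * adj m) w) (A w)) ->
    (forall w, l2cvg (fun n => (T * g n * adj b) w) (B w)) ->
    A * m + B * b = T.
  move=> hT hA hB; apply: bop_ext => w.
  apply: l2cvg_unique (l2cvgD (hA (m w)) (hB (b w))) _.
  rewrite (_ : (fun n => _) = fun n => T w - T ((C ^+ n) w)); last first.
    apply/funext => n; rewrite !bop_mulE -!bopD -[adj m (m w) + _]/(N w) gN.
    by rewrite bopB.
  rewrite -[X in l2cvg _ X]subr0.
  apply: l2cvgD; first exact: l2cvg_cst.
  rewrite -[X in l2cvg _ X](scaleN1r 0).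
  rewrite (_ : (fun n => _) = fun n => (-1) *: T ((C ^+ n) w)); last first.
    by apply/funext => n; rewrite scaleN1r.
  by apply: l2cvgZ; exact: mC_cvg.
have eqm := pX _ _ _ hm hal hbe; have eqb := pX _ _ _ hb hbe' hga.
(* Multiplying a row [(A, B)] by a column of limits replaces [A * m + B * b] by [T]. The four cases
   say that the matrix is idempotent. *)
have idem (T A B D E F : bop R G) : A * m + B * b = T ->
    (forall w, l2cvg (fun n => (m * g n * D) w) (E w)) ->
    (forall w, l2cvg (fun n => (b * g n * D) w) (F w)) ->
    (forall w, l2cvg (fun n => (T * g n * D) w) ((A * E + B * F) w)).
  move=> <- hE' hF w; have := l2cvgD (l2cvg_bop A (hE' w)) (l2cvg_bop B (hF w)).
  rewrite (_ : (fun n => _) = fun n => ((A * m + B * b) * g n * D) w)//.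
have iuniq (u u' : nat -> bop R G) (A B : bop R G) : (forall n, u n = u' n) ->
    (forall w, l2cvg (fun n => u n w) (A w)) -> (forall w, l2cvg (fun n => u' n w) (B w)) ->
    A = B.
  move=> /funext <- hA hB; apply: bop_ext => w; exact: l2cvg_unique (hA w) (hB w).
have e11 : al * al + be * be' = al.
  by apply: iuniq (idem _ _ _ _ _ _ eqm hal hbe') hal.
have e12 : al * be + be * ga = be.
  by apply: iuniq (idem _ _ _ _ _ _ eqm hbe hga) hbe.
have e21 : be' * al + ga * be' = be'.
  by apply: iuniq (idem _ _ _ _ _ _ eqb hal hbe') hbe'.
have e22 : be' * be + ga * ga = ga.
  by apply: iuniq (idem _ _ _ _ _ _ eqb hbe hga) hga.
have adjl (T S A B : bop R G) : (forall w, l2cvg (fun n => (T * g n * adj S) w) (A w)) ->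
    (forall w, l2cvg (fun n => (S * g n * adj T) w) (B w)) -> adj A = B.
  move=> hA hB; apply/esym/adj_uniq => u v.
  apply: rcvg_unique (l2cvg_rip (hA u)) _.
  rewrite (_ : (fun n => _) = fun n => rip ((S * g n * adj T) v) u).
    by rewrite [rip u _]ripC; exact: l2cvg_rip.
  by apply/funext => n; rewrite adjP !adjM adjK adj_g [LHS]ripC mulrA.
have aal := adjl _ _ _ _ hal hal; have aga := adjl _ _ _ _ hga hga.
have abe := adjl _ _ _ _ hbe hbe'.
have abe' : adj be' = be by rewrite -abe adjK.
have pal : positive_contraction al.
  split=> // u; apply/andP; split.
    rewrite -{1}e11 bop_addE !bop_mulE ripDl -{1}aal adjPl -abe' adjPl.
    by rewrite addr_ge0// rip_ge0.
  apply: le_trans (ler_norm _) _; apply: le_trans (rip_le _ _) _.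
  by rewrite rip_nsq nsqE expr2 ler_wpM2r ?hnorm_ge0// -[leRHS]mul1r.
have rga u : rip (ga u) u = nsq (ga u) + nsq (be u).
  have r1 : rip (be' (be u)) u = nsq (be u) by rewrite -abe adjPl rip_nsq.
  have r2 : rip (ga (ga u)) u = nsq (ga u) by rewrite -{1}aga adjPl rip_nsq.
  by rewrite -{1}e22 bop_addE !bop_mulE ripDl r1 r2 addrC.
have pga : positive_contraction (1 - ga).
  split=> [|u]; first by rewrite adjB adj1 aga.
  rewrite bop_subE bop_oneE ripBl rga rip_nsq.
  have h1 : nsq (ga u) + nsq (be u) <= nsq u.
    rewrite -rga; apply: le_trans (ler_norm _) _; apply: le_trans (rip_le _ _) _.
    by rewrite nsqE expr2 ler_wpM2r ?hnorm_ge0// -[leRHS]mul1r.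
  have := nsq_ge0 (ga u); have := nsq_ge0 (be u).
  by move: h1; move: (nsq (ga u)) (nsq (be u)) (nsq u) => x y z; lra.
(* [al - al * al = be * be'], and [be] intertwines [al] with [1 - ga]; cyclicity then brings up
   [be' * be = ga * (1 - ga)]. *)
have step k : rtr (al ^+ k.+1) - rtr (al ^+ k.+2) =
    rtr ((1 - ga) ^+ k.+1) - rtr ((1 - ga) ^+ k.+2).
  have inter n : al ^+ n * be = be * (1 - ga) ^+ n.
    elim: n => [|n IHn]; first by rewrite !expr0 mul1r mulr1.
    rewrite exprS -mulrA IHn mulrA exprS [RHS]mulrA; congr (_ * _).
    by rewrite mulrBr mulr1 -{2}e12 addrK.
  have xLG n : (1 - ga) ^+ n \in @in_LG R G by rewrite rpredX ?rpredB ?rpred1.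
  have yLG n : al ^+ n \in @in_LG R G by rewrite rpredX.
  rewrite -!rtrB.
  have -> : al ^+ k.+1 - al ^+ k.+2 = (al ^+ k * be) * be'.
    have d : al - al * al = be * be' by rewrite -{1}e11 addrAC subrr add0r.
    by rewrite !exprSr -!mulrA -mulrBr d.
  have d : be' * be = ga * (1 - ga) by rewrite mulrBr mulr1 -{1}e22 addrK.
  rewrite inter rtrC ?rpredM// mulrA d.
  congr rtr; rewrite -mulrA -exprS [X in _ = _ - X]exprS mulrBl mul1r.
  by rewrite opprB addrCA subrr addr0.
(* [rtr al + rtr ga] is the limit of [rtr (N * g n) = 1 - rtr (C ^+ n)], which is at most 1. *)
have tr1 : rtr al <= rtr (1 - ga).
  rewrite rtrB rtr1 lerBrDr.
  have c1 : rtr (m * g n * adj m) + rtr (b * g n * adj b) @[n --> \oo] --> rtr al + rtr ga.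
    exact: cvgD (l2cvg_rip (hal _)) (l2cvg_rip (hga _)).
  apply: (closed_cvg _ (@closed_le R 1) _ _ c1) => //; exists 0%N => // n _ /=.
  rewrite rtrC ?rpredM ?adj_in_LG// [X in _ + X]rtrC ?rpredM ?adj_in_LG//.
  rewrite !mulrA -rtrD -mulrDl -/N.
  rewrite /rtr bop_mulE Ng ripBl -[X in X - _]/(rtr 1) rtr1.
  by rewrite gerBl; exact: pow_rip_ge0.
have trk k : rtr (al ^+ k.+1) <= rtr ((1 - ga) ^+ k.+1).
  elim: k => [|k]; first by rewrite !expr1.
  by have := step k; move: (rtr _) (rtr _) (rtr _) (rtr _) => x y z w; lra.
exists (1 - al), be; split=> //.
- by rewrite rpredB ?rpred1.
- by rewrite mulrBl mul1r -{1}eqm addrAC subrr add0r.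
move=> xi /eqP; rewrite bop_subE bop_oneE subr_eq0 eq_sym => /eqP.
apply: trace_pow_fix => //.
rewrite -cvg_shiftS.
apply: (@squeeze_cvgr _ _ _ _ (fun=> 0) (fun k => rtr ((1 - ga) ^+ k.+1))).
- by near=> k; rewrite trk pow_rip_ge0.
- exact: cvg_cst.
rewrite (cvg_shiftS (fun k => rtr ((1 - ga) ^+ k))); apply: trace_pow_cvg0 => // u /eqP.
rewrite bop_subE bop_oneE -subr_eq0 addrAC subrr add0r oppr_eq0 => /eqP gu.
have bu : be u = 0.
  apply: nsq_eq0; have := rga u; rewrite gu rip0l nsq0 add0r.
  by move=> ->.
(* The adjoint of [be' * m + ga * b = b] gives [adj b u = adj m (be u) + adj b (ga u) = 0]. *)
apply: (injective_adjoint bLG ib); rewrite -eqb adjD !adjM abe' aga.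
by rewrite bop_addE !bop_mulE gu bu !bop0 addr0.
Unshelve. all: by end_near. Qed.

End ore_construction.

(** * The universal derivation module *)

Lemma quotmod_scale_eq0 (A : pzRingType) (M : lmodType A) (N : zmodClosed M)
  (scaleN : GRing.scaler_closed N) (a : A) (u : quotmod scaleN) :
  a *: repr u \in N -> a *: u = 0.
Proof.
move=> h; change (quotmod_scale a u = 0); rewrite /quotmod_scale.
have p0 : \pi_(quotmod scaleN)%qT (0 : M) = 0.
  by apply: (addrI (\pi_(quotmod scaleN)%qT (0 : M))); rewrite pi_quotmodD !addr0.
by rewrite -[RHS]p0; apply/eqP; rewrite -Quotient.idealrBE subr0.
Qed.

Section derivation_module.
Variables (R : realType) (G : groupType).
Local Notation LG := (LG R G).
Implicit Types (g h x y z : G) (s t q m : LG) (c d : {freeg G / LG}).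
Local Open Scope complex_scope.

Local Notation U g := (<< g >> : {freeg G / LG}).
Local Notation lam g := (LG_lambda R g).

Lemma LG_valM s t : LG_val (s * t) = LG_val s * LG_val t. Proof. by []. Qed.
Lemma LG_valB s t : LG_val (s - t) = LG_val s - LG_val t. Proof. by []. Qed.
Lemma LG_val1 : LG_val (1 : LG) = 1. Proof. by []. Qed.
Lemma LG_valP t : LG_val t \in @in_LG R G. Proof. by case: t. Qed.

Lemma LG_lambda1 : lam (1%g : G) = 1.
Proof. by apply: val_inj; exact: lambda1. Qed.

Lemma LG_cancel t s : injective_op (LG_val t) -> t * s = 0 -> s = 0.
Proof.
move=> it ts0; apply/val_inj/bop_ext => xi; apply: it.
by rewrite -bop_mulE -LG_valM ts0.
Qed.

(** An injective element of LG has an injective adjoint, so a right factor can be cancelled after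
    passing to adjoints. *)
Lemma LG_cancelr t s : injective_op (LG_val t) -> s * t = 0 -> s = 0.
Proof.
move=> it st0; apply: val_inj; rewrite -[LHS]adjK -[RHS]adjK; congr adj.
rewrite adj0; apply: bop_ext => xi; apply: (injective_adjoint (LG_valP t) it).
by rewrite -bop_mulE -adjM -LG_valM st0 adj0.
Qed.

Lemma ore m b : injective_op (LG_val b) ->
  exists t s, t * m = s * b /\ injective_op (LG_val t).
Proof.
(* A common factor [c] brings [m] and [b] under the bound [small] and cancels from the resulting
   equation. *)
move=> ib; have [c c0 hc] := small_scale (onorm (LG_val m) ^+ 2 + onorm (LG_val b) ^+ 2).
have sc (T : bop R G) xi : nsq ((c%:C *: T) xi) <= c ^+ 2 * onorm T ^+ 2 * nsq xi.
  rewrite bop_scaleE nsq_scaleR -mulrA ler_pM2l ?exprn_gt0// !nsqE -exprMn.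
  by rewrite ler_pXn2r ?nnegrE ?mulr_ge0 ?hnorm_ge0 ?onorm_ge0// onormP.
have small xi : nsq ((c%:C *: LG_val m) xi) + nsq ((c%:C *: LG_val b) xi) <= nsq xi.
  apply: le_trans (lerD (sc _ _) (sc _ _)) _.
  by rewrite -mulrDl -mulrDr ler_piMl ?nsq_ge0.
have [t [s [tLG sLG ts it]]] := ore_small (scale_in_LG c%:C (LG_valP m))
  (scale_in_LG c%:C (LG_valP b)) small (injective_scale c0 ib).
exists (MkLG tLG), (MkLG sLG); split=> //; apply: val_inj => /=.
apply: bop_ext => xi; have := congr1 (fun V : bop R G => V xi) ts.
rewrite !bop_mulE !bop_scaleE !bopZ => /(congr1 (fun v => c^-1%:C *: v)).
by rewrite !scalerA -rmorphM/= mulVf ?gt_eqF// !scale1r.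
Qed.

(** The relations of the derivation module: [d_2] of a basis element [g|h] is [g [h] - [gh] + [g]].
    Chains modulo [boundary] are its elements, and the cycles among them form [H1]. *)
Definition boundary c := exists e, bar_d2 e = c.

Lemma boundary0 : boundary 0. Proof. by exists 0; rewrite linear0. Qed.

Lemma boundaryD c d : boundary c -> boundary d -> boundary (c + d).
Proof. by move=> [e <-] [f <-]; exists (e + f); rewrite linearD. Qed.

Lemma boundaryZ t c : boundary c -> boundary (t *: c).
Proof. by move=> [e <-]; exists (t *: e); rewrite linearZ. Qed.

Lemma boundaryN c : boundary c -> boundary (- c).
Proof. by move=> [e <-]; exists (- e); rewrite linearN. Qed.

Lemma freegUZ t x : t *: U x = << t *g x >>.
Proof. by apply/eqP/freeg_eqP => y; rewrite coeffZ !coeffU mul1r. Qed.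

Lemma boundaryM g h : boundary (U (g * h)%g - (U g + lam g *: U h)).
Proof.
exists (- << (g, h) >>); rewrite linearN/= bar_d2U mul1r -freegUZ.
by rewrite addrAC opprB [lam g *: _ + _]addrC.
Qed.

Lemma boundary1 : boundary (U (1%g : G)).
Proof.
have := boundaryM 1 1; rewrite LG_lambda1 scale1r mulg1 opprD addrA subrr sub0r.
by move/boundaryN; rewrite opprK.
Qed.

Lemma bar_d1_boundary c : boundary c -> bar_d1 c = 0.
Proof. by move=> [e <-]; exact: bar_d1d2. Qed.

(* [c] becomes a multiple of the class of [x] over the ring of fractions of LG. *)
Definition depends x c := exists t q,
  injective_op (LG_val t) /\ boundary (t *: c - q *: U x).

Lemma injective1 : injective_op (LG_val (1 : LG)). Proof. by []. Qed.

Lemma depends_boundary x c : boundary c -> depends x c.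
Proof. by move=> hc; exists 1, 0; split; [exact: injective1|rewrite scale1r scale0r subr0]. Qed.

Lemma depends_self x : depends x (U x).
Proof. by exists 1, 1; rewrite subrr; split; [exact: injective1|exact: boundary0]. Qed.

(** The Ore condition supplies the common denominator [t * t1 = s * t2]. *)
Lemma dependsD x c d : depends x c -> depends x d -> depends x (c + d).
Proof.
move=> [t1 [q1 [i1 b1]]] [t2 [q2 [i2 b2]]].
have [t [s [ts it]]] := ore t1 i2.
exists (t * t1), (t * q1 + s * q2); split; first exact: injective_mul.
rewrite (_ : _ - _ = t *: (t1 *: c - q1 *: U x) + s *: (t2 *: d - q2 *: U x)).
  by apply: boundaryD; exact: boundaryZ.
by rewrite !scalerBr !scalerA -ts scalerDr scalerDl opprD addrACA.
Qed.

Lemma dependsZ x t c : depends x c -> depends x (t *: c).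
Proof.
move=> [t1 [q1 [i1 b1]]]; have [r [s [rs ir]]] := ore t i1.
exists r, (s * q1); split=> //.
by rewrite scalerA rs -!scalerA -scalerBr; exact: boundaryZ.
Qed.

Lemma depends_trans x z c : depends x (U z) -> depends z c -> depends x c.
Proof.
move=> [t1 [q1 [i1 b1]]] [t2 [q2 [i2 b2]]]; have [r [s [rs ir]]] := ore q2 i1.
exists (r * t2), (s * q1); split; first exact: injective_mul.
rewrite (_ : _ - _ = r *: (t2 *: c - q2 *: U z) + s *: (t1 *: U z - q1 *: U x)).
  by apply: boundaryD; exact: boundaryZ.
by rewrite !scalerBr !scalerA -rs addrA subrK.
Qed.

Lemma depends_congr x c d : boundary (c - d) -> depends x d -> depends x c.
Proof.
by move=> h hd; rewrite -(subrK d c); apply: dependsD => //; exact: depends_boundary.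
Qed.

Lemma dependsM x g h : depends x (U g) -> depends x (U h) -> depends x (U (g * h)%g).
Proof.
move=> hg hh; apply: depends_congr (boundaryM g h) _.
by apply: dependsD => //; exact: dependsZ.
Qed.

Lemma depends1 x : depends x (U (1%g : G)).
Proof. exact/depends_boundary/boundary1. Qed.

Lemma boundaryV g : boundary (U (g^-1)%g - - (lam (g^-1)%g *: U g)).
Proof.
have := boundaryM (g^-1)%g g; rewrite mulVg => /boundaryN/(boundaryD boundary1).
by rewrite opprB addrCA subrr addr0 opprK.
Qed.

Lemma dependsV x g : depends x (U g) -> depends x (U (g^-1)%g).
Proof.
move=> hg; apply: depends_congr (boundaryV g) _.
by rewrite -scaleNr; exact: dependsZ.
Qed.

Lemma depends_all x : (forall y, depends x (U y)) -> forall c, depends x c.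
Proof.
move=> h c; rewrite -[c]freeg_sumE; elim/big_rec: _ => [|y d _ hd].
  exact/depends_boundary/boundary0.
by apply: dependsD => //; rewrite -freegUZ; exact: dependsZ.
Qed.

Lemma bar_d1Z t x : bar_d1 (t *: U x) = t * (lam x - 1).
Proof. by rewrite freegUZ bar_d1U mulrBr mulr1. Qed.

Hypothesis regular : forall x, x != 1%g -> injective_op (LG_val (lam x - 1)).

(** Applying [d_1] to [t [z] = q [x]] gives [t (z - 1) = q (x - 1)]. The left side is injective,
    hence so is [q], which can serve as the new denominator. *)
Lemma depends_sym x z : z != 1%g -> depends x (U z) -> depends z (U x).
Proof.
move=> z1 [t [q [it b]]]; exists q, t; split; last by rewrite -opprB; exact: boundaryN.
have := bar_d1_boundary b; rewrite linearB/= !bar_d1Z => /eqP; rewrite subr_eq0 => /eqP e.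
apply: (injective_mulr (LG_valP q) (LG_valP (lam x - 1))).
by rewrite -LG_valM -e LG_valM; exact: (injective_mul it (regular z1)).
Qed.

(** Applying [d_1] to [t c = q [x]] gives [q (x - 1) = 0], hence [q = 0]. *)
Lemma depends_cycle x c : x != 1%g -> depends x c -> bar_d1 c = 0 ->
  exists2 t, injective_op (LG_val t) & boundary (t *: c).
Proof.
move=> x1 [t [q [it b]]] c0; exists t => //.
have := bar_d1_boundary b; rewrite linearB/= bar_d1Z linearZ/= c0 scaler0 sub0r.
move=> /eqP; rewrite oppr_eq0 => /eqP/(LG_cancelr (regular x1)) q0.
by move: b; rewrite q0 scale0r subr0.
Qed.

Lemma rank_one_betti x : x != 1%g -> (forall y, depends x (U y)) -> l2betti1 R G = 0%E.
Proof.
move=> x1 hx.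
have fg0 (P : set (H1 R G)) (r : R) : fg_projective_dim P r -> r = 0.
  move=> [n [A [f [AA fi _ ->]]]].
  suff A0 : A = 0.
    rewrite big1 ?A0//= => i _; rewrite mxE /LG_trace inner_rip.
    by rewrite [LG_val 0 _](_ : _ = 0)// !rip0l.
  apply/matrixP => i j; rewrite [RHS]mxE.
  (* A unit row vector, so that [v *m A] is row [i] of [A]. Its image in [H1] is killed by an
     injective [t]; since [f] is injective on the image of [A], the row itself is killed by [t]. *)
  pose v : 'rV[LG]_n := \row_k (k == i)%:R.
  have vA : (v *m A) 0 j = A i j.
    rewrite mxE (bigD1 i)//= mxE eqxx mul1r big1 ?addr0// => k /negPf ki.
    by rewrite mxE ki mul0r.
  pose c := repr (f (v *m A)).
  have [t it bt] : exists2 t, injective_op (LG_val t) & boundary (t *: cycle_val c).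
    apply: (depends_cycle x1); first exact: depends_all.
    by case: (c) => c' /= /eqP.
  have z0 : t *: f (v *m A) = 0.
    by apply: quotmod_scale_eq0; rewrite inE.
  have tvA : (t *: v) *m A = 0.
    by apply: fi; rewrite -scalemxAl linearZ.
  apply: (LG_cancel it); rewrite -vA.
  by move: tvA; rewrite -scalemxAl => /(congr1 (fun M : 'rV[LG]_n => M 0 j)); rewrite !mxE.
rewrite /l2betti1 /luck_dim (_ : [set _ | _ in _] = [set 0%E]) ?ereal_sup1//.
apply/seteqP; split=> [_ [r [P /fg0 ->] <-]//|_ ->].
(* The zero module, presented by a matrix of size 0. It keeps the set of dimensions from being
   empty, where the supremum would be [-oo]. *)
exists 0 => //; exists (range (fun v : 'rV[LG]_0 => (0 : H1 R G))).
exists 0%N, 0, (\0 : {linear 'rV[LG]_0 -> H1 R G}); split; rewrite ?mul0mx//.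
- by move=> v _; rewrite mulmx0.
- by rewrite big_ord0.
Qed.

Hypothesis torsion_free : torsionfree G.

(** Pigeonhole on [u * x0 ^+ n], where [u] does not depend on [x0]. If two of these depend on the
    same [x] in [F], then so does their quotient, a power [z <> 1] of [x0]; through [z] dependence
    on [x] becomes dependence on [x0], and [u] would depend on [x0]. *)
Lemma exists_independent (F : seq G) : l2betti1 R G <> 0%E ->
  (forall x, x \in F -> x != 1%g) ->
  exists y, forall x, x \in F -> ~ depends x (U y).
Proof.
move=> betti F1; have [->|[x0 x0F]] : F = [::] \/ exists x, x \in F.
  by case: F F1 => [|x F] _; [left|right; exists x; rewrite inE eqxx].
  by exists 1%g.
have x01 := F1 _ x0F.
have [u hu] : exists u, ~ depends x0 (U u).
  apply/not_existsP => h; apply: betti; apply: (rank_one_betti x01) => y.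
  by apply: contrapT; exact: h.
apply/not_existsP => h.
have /choice[k hk] : forall n : nat, exists x, x \in F /\ depends x (U (u * x0 ^+ n)%g).
  move=> n; have /existsNP[x] := h (u * x0 ^+ n)%g.
  by move=> /not_implyP[xF /contrapT hx]; exists x.
have key (m n : nat) : (m < n)%N -> k m <> k n.
  move=> mn kmn; have [kF hm] := hk m; have [_ hn] := hk n; rewrite -kmn in hn.
  pose z := (x0 ^+ (n - m))%g.
  have z1 : z != 1%g.
    apply/eqP => z0; move/eqP: x01; apply; apply: torsion_free z0.
    by rewrite subn_gt0.
  have xz : depends x0 (U z).
    rewrite /z; elim: (n - m)%N => [|j IHj]; first by rewrite expg0; exact: depends1.
    by rewrite expgS; apply: dependsM => //; exact: depends_self.
  have kz : depends (k m) (U z).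
    rewrite (_ : z = (u * x0 ^+ m)^-1 * (u * x0 ^+ n))%g.
      by apply: dependsM => //; exact: dependsV.
    by rewrite invgM mulgA mulgVK -{1}(subnKC (ltnW mn)) expgnDr mulKg.
  have xu : depends x0 (U (u * x0 ^+ m)%g).
    by apply: depends_trans xz _; apply: depends_trans hm; exact: depends_sym.
  apply: hu; rewrite -(mulgK (x0 ^+ m) u)%g; apply: dependsM => //.
  apply: dependsV; elim: (m) => [|j IHj]; first by rewrite expg0; exact: depends1.
  by rewrite expgS; apply: dependsM => //; exact: depends_self.
(* An injective self-map of [size F + 1] indices that misses the last one: every [k i] lies in [F],
   so its index is below [size F] and [inord] does not change it. *)
pose f (i : 'I_(size F).+1) := inord (index (k i) F) : 'I_(size F).+1.
have fi : injective f.
  move=> i j /(congr1 val) /=; rewrite !inordK ?ltnS ?index_size// => e.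
  have kij : k i = k j.
    by rewrite -(nth_index 1%g (proj1 (hk i))) e nth_index//; exact: (proj1 (hk j)).
  by apply: val_inj => /=; case: (ltngtP i j) => // /key; rewrite kij.
have := leqnn (size F); apply/negP; rewrite -ltnNge.
have [i fi0] : exists i, f i = ord_max by exists (invF fi ord_max); rewrite f_invF.
have : (f i < size F)%N by rewrite /f inordK ?ltnS ?index_size// index_mem; exact: (proj1 (hk i)).
by rewrite fi0 /= ltnn.
Qed.

End derivation_module.

(** * Free products from independence *)

Section group_ring_action.
Variables (R : realType) (G : groupType).
Implicit Types a b : {freeg G / int}.

Lemma zactE a (s : seq G) : uniq s -> {subset dom a <= s} ->
  zgroup_ring_act R a = \sum_(g <- s) lambda R g *~ coeff g a.
Proof.
move=> us sub; rewrite [RHS](bigID (mem (dom a)))/= [X in _ + X]big1 ?addr0; last first.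
  by move=> g gd; rewrite coeff_outdom// mulr0z.
rewrite -big_filter; apply: perm_big; apply: uniq_perm; rewrite ?uniq_dom ?filter_uniq//.
by move=> g; rewrite mem_filter andb_idr// => /sub.
Qed.

Lemma zactD a b : zgroup_ring_act R (a + b) = zgroup_ring_act R a + zgroup_ring_act R b.
Proof.
pose s := undup (dom a ++ dom b ++ dom (a + b)).
have us : uniq s by exact: undup_uniq.
rewrite (@zactE a s)// ?(@zactE b s)// ?(@zactE (a + b) s)//.
- by rewrite -big_split; apply: eq_bigr => g _; rewrite coeffD mulrzDr.
- by move=> g h; rewrite mem_undup !mem_cat h !orbT.
- by move=> g h; rewrite mem_undup !mem_cat h !orbT.
- by move=> g h; rewrite mem_undup !mem_cat h.
Qed.

Lemma zact0 : zgroup_ring_act R (0 : {freeg G / int}) = 0.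
Proof. by rewrite /zgroup_ring_act dom0 big_nil. Qed.

Lemma zactN a : zgroup_ring_act R (- a) = - zgroup_ring_act R a.
Proof. by apply/eqP; rewrite -addr_eq0 -zactD addNr zact0. Qed.

Lemma zactB a b : zgroup_ring_act R (a - b) = zgroup_ring_act R a - zgroup_ring_act R b.
Proof. by rewrite zactD zactN. Qed.

Lemma zactU (g : G) : zgroup_ring_act R (<< g >> : {freeg G / int}) = lambda R g.
Proof. by rewrite /zgroup_ring_act domU1 big_seq1 coeffU eqxx mulr1 mulr1z. Qed.

End group_ring_action.

Section free_product.
Variables (R : realType) (G : groupType).
Local Notation LG := (LG R G).
Implicit Types (g h x y z : G) (w s : seq G).
Local Open Scope complex_scope.
Local Notation U g := (<< g >> : {freeg G / LG}).
Local Notation lam g := (LG_lambda R g).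

Hypothesis zg_injective : forall a : {freeg G / int}, a != 0 ->
  injective_op (zgroup_ring_act R a).

Lemma regular_elt x : x != 1%g -> injective_op (LG_val (lam x - 1)).
Proof.
move=> x1; rewrite LG_valB LG_val1 -(@lambda1 R G).
rewrite -[LG_val (lam x)]/(lambda R x) -!zactU -zactB; apply: zg_injective.
apply/eqP => /(congr1 (coeff x)); rewrite coeffB !coeffU coeff0 eqxx eq_sym (negPf x1).
by rewrite mulr0 subr0 mulr1.
Qed.

Definition homologous (c d : {freeg G / LG}) := boundary (c - d).

Lemma homologous_refl c : homologous c c.
Proof. by rewrite /homologous subrr; exact: boundary0. Qed.

Lemma homologous_sym c d : homologous c d -> homologous d c.
Proof. by move/boundaryN; rewrite opprB. Qed.

Lemma homologous_trans d c e : homologous c d -> homologous d e -> homologous c e.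
Proof. by move=> h1 /(boundaryD h1); rewrite addrA subrK. Qed.

Lemma homologousD c d c' d' :
  homologous c d -> homologous c' d' -> homologous (c + c') (d + d').
Proof. by move=> h1 /(boundaryD h1); rewrite addrACA -opprD. Qed.

Lemma homologousZ (t : LG) c d : homologous c d -> homologous (t *: c) (t *: d).
Proof. by move=> /(boundaryZ t); rewrite scalerBr. Qed.

Lemma homologousM g h : homologous (U (g * h)%g) (U g + lam g *: U h).
Proof. exact: boundaryM. Qed.

(** Unlike [depends], this allows no denominator on the left, so coefficients along a path of such
    letters stay in LG. The elements form a subgroup containing the powers of [x]. *)
Definition span x g := exists q : LG, homologous (U g) (q *: U x).

Lemma span_self x : span x x.
Proof. by exists 1; rewrite scale1r; exact: homologous_refl. Qed.

Lemma span1 x : span x 1%g.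
Proof. by exists 0; rewrite /homologous scale0r subr0; exact: boundary1. Qed.

Lemma spanM x g h : span x g -> span x h -> span x (g * h)%g.
Proof.
move=> [q hq] [r hr]; exists (q + lam g * r); rewrite scalerDl -scalerA.
apply: homologous_trans (homologousM g h) _.
by apply: homologousD => //; exact: homologousZ.
Qed.

Lemma spanV x g : span x g -> span x (g^-1)%g.
Proof.
move=> [q hq]; exists (- (lam (g^-1)%g * q)).
apply: homologous_trans (boundaryV R g : homologous _ _) _.
by rewrite -scaleNr -mulNr -scalerA; exact: homologousZ.
Qed.

Lemma spanX x g n : span x g -> span x (g ^+ n)%g.
Proof.
by move=> hg; elim: n => [|n IHn]; rewrite ?expg0 ?expgS; [exact: span1|exact: spanM].
Qed.

Lemma span_d1 x g (q : LG) : homologous (U g) (q *: U x) -> lam g - 1 = q * (lam x - 1).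
Proof.
move/bar_d1_boundary; rewrite linearB/= bar_d1Z -{1}[U g]scale1r bar_d1Z mul1r.
by move/eqP; rewrite subr_eq0 => /eqP.
Qed.

Variables x y : G.
Hypothesis indep : ~ depends x (U y).

Definition letter (b : bool) g := (g <> 1%g) /\ span (if b then x else y) g.

Fixpoint alternating (b : bool) w : Prop :=
  if w is a :: w' then letter b a /\ alternating (~~ b) w' else True.

Definition value w : G := foldr (fun a g => a * g)%g 1%g w.

Lemma value_cat w s : value (w ++ s) = (value w * value s)%g.
Proof. by elim: w => [|a w /= ->]; rewrite /= ?mul1g ?mulgA. Qed.

Lemma alternating_cat b w s :
  alternating b (w ++ s) <-> alternating b w /\ alternating (b (+) odd (size w)) s.
Proof.
elim: w b => [|a w IHw] b /=; first by rewrite addbF; tauto.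
by rewrite IHw addNb addbN; tauto.
Qed.

(* The part [\sum (g_(i+1) - g_i)], over the steps by a letter from the span of
   [y], of the path [g = g_0, g_1, ...] whose steps are the letters of a word. *)
Fixpoint ysteps (b : bool) g w : {freeg G / int} :=
  if w is a :: w' then
    (if b then 0 else << (g * a)%g >> - << g >>) + ysteps (~~ b) (g * a)%g w'
  else 0.

(** Fox calculus. A step by a letter [a] with [[a] = r [y]] adds [g r] to the coefficient [q], and
    [g r (y - 1) = g a - g]. Thus [q (y - 1)] lies in Z[G] although [q] need not. *)
Lemma path_homologous b g w : alternating b w -> exists p q : LG,
  homologous (U (g * value w)%g) (U g + (p *: U x + q *: U y)) /\
  LG_val (q * (lam y - 1)) = zgroup_ring_act R (ysteps b g w).
Proof.
elim: w b g => [|a w IHw] b g; rewrite [alternating _ _]/= [ysteps _ _ _]/=.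
  move=> _; exists 0, 0; rewrite [value _]/= mulg1 !scale0r !addr0 mul0r zact0.
  by split=> //; exact: homologous_refl.
move=> [[_ [r hr]] /(IHw _ (g * a)%g)[p [q [hpq eq]]]].
rewrite [value _]/= -/(value w).
have h1 : homologous (U (g * a)%g) (U g + (lam g * r) *: U (if b then x else y)).
  apply: homologous_trans (homologousM g a) _; rewrite -scalerA.
  by apply: homologousD; [exact: homologous_refl|exact: homologousZ].
have h2 := homologous_trans hpq (homologousD h1 (homologous_refl _)).
rewrite mulgA in h2 *.
case: b {h1 IHw} hr h2 eq hpq => hr h2 eq _.
  exists (lam g * r + p), q; split; last by rewrite eq add0r.
  by move: h2; rewrite -addrA scalerDl !addrA.
exists p, (lam g * r + q); split.
  by move: h2; rewrite -addrA scalerDl [_ *: U y + (_ + _)]addrCA.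
rewrite zactD -eq mulrDl -mulrA -(span_d1 hr) mulrBr mulr1 -LG_lambdaM.
by rewrite zactB !zactU.
Qed.

(** The interior vertices of the path avoid 1, so only its two ends can contribute, each when the
    adjacent step belongs to the span of [y]. *)
Lemma coeff_ysteps b g w : w != [::] ->
  (forall i, (0 < i < size w)%N -> (g * value (take i w))%g != 1%g) ->
  coeff 1%g (ysteps b g w) =
    (~~ (b (+) odd (size w).-1) && ((g * value w)%g == 1%g))%:R - (~~ b && (g == 1%g))%:R.
Proof.
elim: w b g => // a [|a' w] IHw b g _ hw.
  by rewrite /= addr0 addbF /value/= mulg1; case: b;
    rewrite ?coeff0 ?subrr// coeffB !coeffU !mul1r.
have ga1 : (g * a)%g != 1%g.
  by have := hw 1%N isT; rewrite /value/= mulg1.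
rewrite [ysteps _ _ _]/= -/(ysteps (~~ b) _ (a' :: w)) coeffD IHw//; last first.
  move=> i /andP[i0 iw]; have := hw i.+1; rewrite /= ltnS iw => /(_ isT).
  by rewrite /value /= mulgA.
rewrite (negPf ga1) andbF subr0 /= -mulgA.
have -> : ~~ b (+) odd (size w) = b (+) ~~ odd (size w) by case: b; case: (odd _).
rewrite addrC; congr (_ + _); case: b; rewrite ?coeff0 ?oppr0//.
by rewrite coeffB !coeffU !mul1r (negPf ga1) sub0r.
Qed.

Lemma no_relation b w : alternating b w -> value w = 1%g -> w = [::].
Proof.
have [n] := ubnP (size w); elim: n b w => // n IHn b w; rewrite ltnS => wn aw vw.
have [->//|w0] := eqVneq w [::]; exfalso.
(* In odd length the first and the last letter come from the same span. Conjugation moves the last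
   one to the front, where it cancels or merges with the first and shortens the word. *)
have [ow|ew] := boolP (odd (size w)).
  case: w w0 wn aw vw ow => // a w _ wn /= [la aw].
  case/lastP: w wn aw => [|w c]; first by rewrite /value/= mulg1; case: la.
  rewrite size_rcons -cats1 /= => wn /alternating_cat[aw [lc _]].
  rewrite /value/= -/(value _) value_cat /value/= mulg1 -/(value w) negbK => vw ow.
  rewrite size_cat addn1 in wn.
  rewrite ow addbT negbK in lc.
  have cav : (c * a * value w = 1)%g.
    rewrite (_ : c * a * value w = c * (a * (value w * c)) * c^-1)%g; last first.
      by rewrite !mulgA mulgK.
    by rewrite vw mulg1 mulgV.
  have [ca1|/eqP ca1] := eqVneq (c * a)%g 1%g.
    move: cav; rewrite ca1 mul1g => /(IHn _ _ (ltnW wn) aw) w0.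
    by move: ow; rewrite w0.
  suff : (c * a)%g :: w = [::] by [].
  apply: (IHn b); [exact: wn| |exact: cav].
  by split=> //; split=> //; apply: spanM; [case: lc|case: la].
(* In even length exactly one of the two end letters comes from the span of [y]. No proper non-empty
   prefix has value 1, so the coefficient of [ysteps] at 1 is 1 or -1; hence [q] is injective, and
   [q [y] = - p [x]]. *)
have [p [q [hpq eq]]] := path_homologous 1%g aw.
rewrite mul1g vw in hpq.
have th0 : ysteps b 1%g w != 0.
  apply/eqP => /(congr1 (coeff 1%g)); rewrite coeff0 coeff_ysteps//.
    rewrite mul1g vw eqxx !andbT.
    have -> : odd (size w).-1 by case: (w) w0 ew => //= ? ?; rewrite negbK.
    by case: b {aw hpq eq} => /eqP.
  move=> i /andP[i0 iw]; rewrite mul1g; apply/eqP => vi.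
  have ti : alternating b (take i w).
    by have := aw; rewrite -{1}(cat_take_drop i w) => /alternating_cat[].
  have := IHn b (take i w) _ ti vi; rewrite size_take iw => /(_ (leq_trans iw wn)).
  by move/(congr1 size); rewrite size_take iw /= => i00; rewrite i00 in i0.
apply: indep; exists q, (- p); split.
  apply: (injective_mulr (LG_valP q) (LG_valP (lam y - 1))).
  by rewrite -LG_valM eq; exact: zg_injective.
move/homologous_sym: hpq; rewrite /homologous addrC addKr.
by rewrite scaleNr opprK addrC.
Qed.

End free_product.

(** * Averages over conjugates *)

Section orthogonal_sums.
Variables (R : realType) (G : choiceType).
Implicit Types xi : ell2 R G.

Lemma nsq_sum_orthogonal (n : nat) (F : 'I_n -> ell2 R G) :
  (forall i j, i != j -> rip (F i) (F j) = 0) ->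
  nsq (\sum_(i < n) F i) = \sum_(i < n) nsq (F i).
Proof.
move=> h; rewrite -rip_nsq rip_suml; apply: eq_bigr => i _.
by rewrite rip_sumr (bigD1 i)//= big1 ?addr0 ?rip_nsq// => j ji; rewrite h// eq_sym.
Qed.

Lemma nsq_sum_le (n : nat) (F : 'I_n -> ell2 R G) :
  nsq (\sum_(i < n) F i) <= n%:R * \sum_(i < n) nsq (F i).
Proof.
rewrite -rip_nsq rip_suml.
apply: (@le_trans _ _ (\sum_(i < n) \sum_(j < n) ((nsq (F i) + nsq (F j)) / 2))).
  apply: ler_sum => i _; rewrite rip_sumr; apply: ler_sum => j _.
  have := nsq_ge0 (F i - F j); rewrite nsqB.
  by move: (nsq (F i)) (nsq (F j)) (rip (F i) (F j)) => a b c; lra.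
set S := \sum_(i < n) nsq (F i).
rewrite (eq_bigr (fun i => (n%:R * nsq (F i) + S) / 2)); last first.
  by move=> i _; rewrite -mulr_suml big_split/= sumr_const card_ord mulr_natl.
rewrite -mulr_suml big_split/= -mulr_sumr sumr_const card_ord -/S -mulr_natl.
by move: (n%:R * S) => c; lra.
Qed.

Lemma rip_cut (P : pred G) xi : rip xi (cut P xi) = nsq (cut P xi).
Proof.
rewrite -{1}(subrK (cut P xi) xi) ripDl rip_nsq rip_disjoint ?add0r// => z.
by rewrite ell2BE cutE; case: ifP => _; [left; rewrite subrr|right].
Qed.

Lemma nsq_sub_cut_le (P : pred G) xi : nsq (xi - cut P xi) <= nsq xi.
Proof.
rewrite nsqB rip_cut; have := nsq_ge0 (cut P xi).
by move: (nsq (cut P xi)) (nsq xi) => a b; lra.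
Qed.

Lemma bessel_cut (n : nat) (P : 'I_n -> pred G) xi :
  (forall i j z, i != j -> P i z -> P j z -> False) ->
  \sum_(i < n) nsq (cut (P i) xi) <= nsq xi.
Proof.
move=> dis.
have orth i j : i != j -> rip (cut (P i) xi) (cut (P j) xi) = 0.
  move=> ij; apply: rip_disjoint => z; rewrite !cutE.
  by case: ifP => [zi|_]; [right|left]; rewrite // ifF//; apply/negP => zj; exact: dis ij zi zj.
have := nsq_ge0 (xi - \sum_(i < n) cut (P i) xi).
rewrite nsqB nsq_sum_orthogonal// rip_sumr (eq_bigr (fun i => nsq (cut (P i) xi))); last first.
  by move=> i _; exact: rip_cut.
by move: (\sum_(_ < _) _) (nsq xi) => a b; lra.
Qed.

End orthogonal_sums.

Section powers_averages.
Variables (R : realType) (G : groupType).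
Local Notation LG := (LG R G).
Implicit Types (g h z : G) (w s : seq G) (xi : ell2 R G).
Local Open Scope complex_scope.
Local Notation U g := (<< g >> : {freeg G / LG}).

Hypothesis zg_injective : forall a : {freeg G / int}, a != 0 ->
  injective_op (zgroup_ring_act R a).
Hypothesis torsion_free : torsionfree G.

Lemma torsion_freeX (y : G) (n : nat) : y != 1%g -> (0 < n)%N -> (y ^+ n)%g <> 1%g.
Proof. by move=> y1 n0 yn; move/eqP: y1; apply; exact: torsion_free n0 yn. Qed.

(** * Ping-pong on the cosets of the subgroup generated by two spans *)

Section ping_pong.
Variables x y : G.
Hypotheses (x1 : x != 1%g) (y1 : y != 1%g).
Hypothesis indep : ~ depends x (U y).
Local Notation alt := (alternating R x y).

Lemma letterV b g : letter R x y b g -> letter R x y b (g^-1)%g.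
Proof.
move=> [g1 sg]; split; last exact: spanV.
by move/(congr1 (fun z => z^-1)%g); rewrite invgK invg1.
Qed.

Lemma alternating_rev b w : alt b w ->
  alt (~~ b (+) odd (size w)) (rev [seq (g^-1)%g | g <- w]).
Proof.
elim: w b => [|a w IHw] b //= [la aw].
rewrite rev_cons -cats1; apply/alternating_cat; split.
  by have := IHw _ aw; rewrite negbK addNb addbN negbK.
rewrite size_rev size_map.
have -> : ~~ b (+) ~~ odd (size w) (+) odd (size w) = b by case: b {la aw}; case: odd.
by split=> //; exact: letterV.
Qed.

Lemma value_rev w : value (rev [seq (g^-1)%g | g <- w]) = ((value w)^-1)%g.
Proof.
elim: w => [|a w IHw]; first by rewrite /value/= invg1.
by rewrite /= rev_cons -cats1 value_cat IHw [value [:: _]]/= mulg1 -invgM.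
Qed.

Definition generated g := exists b w, alt b w /\ value w = g.

Lemma generatedMl b a g : letter R x y b a -> generated g -> generated (a * g)%g.
Proof.
move=> la [c [w [aw <-]]]; case: w aw => [|d w] aw.
  by exists b, [:: a].
have [cb|cb] := eqVneq c b; last first.
  exists b, (a :: d :: w); split=> //; split=> //.
  by move: aw; rewrite (_ : c = ~~ b)//; case: c b cb {la} => -[].
rewrite {}cb in aw; case: aw => ld aw.
have [ad1|/eqP ad1] := eqVneq (a * d)%g 1%g.
  by exists (~~ b), w; split=> //; rewrite /= mulgA ad1 mul1g.
exists b, ((a * d)%g :: w); split; last by rewrite /= mulgA.
by split=> //; split=> //; apply: spanM; [case: la|case: ld].
Qed.

Lemma generatedM g h : generated g -> generated h -> generated (g * h)%g.
Proof.
move=> [b [w [aw <-]]] gh; elim: w b aw => [|a w IHw] b; first by rewrite mul1g.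
by move=> [la aw]; rewrite /= -mulgA; apply: (generatedMl la); exact: IHw aw.
Qed.

Lemma generatedV g : generated g -> generated (g^-1)%g.
Proof.
by move=> [b [w [aw <-]]]; exists (~~ b (+) odd (size w)), (rev [seq (g^-1)%g | g <- w]);
  split; [exact: alternating_rev|exact: value_rev].
Qed.

(** The set depends only on the coset of [g], so [xget] makes the same choice on all of it. The
    default is never taken, as [g] itself belongs to the set. *)
Definition coset_rep g := xget 1%g [set h | generated (g * h^-1)%g].

Lemma coset_repP g : generated (g * (coset_rep g)^-1)%g.
Proof.
rewrite /coset_rep; case: xgetP => [h _ //|/(_ g)]; case.
by rewrite /= mulgV; exists true, [::].
Qed.

Lemma coset_repM g h : generated g -> coset_rep (g * h)%g = coset_rep h.
Proof.
move=> gg; rewrite /coset_rep; congr xget; apply/seteqP; split=> z /= hz.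
  by rewrite -(mulKg g h) -mulgA; apply: generatedM => //; exact: generatedV.
by rewrite -mulgA; exact: generatedM.
Qed.

(* The elements whose component in the coset of the subgroup generated by the
   spans of [x] and [y] begins with a letter from the span of [x]. *)
Definition starts_left g := exists w,
  [/\ w <> [::], alt true w & value w = (g * (coset_rep g)^-1)%g].

Lemma letter_yX n : (0 < n)%N -> letter R x y false (y ^+ n)%g.
Proof.
by move=> n0; split; [exact: torsion_freeX|apply: spanX; exact: span_self].
Qed.

Lemma letter_x : letter R x y true x.
Proof. by split; [exact/eqP|exact: span_self]. Qed.

Lemma letter_generated b a : letter R x y b a -> generated a.
Proof. by move=> la; exists b, [:: a]; split=> //=; rewrite mulg1. Qed.

(** If [w] and [s] are the words of [g] and [y ^+ n * g], both beginning on the [x] side, then the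
    inverse of [s], [y ^+ n] and [w] concatenate to an alternating word of value 1. *)
Lemma starts_left_yX n g : (0 < n)%N -> starts_left g -> ~ starts_left (y ^+ n * g)%g.
Proof.
move=> n0 [w [w0 aw vw]] [s [s0 asx vs]].
have ly := letter_yX n0.
rewrite coset_repM in vs; last exact: letter_generated ly.
rewrite -mulgA -vw in vs.
have h := @no_relation _ _ zg_injective _ _ indep (odd (size s))
  (rev [seq (g^-1)%g | g <- s] ++ (y ^+ n)%g :: w).
suff : rev [seq (g^-1)%g | g <- s] ++ (y ^+ n)%g :: w = [::].
  by move/(congr1 size); rewrite size_cat /= addnS.
apply: h.
  apply/alternating_cat; split; first exact: (alternating_rev asx).
  by rewrite size_rev size_map addbb.
by rewrite value_cat value_rev vs /= mulVg.
Qed.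

(** The word of [g] is empty or begins with a letter from the span of [y], so [x] can be put in
    front of it. *)
Lemma starts_left_x g : ~ starts_left g -> starts_left (x * g)%g.
Proof.
move=> h; have [b [w [aw vw]]] := coset_repP g; exists (x :: w); split=> //.
  split; first exact: letter_x.
  case: w aw vw => [//|a w] aw vw; case: b aw => // aw.
  by case: h; exists (a :: w).
rewrite coset_repM; last exact: letter_generated letter_x.
by rewrite /= vw mulgA.
Qed.

(** The translates [P j] of [starts_left] by [y ^+ j] are pairwise disjoint, and [z j] maps the
    complement of [P j] into [P j]. *)
Lemma onorm_sum_conj (n : nat) :
  onorm (\sum_(j < n) lambda R (y ^+ j * x * (y ^+ j)^-1)%g) <= 2 * Num.sqrt n%:R.
Proof.
pose P (j : 'I_n) : pred G := fun g => `[< starts_left ((y ^+ j)^-1 * g)%g >].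
pose z (j : 'I_n) := (y ^+ j * x * (y ^+ j)^-1)%g.
have dis' (i j : 'I_n) g : (i < j)%N -> P i g -> P j g -> False.
  move=> ij /asboolP hi /asboolP hj; apply: (@starts_left_yX (j - i)%N _ _ hj).
    by rewrite subn_gt0.
  rewrite (_ : y ^+ (j - i) * _ = (y ^+ i)^-1 * g)%g//.
  have -> : (y ^+ j = y ^+ i * y ^+ (j - i))%g by rewrite -expgnDr subnKC// ltnW.
  by rewrite invgM -mulgA mulVKg.
have dis (i j : 'I_n) g : i != j -> P i g -> P j g -> False.
  by rewrite -val_eqE neq_ltn => /orP[] ij hi hj; [exact: dis' ij hi hj|exact: dis' ij hj hi].
apply: onorm_le => [|xi]; first by rewrite mulr_ge0 ?sqrtr_ge0.
rewrite bop_sumE.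
(* The [v j] are images of pieces with disjoint supports and are controlled by Cauchy-Schwarz and
   [bessel_cut]; the [u j] have disjoint supports themselves. Each of the two sums has norm at most
   [sqrt n * |xi|]. *)
pose v j := lambda R (z j) (cut (P j) xi).
pose u j := lambda R (z j) (xi - cut (P j) xi).
have -> : \sum_(j < n) lambda R (z j) xi = \sum_(j < n) v j + \sum_(j < n) u j.
  have vu j : lambda R (z j) xi = v j + u j by rewrite /v /u -bopD addrC subrK.
  by rewrite -big_split; apply: eq_bigr => j _; exact: vu.
have bnd (f : ell2 R G) : nsq f <= n%:R * nsq xi -> hnorm f <= Num.sqrt n%:R * hnorm xi.
  move=> h; rewrite hnorm_le_nsq ?mulr_ge0 ?sqrtr_ge0 ?hnorm_ge0//.
  by rewrite exprMn sqr_sqrtr ?ler0n// -nsqE.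
apply: le_trans (hnormD _ _) _; rewrite -mulrA mulr_natl mulr2n; apply: lerD; apply: bnd.
  apply: le_trans (nsq_sum_le _) _; rewrite ler_wpM2l ?ler0n//.
  rewrite (eq_bigr (fun j => nsq (cut (P j) xi))); first exact: bessel_cut.
  by move=> j _; rewrite nsq_lambda.
have usupp j g : u j g <> 0 -> P j g.
  rewrite lambdaE ell2BE cutE; case: ifPn => [_|/asboolPn h _]; first by rewrite subrr.
  apply/asboolP; have := starts_left_x h.
  by rewrite /z !invgM invgK -!mulgA mulKg mulVKg.
rewrite nsq_sum_orthogonal.
  rewrite mulr_natl -[X in _ *+ X]card_ord -sumr_const; apply: ler_sum => j _.
  by rewrite nsq_lambda nsq_sub_cut_le.
move=> i j ij; apply: rip_disjoint => g.
have [->|/eqP ui] := eqVneq (u i g : R[i]) 0; first by left.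
have [->|/eqP uj] := eqVneq (u j g : R[i]) 0; first by right.
by case: (dis i j g ij (usupp _ _ ui) (usupp _ _ uj)).
Qed.

End ping_pong.

Hypothesis betti : l2betti1 R G <> 0%E.

Lemma powers_averages (F : seq G) (e : R) : 0 < e -> (forall x, x \in F -> x != 1%g) ->
  exists (n : nat) (h : nat -> G), (0 < n)%N /\ forall x, x \in F ->
    onorm (\sum_(j < n) lambda R (h j * x * (h j)^-1)%g) <= e * n%:R.
Proof.
move=> e0 F1.
have [y hy] := exists_independent (regular_elt zg_injective) torsion_free betti F1.
have [n n0 hn] : exists2 n : nat, (0 < n)%N & 2 * Num.sqrt n%:R <= e * n%:R.
  (* [2 sqrt n <= e n] amounts to [(2 / e)^2 <= n]. *)
  pose n := (Num.truncn ((2 / e) ^+ 2)).+1; exists n => //.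
  have h : (2 / e) ^+ 2 <= n%:R by apply/ltW; exact: truncnS_gt.
  have n0 : 0 <= n%:R :> R by rewrite ler0n.
  rewrite -[X in e * X](sqr_sqrtr n0) expr2 mulrA ler_wpM2r ?sqrtr_ge0// mulrC -ler_pdivrMr//.
  by rewrite -(@ler_pXn2r _ 2)// ?nnegrE ?sqrtr_ge0 ?divr_ge0 ?(ltW e0)// sqr_sqrtr.
exists n, (fun j => y ^+ j)%g; split=> // x xF; apply: le_trans hn.
apply: onorm_sum_conj; [exact: F1| |exact: hy].
by apply/eqP => y1; apply: (hy x xF); rewrite y1; exact: depends1.
Qed.

End powers_averages.

(** * The reduced group algebra *)

Section reduced_algebra.
Variables (R : realType) (G : groupType).
Implicit Types (g h x : G) (S T U V W Y : bop R G).
Local Open Scope complex_scope.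

Lemma onorm_eq0 T : (forall e : R, 0 < e -> onorm T <= e) -> T = 0.
Proof.
move=> h; have T0 : onorm T = 0.
  apply/eqP; rewrite eq_le onorm_ge0 andbT.
  by apply/ler_addgt0Pl => e e0; rewrite addr0; exact: h.
apply: bop_ext => xi; apply: hnorm_eq0; have := onormP T xi; rewrite T0 mul0r => hx.
by apply/eqP; rewrite eq_le hx hnorm_ge0.
Qed.

Lemma onorm_scaleR (c : R) T : onorm (c%:C *: T) <= `|c| * onorm T.
Proof.
apply: le_trans (onormZ _ _) _.
by rewrite /sqmod /= expr0n /= addr0 sqrtr_sqr.
Qed.

Lemma half_pow_small (e : R) : 0 < e -> exists n : nat, 2^-1 ^+ n < e.
Proof.
move=> e0; pose n := (Num.truncn e^-1).+1; exists n.
have h : e^-1 < n%:R by exact: truncnS_gt.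
rewrite exprVn invf_plt ?posrE ?exprn_gt0//; apply: lt_trans h _.
by rewrite -natrX ltr_nat; exact: ltn_expl.
Qed.

Lemma half_pow_gt0 n : 0 < 2^-1 ^+ n :> R.
Proof. by rewrite exprn_gt0// invr_gt0. Qed.

Lemma norm_closureP (A : set (bop R G)) T : norm_closure A T <->
  forall e : R, 0 < e -> exists2 U, A U & onorm (T - U) < e.
Proof.
by rewrite /norm_closure/=; split=> h e /h[U AU hU]; exists U => //; move: hU; rewrite opnormE.
Qed.

Local Notation LS := (linear_span (range (@lambda R G))).
Local Notation A := (Cred R G).

Lemma spanP T : LS T <->
  exists s : seq (R[i] * G), T = \sum_(p <- s) p.1 *: lambda R p.2.
Proof.
split=> [[n [c [U [hU ->]]]]|[s ->]].
  have /choice[g hg] : forall i, exists g, lambda R g = U i.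
    by move=> i; have [g _ <-] := hU i; exists g.
  exists [seq (c i, g i) | i <- enum 'I_n].
  by rewrite big_map big_enum /=; apply: eq_bigr => i _; rewrite hg.
exists (size s), (fun i => (nth (0, 1%g) s i).1), (fun i => lambda R (nth (0, 1%g) s i).2).
split; first by move=> i; exists (nth (0, 1%g) s i).2.
by rewrite (big_nth (0, 1%g)) big_mkord.
Qed.

Lemma span_lambda g : LS (lambda R g).
Proof. by apply/spanP; exists [:: (1, g)]; rewrite big_seq1 scale1r. Qed.

Lemma span_linear c S T : LS S -> LS T -> LS (c *: S + T).
Proof.
move=> /spanP[s ->] /spanP[t ->]; apply/spanP.
exists ([seq (c * p.1, p.2) | p <- s] ++ t); rewrite big_cat big_map scaler_sumr /=.
by congr (_ + _); apply: eq_bigr => p _; rewrite scalerA.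
Qed.

Lemma bop_scalel (c : R[i]) S T : (c *: S) * T = c *: (S * T).
Proof. by apply: bop_ext. Qed.

Lemma bop_scaler (c : R[i]) S T : S * (c *: T) = c *: (S * T).
Proof. by apply: bop_ext => xi; rewrite bop_mulE !bop_scaleE bopZ. Qed.

Lemma span_mul S T : LS S -> LS T -> LS (S * T).
Proof.
move=> /spanP[s ->] /spanP[t ->]; apply/spanP.
exists [seq (p.1 * q.1, (p.2 * q.2)%g) | p <- s, q <- t].
rewrite big_allpairs_dep mulr_suml; apply: eq_bigr => p _.
rewrite mulr_sumr; apply: eq_bigr => q _.
by rewrite /= lambdaM bop_scalel bop_scaler scalerA.
Qed.

Lemma adj_sum (I : Type) (s : seq I) (F : I -> bop R G) :
  adj (\sum_(i <- s) F i) = \sum_(i <- s) adj (F i).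
Proof. by elim/big_rec2: _ => [|i u v _ <-]; rewrite ?adj0 ?adjD. Qed.

Lemma span_adj S : LS S -> LS (adj S).
Proof.
move=> /spanP[s ->]; apply/spanP.
exists [seq (conjc p.1, (p.2^-1)%g) | p <- s]; rewrite big_map adj_sum.
by apply: eq_bigr => p _; rewrite adjZ adj_lambda.
Qed.

Lemma span_Cred T : LS T -> A T.
Proof.
by move=> hT; apply/norm_closureP => e e0; exists T => //; rewrite subrr onorm0.
Qed.

Lemma CredP T : A T <-> forall e : R, 0 < e -> exists2 U, LS U & onorm (T - U) < e.
Proof. exact: norm_closureP. Qed.

Lemma Cred_closed T : norm_closure A T -> A T.
Proof.
move=> /norm_closureP h; apply/CredP => e e0; have e20 : 0 < e / 2 by rewrite divr_gt0.
have [U /CredP/(_ _ e20)[V LV hV] hU] := h _ e20; exists V => //.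
rewrite -(subrKA U T (- V)); apply: le_lt_trans (onormD _ _) _.
by rewrite [e]splitr ltrD.
Qed.

Lemma Cred_lambda g : A (lambda R g). Proof. exact/span_Cred/span_lambda. Qed.

Lemma Cred1 : A 1. Proof. by rewrite -(@lambda1 R G); exact: Cred_lambda. Qed.

Lemma CredD S T : A S -> A T -> A (S + T).
Proof.
move=> /CredP hS /CredP hT; apply/CredP => e e0; have e20 : 0 < e / 2 by rewrite divr_gt0.
have [U LU hU] := hS _ e20; have [V LV hV] := hT _ e20; exists (U + V).
  by have := span_linear 1 LU LV; rewrite scale1r.
by rewrite opprD addrACA; apply: le_lt_trans (onormD _ _) _; rewrite [e]splitr ltrD.
Qed.

Lemma CredM S T : A S -> A T -> A (S * T).
Proof.
move=> /CredP hS /CredP hT; apply/CredP => e e0.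
have p (c : R) : 0 <= c -> 0 < e / 2 / (c + 1).
  by move=> c0; rewrite !divr_gt0// ltr_wpDl.
have q (c d : R) : 0 <= c -> d < e / 2 / (c + 1) -> c * d < e / 2.
  move=> c0; rewrite ltr_pdivlMr ?ltr_wpDl// mulrDr mulr1 mulrC => h.
  have [d0|d0] := leP 0 d; first by apply: le_lt_trans h; rewrite lerDl.
  by apply: le_lt_trans (_ : 0 < _); rewrite ?divr_gt0// mulr_ge0_le0// ltW.
have [V LV hV] := hT _ (p _ (onorm_ge0 S)).
have [U LU hU] := hS _ (p _ (onorm_ge0 V)).
exists (U * V); first exact: span_mul.
rewrite (_ : S * T - U * V = S * (T - V) + (S - U) * V); last first.
  by rewrite mulrBr mulrBl addrA subrK.
apply: le_lt_trans (onormD _ _) _; rewrite [e]splitr; apply: ltrD.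
  by apply: le_lt_trans (onormM _ _) _; apply: q => //; exact: onorm_ge0.
by apply: le_lt_trans (onormM _ _) _; rewrite mulrC; apply: q => //; exact: onorm_ge0.
Qed.

Lemma CredZ (c : R[i]) T : A T -> A (c *: T).
Proof.
move=> AT; rewrite -[T]mul1r -bop_scalel; apply: (CredM _ AT); apply: span_Cred.
have := span_linear (c - 1) (span_lambda 1%g) (span_lambda 1%g).
by rewrite lambda1 scalerBl scale1r subrK.
Qed.

Lemma CredN T : A T -> A (- T).
Proof. by rewrite -scaleN1r; exact: CredZ. Qed.

Lemma CredB S T : A S -> A T -> A (S - T).
Proof. by move=> hS hT; exact: (CredD hS (CredN hT)). Qed.

Lemma CredX T n : A T -> A (T ^+ n).
Proof.
move=> hT; elim: n => [|n IHn]; first by rewrite expr0; exact: Cred1.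
by rewrite exprS; exact: (CredM hT IHn).
Qed.

Lemma Cred_adj T : A T -> A (adj T).
Proof.
move=> /CredP h; apply/CredP => e /h[U LU hU]; exists (adj U); first exact: span_adj.
by rewrite -adjB onorm_adj.
Qed.

Lemma Cred_in_LG T : A T -> T \in @in_LG R G.
Proof.
move=> /CredP h; apply/in_LGE => W hW; apply/eqP; rewrite -subr_eq0; apply/eqP/onorm_eq0 => e e0.
have p : 0 < e / (2 * (onorm W + 1)).
  by rewrite divr_gt0// mulr_gt0// ltr_wpDl ?onorm_ge0.
have [V /spanP[s sV] hV] := h _ p.
have VW : V * W = W * V.
  rewrite sV mulr_suml mulr_sumr; apply: eq_bigr => q _.
  by rewrite bop_scalel bop_scaler; congr (_ *: _); rewrite hW//; exists q.2.
have -> : T * W - W * T = (T - V) * W - W * (T - V).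
  by rewrite mulrBl mulrBr VW opprB addrA subrK.
apply: le_trans (onormD _ _) _; rewrite onormN.
apply: le_trans (lerD (onormM _ _) (onormM _ _)) _.
move: hV; rewrite ltr_pdivlMr ?mulr_gt0 ?ltr_wpDl ?onorm_ge0//.
have := onorm_ge0 W; have := onorm_ge0 (T - V).
by move: (onorm W) (onorm (T - V)) => a b a0 b0; nra.
Qed.

(** Norm completeness: the limit is taken on each vector, and the bounds, uniform over vectors, pass
    to it. *)
Lemma geometric_limit (Y : nat -> bop R G) :
  (forall n k, onorm (Y (n + k)%N - Y n) <= 2^-1 ^+ n) ->
  exists Z, forall n, onorm (Z - Y n) <= 2^-1 ^+ n.
Proof.
move=> hY.
have Yn n k xi : hnorm (Y (n + k)%N xi - Y n xi) <= 2^-1 ^+ n * hnorm xi.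
  rewrite -bop_subE; apply: le_trans (onormP _ _) _.
  by rewrite ler_wpM2r ?hnorm_ge0.
have [Z _ hZ] : exists2 Z : bop R G, (forall xi, hnorm (Z xi) <= (onorm (Y 0%N) + 1) * hnorm xi)
    & forall xi, l2cvg (fun n => Y n xi) (Z xi).
  apply: strong_limit => [n xi|xi e e0].
    rewrite -(subrK (Y 0%N xi) (Y n xi)); apply: le_trans (hnormD _ _) _.
    rewrite addrC mulrDl lerD ?onormP//.
    by have := Yn 0%N n xi; rewrite add0n expr0.
  have p : 0 < e / (2 * (hnorm xi + 1)) by rewrite divr_gt0// mulr_gt0// ltr_wpDl ?hnorm_ge0.
  have [N hN] := half_pow_small p; exists N => m n Nm Nn.
  have b k : (N <= k)%N -> hnorm (Y k xi - Y N xi) <= e / 2.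
    move=> Nk; rewrite -(subnKC Nk); apply: le_trans (Yn _ _ _) _.
    move: hN; rewrite ltr_pdivlMr ?mulr_gt0 ?ltr_wpDl ?hnorm_ge0//.
    have := hnorm_ge0 xi; have := half_pow_gt0 N.
    by move: (hnorm xi) (2^-1 ^+ N) => a c a0 c0; nra.
  rewrite -(subrKA (Y N xi) (Y m xi) (- Y n xi)); apply: le_trans (hnormD _ _) _.
  by rewrite [e]splitr lerD ?b// hnormB b.
exists Z => n; apply: onorm_le => [|xi]; first exact/ltW/half_pow_gt0.
have h1 : hnorm (Y (k + n)%N xi - Y n xi) @[k --> \oo] --> hnorm (Z xi - Y n xi).
  apply: (@l2cvg_norm _ _ (fun k => Y (k + n)%N xi - Y n xi)).
  apply: l2cvgD; last exact: l2cvg_cst.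
  apply/l2cvgP => e e0; have /l2cvgP/(_ e e0)[N _ hN] := hZ xi.
  by exists N => // k Nk; apply: (hN (k + n)%N); rewrite /= (leq_trans Nk)// leq_addr.
rewrite bop_subE; apply: (closed_cvg _ (@closed_le R (2^-1 ^+ n * hnorm xi)) _ _ h1) => //.
by exists 0%N => // k _; rewrite /= addnC; exact: Yn.
Qed.

(* [1 - Y] is a square root of [1 - T], found as the fixed point of the
   contraction [Y |-> (T + Y^2) / 2] of the ball of radius 1/4. *)
Lemma sqrt_near1 T : A T -> adj T = T -> onorm T <= 4^-1 ->
  exists Y, [/\ A Y, adj Y = Y & (1 - Y) * (1 - Y) = 1 - T].
Proof.
move=> AT aT nT.
pose f Y := (2^-1 : R)%:C *: (T + Y * Y).
pose Y := fix Y n := if n is n'.+1 then f (Y n') else (0 : bop R G).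
have fE V W : f V - f W = (2^-1 : R)%:C *: (V * (V - W) + (V - W) * W).
  rewrite /f -scalerBr; congr (_ *: _).
  by rewrite opprD addrACA subrr add0r mulrBr mulrBl addrA subrK.
have fd V W : onorm V <= 4^-1 -> onorm W <= 4^-1 -> onorm (f V - f W) <= 2^-1 * onorm (V - W).
  move=> hV hW; rewrite fE.
  apply: le_trans (onorm_scaleR _ _) _; rewrite ger0_norm ?invr_ge0// ler_pM2l ?invr_gt0//.
  apply: le_trans (onormD _ _) _; apply: le_trans (lerD (onormM _ _) (onormM _ _)) _.
  by have := onorm_ge0 (V - W); move: (onorm _) (onorm _) (onorm _) hV hW => a b c; nra.
have fb V : onorm V <= 4^-1 -> onorm (f V) <= 4^-1.
  move=> hV; apply: le_trans (onorm_scaleR _ _) _; rewrite ger0_norm ?invr_ge0//.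
  have := onormD T (V * V); have := onormM V V; have := onorm_ge0 V.
  move: nT hV; move: (onorm T) (onorm V) (onorm (V * V)) (onorm (T + V * V)) => a b c d; nra.
have Yb n : onorm (Y n) <= 4^-1.
  by elim: n => [|n IHn]; [rewrite onorm0 invr_ge0|exact: fb].
have YA n : A (Y n).
  elim: n => [|n IHn]; first by rewrite /= -(subrr 1); exact: (CredB Cred1 Cred1).
  by apply: CredZ; exact: (CredD AT (CredM IHn IHn)).
have Ya n : adj (Y n) = Y n.
  elim: n => [|n IHn]; first exact: adj0.
  by rewrite /= /f adjZ conjc_real adjD aT adjM IHn.
have Yc n k : onorm (Y (n + k)%N - Y n) <= 2^-1 ^+ n.
  elim: n => [|n IHn].
    by rewrite add0n subr0 expr0; apply: le_trans (Yb k) _; lra.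
  by rewrite addSn /= exprS; apply: le_trans (fd _ _ (Yb _) (Yb _)) _; rewrite ler_pM2l ?invr_gt0.
have [Z hZ] := geometric_limit Yc; exists Z.
have Zb : onorm Z <= 2.
  have := hZ 0%N; rewrite subr0 expr0 => h; apply: le_trans h _; lra.
have fZ : Z = f Z.
  apply/eqP; rewrite -subr_eq0; apply/eqP/onorm_eq0 => e e0.
  have p : 0 < e / 4 by rewrite divr_gt0.
  have [n hn] := half_pow_small p.
  have h1 : onorm (Z - Y n.+1) <= 2^-1 ^+ n.
    apply: le_trans (hZ n.+1) _; rewrite exprS; have := half_pow_gt0 n.
    by move: (2^-1 ^+ n) => q; lra.
  have h2 : onorm (f (Y n) - f Z) <= 3 * 2^-1 ^+ n.
    rewrite fE.
    apply: le_trans (onorm_scaleR _ _) _; rewrite ger0_norm ?invr_ge0//.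
    have := onormD (Y n * (Y n - Z)) ((Y n - Z) * Z).
    have := onormM (Y n) (Y n - Z); have := onormM (Y n - Z) Z.
    have := hZ n; rewrite onormB; have := onorm_ge0 (Y n - Z); have := onorm_ge0 Z.
    have := onorm_ge0 (Y n); have := Yb n; have := half_pow_gt0 n.
    move: (2^-1 ^+ n) (onorm (Y n)) (onorm (Y n - Z)).
    move: (onorm (_ * Z)) (onorm (Y n * _)) (onorm (_ + _)).
    by move=> q a b c d e' ? ? ? ? ? ? ? ?; nra.
  rewrite -(subrKA (Y n.+1) Z (- f Z)); apply: le_trans (onormD _ _) _.
  have h3 : onorm (Y n.+1 - f Z) <= 3 * 2^-1 ^+ n by [].
  by move: h1 h3 hn; move: (onorm _) (onorm _) (2^-1 ^+ n) => a b c; lra.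
split.
- apply: Cred_closed; apply/norm_closureP => e /half_pow_small[n hn].
  by exists (Y n); [exact: YA|exact: le_lt_trans (hZ n) hn].
- apply/eqP; rewrite -subr_eq0; apply/eqP/onorm_eq0 => e e0.
  have p : 0 < e / 2 by rewrite divr_gt0.
  have [n hn] := half_pow_small p.
  rewrite -(subrKA (Y n) (adj Z) (- Z)) -{1}(Ya n) -adjB.
  apply: le_trans (onormD _ _) _; rewrite onorm_adj (onormB (Y n)).
  by have := hZ n; move: (onorm _) (2^-1 ^+ n) hn => a b; lra.
have hZf : Z + Z = T + Z * Z.
  rewrite {1 2}fZ /f -scalerDl -rmorphD/= (_ : 2^-1 + 2^-1 = 1) ?scale1r//; lra.
rewrite mulrBr mulr1 mulrBl mul1r opprB addrA.
rewrite (_ : 1 - Z + Z * Z - Z = 1 - (Z + Z) + Z * Z); last first.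
  by rewrite opprD addrA addrAC.
by rewrite hZf opprD addrA subrK.
Qed.

End reduced_algebra.

(** * Uniqueness of the trace and simplicity *)

Section trace_and_simplicity.
Variables (R : realType) (G : groupType).
Implicit Types (g h x : G) (S T U V W : bop R G).
Local Open Scope complex_scope.
Local Notation LS := (linear_span (range (@lambda R G))).
Local Notation A := (Cred R G).

(** The canonical trace [inner (T delta1) delta1], read off as a coordinate. *)
Definition ctrace T : R[i] := T (delta1 R G) 1%g.

Lemma ctrace_linear (c : R[i]) S T : ctrace (c *: S + T) = c * ctrace S + ctrace T.
Proof. by rewrite /ctrace bop_addE ell2DE bop_scaleE ell2ZE. Qed.

Lemma ctrace_lambda g : ctrace (lambda R g) = (g == 1%g)%:R.
Proof.
rewrite /ctrace lambdaE delta1E singleE mulg1 -[1%g in LHS]invg1 (inj_eq (@invg_inj _)).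
by case: eqP.
Qed.

Lemma Re_ctrace T : complex.Re (ctrace T) = rtr T.
Proof. by rewrite /rtr ripC delta1E rip_single /= mul0r addr0 mul1r -delta1E. Qed.

Lemma Im_ctrace T : complex.Im (ctrace T) = rtr ((- 'i) *: T).
Proof.
rewrite -Re_ctrace /ctrace bop_scaleE ell2ZE.
by case: (T _ _) => a b /=; rewrite oppr0 mul0r sub0r mulN1r opprK.
Qed.

Lemma complex_eq (z w : R[i]) : complex.Re z = complex.Re w -> complex.Im z = complex.Im w -> z = w.
Proof. by case: z w => a b [c d] /= -> ->. Qed.

Lemma ctraceC S T : S \in @in_LG R G -> T \in @in_LG R G -> ctrace (S * T) = ctrace (T * S).
Proof.
move=> hS hT; apply: complex_eq.
  by rewrite !Re_ctrace rtrC.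
rewrite !Im_ctrace -bop_scalel -[(- 'i) *: (T * S)]bop_scaler.
by apply: rtrC => //; exact: scale_in_LG.
Qed.

Lemma ctrace_adj T : ctrace (adj T * T) = (nsq (T (delta1 R G)))%:C.
Proof.
apply: complex_eq; first by rewrite Re_ctrace /rtr bop_mulE adjPl rip_nsq.
rewrite Im_ctrace /rtr bop_scaleE bop_mulE.
rewrite (_ : - 'i = conjc 'i :> R[i]); last by apply: complex_eq; rewrite /= ?oppr0.
rewrite -ripZr_conj adjPl bopZ; set v := T _.
by have := rip_ir v v; rewrite [rip v _]ripC => e; rewrite /=; lra.
Qed.

Lemma ctrace_state : tracial_state A ctrace.
Proof.
split.
- by move=> c S T _ _; exact: ctrace_linear.
- by move=> S T _ _ /is_adjointP ->; rewrite ctrace_adj lecR nsq_ge0.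
- by rewrite -(@lambda1 R G) ctrace_lambda eqxx.
- by move=> S T /Cred_in_LG hS /Cred_in_LG hT; exact: ctraceC.
Qed.

(** * Continuity of tracial states *)

Section states.
Variable tau : bop R G -> R[i].
Hypothesis tauP : tracial_state A tau.

Let tau_linear (c : R[i]) S T : A S -> A T -> tau (c *: S + T) = c * tau S + tau T.
Proof. by case: tauP => h _ _ _; exact: h. Qed.

Let tau1 : tau 1 = 1. Proof. by case: tauP. Qed.

Lemma state0 : tau 0 = 0.
Proof.
have A0 : A 0 by rewrite -(subrr 1); exact: (CredB (@Cred1 R G) (@Cred1 R G)).
have := tau_linear 1 A0 A0; rewrite scaler0 addr0 mul1r => h.
by apply: (addrI (tau 0)); rewrite addr0 -h.
Qed.

Lemma Cred0 : A 0.
Proof. by rewrite -(subrr 1); exact: (CredB (@Cred1 R G) (@Cred1 R G)). Qed.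

Lemma stateZ (c : R[i]) T : A T -> tau (c *: T) = c * tau T.
Proof. by move=> hT; have := tau_linear c hT Cred0; rewrite addr0 state0 addr0. Qed.

Lemma stateD S T : A S -> A T -> tau (S + T) = tau S + tau T.
Proof. by move=> hS hT; have := tau_linear 1 hS hT; rewrite scale1r mul1r. Qed.

Lemma stateB S T : A S -> A T -> tau (S - T) = tau S - tau T.
Proof.
by move=> hS hT; rewrite (stateD hS (CredN hT)) -scaleN1r (stateZ _ hT) mulN1r.
Qed.

Lemma state_sum (I : Type) (s : seq I) (F : I -> bop R G) :
  (forall i, A (F i)) -> tau (\sum_(i <- s) F i) = \sum_(i <- s) tau (F i).
Proof.
move=> hF; suff [] : A (\sum_(i <- s) F i) /\
    tau (\sum_(i <- s) F i) = \sum_(i <- s) tau (F i) by [].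
elim: s => [|i s [IHA IH]]; first by rewrite !big_nil state0; split; [exact: Cred0|].
by rewrite !big_cons (stateD (hF i) IHA) IH; split; [exact: (CredD (hF i) IHA)|].
Qed.

Lemma state_conj g h : tau (lambda R (h * g * h^-1)%g) = tau (lambda R g).
Proof.
case: tauP => _ _ _ tauC; rewrite -mulgA lambdaM.
rewrite tauC; [|exact: Cred_lambda|exact: Cred_lambda].
by rewrite -lambdaM -mulgA mulVg mulg1.
Qed.

(** [1 - T] is the square of a self-adjoint element of the algebra, so positivity applies; the bound
    [4^-1] is the one required by [sqrt_near1]. *)
Lemma state_le1 T : A T -> adj T = T -> onorm T <= 4^-1 -> tau T <= 1.
Proof.
move=> AT aT nT; have [Y [AY aY YY]] := sqrt_near1 AT aT nT.
have A1Y : A (1 - Y) by exact: (CredB (@Cred1 R G) AY).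
have [_ pos _ _] := tauP; have := pos _ _ A1Y A1Y.
rewrite YY (stateB (@Cred1 R G) AT) tau1 subr_ge0; apply.
by apply/is_adjointP; rewrite adjB adj1 aY.
Qed.

(** [state_le1] applies to both [T / e] and [- T / e]. As the order on [R[i]] includes equality of
    imaginary parts, it also forces [tau T] to be real. *)
Lemma state_selfadjoint T (e : R) : 0 < e -> A T -> adj T = T -> onorm T <= e / 4 ->
  complex.Im (tau T) = 0 /\ `|complex.Re (tau T)| <= e.
Proof.
move=> e0 AT aT nT.
have bnd (c : R) : `|c| = e^-1 -> tau (c%:C *: T) <= 1.
  move=> hc; apply: state_le1; first exact: CredZ.
    by rewrite adjZ conjc_real aT.
  apply: le_trans (onorm_scaleR _ _) _; rewrite hc mulrC ler_pdivrMr// mulrC.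
  by move: nT; rewrite mulrC.
have ei : 0 <= e^-1 by rewrite invr_ge0 ltW.
have := bnd e^-1; rewrite (ger0_norm ei) => /(_ erefl).
have := bnd (- e^-1); rewrite normrN (ger0_norm ei) => /(_ erefl).
rewrite !(stateZ _ AT); case: (tau T) => a b; rewrite !lecE /= !mul0r !subr0 !addr0 eq_sym.
move=> /andP[/eqP b0 h1] /andP[_ h2]; split.
  by move: b0 => /eqP; rewrite mulNr oppr_eq0 mulf_eq0 invr_eq0 (gt_eqF e0) => /eqP.
rewrite mulNr in h1; have ea : e * (e^-1 * a) = a by rewrite mulrA divff ?mul1r// gt_eqF.
rewrite ler_norml -ea; apply/andP; split; move: h1 h2; move: (e^-1 * a) => c; nra.
Qed.

Lemma state_bound T (e : R) : 0 < e -> A T -> onorm T <= e / 4 ->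
  `|complex.Re (tau T)| <= e /\ `|complex.Im (tau T)| <= e.
Proof.
move=> e0 AT nT.
(* Real and imaginary part of [T]; [Complex 0 (- 2^-1)] is [1 / (2 'i)]. Both have real values under
   [tau], which are the two parts of [tau T]. *)
pose H := (2^-1 : R)%:C *: (T + adj T); pose K := (Complex 0 (- 2^-1) : R[i]) *: (T - adj T).
have AaT := Cred_adj AT.
have AH : A H by apply: CredZ; exact: CredD.
have AK : A K by apply: CredZ; exact: CredB.
have aH : adj H = H by rewrite /H adjZ conjc_real adjD adjK addrC.
have aK : adj K = K.
  rewrite /K adjZ adjB adjK -opprB scalerN -scaleNr; congr (_ *: _).
  by apply: complex_eq; rewrite /= ?oppr0 ?opprK.
have TE : T = H + 'i *: K.
  rewrite /H /K scalerA (_ : 'i * _ = (2^-1 : R)%:C); last first.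
    by apply: complex_eq; rewrite /=; ring.
  rewrite -scalerDr addrACA subrr addr0.
  have -> : T + T = (2%:R : R[i]) *: T by rewrite scaler_nat mulr2n.
  rewrite scalerA (_ : _ * _ = 1) ?scale1r//.
  have -> : (2%:R : R[i]) = (2%:R : R)%:C by rewrite rmorph_nat.
  by rewrite -rmorphM/= mulVf ?pnatr_eq0.
have nH : onorm H <= e / 4.
  apply: le_trans (onorm_scaleR _ _) _; rewrite ger0_norm ?invr_ge0//.
  have := onormD T (adj T); rewrite onorm_adj; move: nT.
  by move: (onorm T) (onorm (T + _)) => a b; lra.
have nK : onorm K <= e / 4.
  apply: le_trans (onormZ _ _) _.
  rewrite /sqmod /= expr0n /= add0r sqrtr_sqr normrN ger0_norm ?invr_ge0//.
  have := onormD T (- adj T); rewrite onormN onorm_adj; move: nT.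
  by move: (onorm T) (onorm (T - _)) => a b; lra.
have [H1 H2] := state_selfadjoint e0 AH aH nH; have [K1 K2] := state_selfadjoint e0 AK aK nK.
rewrite TE (stateD AH (CredZ 'i AK)) (stateZ _ AK).
move: H1 H2 K1 K2; case: (tau H) => a b; case: (tau K) => c d /= -> h1 -> h2.
by rewrite !mul0r !mul1r subr0 !addr0 !add0r.
Qed.

End states.

Hypothesis averages : forall (F : seq G) (e : R), 0 < e -> (forall x, x \in F -> x != 1%g) ->
  exists (n : nat) (h : nat -> G), (0 < n)%N /\ forall x, x \in F ->
    onorm (\sum_(j < n) lambda R (h j * x * (h j)^-1)%g) <= e * n%:R.

Lemma eq0_small (a : R) : (forall e, 0 < e -> `|a| <= e) -> a = 0.
Proof.
move=> h; apply/eqP; rewrite -normr_eq0 eq_le normr_ge0 andbT.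
by apply/ler_addgt0Pl => e e0; rewrite addr0; exact: h.
Qed.

(** A trace is constant on conjugates, so its value on the sum of [n] conjugates is [n] times
    [tau (lambda R g)], whereas the norm of that sum is small compared with [n]. *)
Lemma state_lambda tau : tracial_state A tau -> forall g, g != 1%g -> tau (lambda R g) = 0.
Proof.
move=> tauP g g1.
have bnd (e : R) : 0 < e ->
    `|complex.Re (tau (lambda R g))| <= e /\ `|complex.Im (tau (lambda R g))| <= e.
  move=> e0; have e40 : 0 < e / 4 by rewrite divr_gt0.
  have [n [h [n0 hn]]] : exists (n : nat) (h : nat -> G), (0 < n)%N /\ forall x, x \in [:: g] ->
      onorm (\sum_(j < n) lambda R (h j * x * (h j)^-1)%g) <= (e / 4) * n%:R.
    by apply: averages => // x; rewrite inE => /eqP->.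
  have np : 0 < n%:R :> R by rewrite ltr0n.
  have {}hn := hn g (mem_head _ _).
  set S := \sum_(j < n) _ in hn.
  have AS : A S.
    rewrite /S; elim/big_rec: _ => [|j V _ AV]; first exact: Cred0.
    exact: (CredD (Cred_lambda _) AV).
  have tS : tau S = n%:R * tau (lambda R g).
    rewrite /S (state_sum tauP); last by move=> j; exact: Cred_lambda.
    rewrite (eq_bigr (fun=> tau (lambda R g))); last by move=> j _; exact: state_conj.
    by rewrite sumr_const card_ord mulr_natl.
  have en0 : 0 < e * n%:R by rewrite mulr_gt0.
  have := state_bound tauP en0 AS; rewrite tS mulrAC => /(_ hn).
  have -> : (n%:R : R[i]) = (n%:R : R)%:C by rewrite rmorph_nat.
  case: (tau _) => a b /=; rewrite !mul0r subr0 addr0 !normrM (ger0_norm (ltW np)).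
  by rewrite ![n%:R * _]mulrC !ler_pM2r.
apply: complex_eq; apply: eq0_small => e /bnd[].
  by [].
by [].
Qed.

Lemma state_unique tau tau' : tracial_state A tau -> tracial_state A tau' ->
  forall T, A T -> tau' T = tau T.
Proof.
move=> tP tP' T AT.
have lamE g : tau' (lambda R g) = tau (lambda R g).
  have [->|g1] := eqVneq g 1%g; last by rewrite !state_lambda.
  by rewrite lambda1; case: tP tP' => _ _ -> _ [_ _ -> _].
have spanE U : LS U -> tau' U = tau U.
  move=> /spanP[s ->]; have hA (p : R[i] * G) : A (p.1 *: lambda R p.2).
    by apply: CredZ; exact: Cred_lambda.
  rewrite (state_sum tP' _ hA) (state_sum tP _ hA); apply: eq_bigr => p _.
  by rewrite (stateZ tP' _ (Cred_lambda _)) (stateZ tP _ (Cred_lambda _)) lamE.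
have bnd (e : R) : 0 < e ->
    `|complex.Re (tau' T - tau T)| <= e /\ `|complex.Im (tau' T - tau T)| <= e.
  move=> e0; have e20 : 0 < e / 2 by rewrite divr_gt0.
  have e80 : 0 < e / 2 / 4 by rewrite !divr_gt0.
  have [U LU /ltW hU] := proj1 (CredP T) AT _ e80.
  have AU := span_Cred LU; have ATU := CredB AT AU.
  have := state_bound tP e20 ATU hU; have := state_bound tP' e20 ATU hU.
  rewrite (stateB tP AT AU) (stateB tP' AT AU) (spanE U LU).
  case: (tau' T) (tau T) (tau U) => a b [c d] [u v] /=.
  rewrite !ler_norml => -[/andP[? ?] /andP[? ?]] [/andP[? ?] /andP[? ?]].
  by split; apply/andP; split; lra.
by apply/eqP; rewrite -subr_eq0; apply/eqP; apply: complex_eq; apply: eq0_small => e /bnd[].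
Qed.

Lemma Cred_unique_trace : has_unique_trace A.
Proof.
by exists ctrace => [|tau ht]; [exact: ctrace_state|exact: (state_unique ctrace_state ht)].
Qed.

Lemma onorm_conj_sum (n : nat) (h : nat -> G) W :
  onorm (\sum_(j < n) lambda R (h j) * W * lambda R ((h j)^-1)%g) <= n%:R * onorm W.
Proof.
apply: le_trans (onorm_sum _ _ _) _; rewrite mulr_natl -[X in _ *+ X]card_ord -sumr_const.
apply: ler_sum => j _; apply: le_trans (onormM _ _) _.
apply: le_trans (ler_pM (onorm_ge0 _) (onorm_ge0 _) (onormM _ _) (onorm_lambda _ _)) _.
by rewrite mulr1 -[leRHS]mul1r ler_wpM2r ?onorm_ge0 ?onorm_lambda.
Qed.

Lemma ctrace_bound T : Num.sqrt (sqmod (ctrace T)) <= onorm T.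
Proof.
rewrite -[leRHS]ger0_norm ?onorm_ge0// -sqrtr_sqr ler_wsqrtr//.
apply: le_trans (sqmod_le_nsq _ _) _; rewrite nsqE ler_pXn2r ?nnegrE ?hnorm_ge0 ?onorm_ge0//.
apply: le_trans (onormP _ _) _; rewrite hnormE delta1E nsq_single /sqmod /= expr1n expr0n /= addr0.
by rewrite sqrtr1 mulr1.
Qed.

(** * Closed ideals of the reduced group algebra *)

Section ideals.
Variable I : set (bop R G).
Hypothesis idealI : closed_ideal A I.

Let IA T : I T -> A T. Proof. by case: idealI => h _ _ _ _; exact: h. Qed.
Let I0 : I 0. Proof. by case: idealI. Qed.
Let Ilin (c : R[i]) S T : I S -> I T -> I (c *: S + T).
Proof. by case: idealI => _ _ h _ _; exact: h. Qed.
Let Il S T : A S -> I T -> I (S * T).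
Proof. by case: idealI => _ _ _ h _ hS hT; case: (h S T hS hT). Qed.
Let Ir S T : A S -> I T -> I (T * S).
Proof. by case: idealI => _ _ _ h _ hS hT; case: (h S T hS hT). Qed.
Let Icl T : norm_closure I T -> I T.
Proof. by case: idealI => _ _ _ _ h; exact: h. Qed.

Let ID S T : I S -> I T -> I (S + T).
Proof. by move=> hS hT; have := Ilin 1 hS hT; rewrite scale1r. Qed.

Let IZ (c : R[i]) T : I T -> I (c *: T).
Proof. by move=> hT; have := Ilin c hT I0; rewrite addr0. Qed.

(** The elements [1 - (1 - b) ^+ k] of the ideal converge to 1 in norm, and the ideal is closed. *)
Lemma ideal_unit_near b : I b -> onorm (1 - b) <= 2^-1 -> I 1.
Proof.
move=> Ib nb; have Ab := CredB (@Cred1 R G) (IA Ib).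
have Ik k : I (1 - (1 - b) ^+ k).
  elim: k => [|k IHk]; first by rewrite expr0 subrr.
  rewrite (_ : 1 - (1 - b) ^+ k.+1 = 1 - (1 - b) ^+ k + (1 - b) ^+ k * b).
    by apply: (ID IHk); apply: Il Ib; exact: CredX.
  by rewrite exprSr mulrBr mulr1 opprB addrA [RHS]addrAC.
have nk k : onorm ((1 - b) ^+ k) <= 2^-1 ^+ k.
  elim: k => [|k IHk]; first by rewrite !expr0 onorm1.
  by rewrite !exprS; apply: le_trans (onormM _ _) _; apply: ler_pM => //; exact: onorm_ge0.
apply: Icl; apply/norm_closureP => e /half_pow_small[k hk].
exists (1 - (1 - b) ^+ k); first exact: Ik.
by rewrite opprB addrC subrK; exact: le_lt_trans (nk k) hk.
Qed.

Lemma ideal_full : I 1 -> I = A.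
Proof.
move=> I1; apply/seteqP; split=> [T|T AT]; first exact: IA.
by rewrite -[T]mulr1; exact: Il.
Qed.

(** Averaging [a] over conjugates stays in the ideal, fixes the scalar part and almost kills the
    rest, so it ends near 1. *)
Lemma ideal_average a : I a -> ctrace a = 1 -> I 1.
Proof.
move=> Ia ta.
(* Three errors of [8^-1]: the approximation of [a] by [U], the distance of the scalar part [c] from
   1, and the average of the remaining part [V]. Together they stay below the [2^-1] of
   [ideal_unit_near]. *)
have e80 : 0 < 8^-1 :> R by rewrite invr_gt0.
have [U /spanP[s sU] hU] := proj1 (CredP a) (IA Ia) _ e80.
pose s1 : seq (R[i] * G) := [seq p <- s | p.2 == 1%g].
pose s2 : seq (R[i] * G) := [seq p <- s | p.2 != 1%g].
pose V : bop R G := \sum_(p <- s2) p.1 *: lambda R p.2.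
pose c : R[i] := \sum_(p <- s1) p.1.
have UE : U = c *: (1 : bop R G) + V.
  rewrite sU (bigID (fun p => p.2 == 1%g))/= /V /s2 big_filter; congr (_ + _).
  rewrite /c /s1 big_filter scaler_suml; apply: eq_bigr => p /eqP ->.
  by rewrite lambda1.
have tU : ctrace U = c.
  rewrite UE ctrace_linear -(@lambda1 R G) ctrace_lambda eqxx mulr1.
  rewrite (_ : ctrace V = 0) ?addr0//.
  rewrite /V /s2 /ctrace bop_sumE ell2_sumE big_filter big1// => p p1.
  rewrite bop_scaleE ell2ZE; have := ctrace_lambda p.2.
  by rewrite (negPf p1) /ctrace => ->; rewrite mulr0.
(* [c - 1 = ctrace (U - a)], and [ctrace] is contractive. *)
have nc : onorm (c *: (1 : bop R G) - 1) <= 8^-1.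
  have -> : c *: (1 : bop R G) - 1 = ctrace (U - a) *: (1 : bop R G).
    have -> : ctrace (U - a) = c - 1.
      by rewrite -[in RHS]tU -ta /ctrace bop_subE ell2BE.
    by rewrite scalerBl scale1r.
  apply: le_trans (onormZ _ _) _.
  apply: le_trans (ler_pM _ _ (ctrace_bound _) (@onorm1 R G)) _; rewrite ?sqrtr_ge0 ?onorm_ge0//.
  by rewrite mulr1 onormB ltW.
pose M := \sum_(p <- s2) Num.sqrt (sqmod p.1).
have M0 : 0 <= M by apply: sumr_ge0 => p _; exact: sqrtr_ge0.
(* [M] bounds the total weight of the coefficients of [V]; [M + 1] keeps the quotient defined when
   [V] has no terms. *)
have e0 : 0 < 8^-1 / (M + 1) by rewrite divr_gt0// ltr_wpDl.
have [n [h [n0 hn]]] : exists (n : nat) (h : nat -> G), (0 < n)%N /\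
    forall x, x \in [seq p.2 | p <- s2] ->
    onorm (\sum_(j < n) lambda R (h j * x * (h j)^-1)%g) <= 8^-1 / (M + 1) * n%:R.
  by apply: averages => // x /mapP[p + ->]; rewrite mem_filter => /andP[].
have np : 0 < n%:R :> R by rewrite ltr0n.
pose avg W := \sum_(j < n) lambda R (h j) * W * lambda R ((h j)^-1)%g.
have avgD W W' : avg (W + W') = avg W + avg W'.
  by rewrite /avg -big_split; apply: eq_bigr => j _; rewrite mulrDr mulrDl.
have avgZ (d : R[i]) W : avg (d *: W) = d *: avg W.
  by rewrite /avg scaler_sumr; apply: eq_bigr => j _; rewrite bop_scaler bop_scalel.
have avg1 : avg 1 = (n%:R : R[i]) *: (1 : bop R G).
  rewrite /avg (eq_bigr (fun=> 1)); last first.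
    by move=> j _; rewrite mulr1 -lambdaM mulgV lambda1.
  by rewrite sumr_const card_ord scaler_nat.
have avgL x : avg (lambda R x) = \sum_(j < n) lambda R (h j * x * (h j)^-1)%g.
  by apply: eq_bigr => j _; rewrite -!lambdaM.
have avgVE : avg V = \sum_(p <- s2) p.1 *: avg (lambda R p.2).
  rewrite /V; elim/big_rec2: _ => [|p W W' _ <-]; last by rewrite avgD avgZ.
  by have := avgZ 0 0; rewrite !scale0r.
have avgV : onorm (avg V) <= 8^-1 * n%:R.
  rewrite avgVE; apply: le_trans (onorm_sum _ _ _) _.
  apply: (@le_trans _ _ (M * (8^-1 / (M + 1) * n%:R))).
    rewrite /M mulr_suml big_seq [leRHS]big_seq; apply: ler_sum => p ps.
    apply: le_trans (onormZ _ _) _; rewrite ler_wpM2l ?sqrtr_ge0// avgL.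
    by apply: hn; apply: map_f.
  rewrite mulrA ler_pM2r// mulrCA ger_pMr// ler_pdivrMr ?ltr_wpDl// mul1r.
  by rewrite lerDl.
have Iavg : I (avg a).
  rewrite /avg; elim/big_rec: _ => [|j W _ IW]; first exact: I0.
  apply: ID IW; apply: (Ir (Cred_lambda _)); exact: (Il (Cred_lambda _)).
apply: (@ideal_unit_near ((n%:R^-1 : R)%:C *: avg a)); first exact: IZ.
set nC := (n%:R^-1 : R)%:C.
have nCn : nC * n%:R = 1.
  rewrite /nC (_ : (n%:R : R[i]) = (n%:R : R)%:C); last by rewrite rmorph_nat.
  by rewrite -rmorphM/= mulVf// gt_eqF.
have aE : nC *: avg a = nC *: (avg (a - U) + avg V) + c *: (1 : bop R G).
  have aU : avg a = avg (a - U) + avg U by rewrite -avgD subrK.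
  have avgU : avg U = c *: ((n%:R : R[i]) *: (1 : bop R G)) + avg V.
    by rewrite UE avgD avgZ avg1.
  have e1 : nC *: (c *: ((n%:R : R[i]) *: (1 : bop R G))) = c *: (1 : bop R G).
    by rewrite 2!scalerA mulrAC nCn mul1r.
  by rewrite aU avgU [in LHS](addrC (c *: _)) addrA scalerDr e1.
rewrite (_ : 1 - _ = - (nC *: (avg (a - U) + avg V)) - (c *: (1 : bop R G) - 1)); last first.
  by rewrite aE opprB opprD addrCA.
apply: le_trans (onormD _ _) _; rewrite !onormN.
have h1 : onorm (nC *: (avg (a - U) + avg V)) <= 4^-1.
  apply: le_trans (onorm_scaleR _ _) _; rewrite ger0_norm ?invr_ge0 ?ler0n//.
  rewrite mulrC ler_pdivrMr//; apply: le_trans (onormD _ _) _.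
  have hx : onorm (avg (a - U)) <= n%:R * 8^-1.
    by apply: le_trans (onorm_conj_sum _ _ _) _; rewrite ler_pM2l// ltW.
  by move: hx avgV; move: (onorm _) (onorm _) => u v; lra.
by move: h1 nc; move: (onorm _) (onorm _) => u v; lra.
Qed.

(** [delta1] is separating for LG, so a non-zero [T] has a non-zero coordinate [z] of [T delta1] at
    some [x]; translating by [x^-1] and dividing by [z] gives an element of trace 1. *)
Lemma ideal_trivial : I = [set 0] \/ I = A.
Proof.
have [h|/existsNP[T /not_implyP[IT T0]]] := pselect (forall T, I T -> T = 0).
  by left; apply/seteqP; split=> [T /h ->//|T ->]; exact: I0.
right; apply: ideal_full.
have hT := Cred_in_LG (IA IT).
have [x hx] : exists x, T (delta1 R G) x != 0 :> R[i].
  apply/not_existsP => h; apply: T0; apply: bop_single_eq => x c.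
  rewrite single_rho (in_LGP hT) bopZ (_ : T (delta1 R G) = 0) ?scaler0 ?bop0 ?bop_zeroE//.
  by apply: ell2_eqP => y; have /negP := h y; rewrite negbK => /eqP.
pose z : R[i] := T (delta1 R G) x.
apply: (@ideal_average (z^-1 *: (lambda R (x^-1)%g * T))).
  by apply: IZ; exact: (Il (Cred_lambda _)).
rewrite /ctrace bop_scaleE ell2ZE bop_mulE lambdaE invgK mulg1.
by rewrite -/z mulVf.
Qed.

End ideals.

Lemma Cred_simple : simple_cstar A.
Proof. by move=> I hI; exact: ideal_trivial. Qed.

End trace_and_simplicity.

Theorem corollary4p6 (R : realType) (G : groupType)
  (G_countable : countable [set: G])
  (G_torsionfree : torsionfree G)
  (ZG_without_kernel : forall a : {freeg G / int}, a != 0 ->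
     forall xi : ell2 R G, zgroup_ring_act R a xi = 0 -> xi = 0)
  (betti1_neq0 : l2betti1 R G <> 0%E) :
  simple_cstar (Cred R G) /\ has_unique_trace (Cred R G).
Proof.
have averages := powers_averages (fun a a0 => ZG_without_kernel a a0) G_torsionfree betti1_neq0.
by split; [exact: Cred_simple averages|exact: Cred_unique_trace averages].
Qed.
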